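(* Let $m\ge2$ be an integer and let $\bar r>1$, $\bar\beta>0$ be orbital stability constants for $m$ (as defined in the context). There exist constants $C_0,c_0,\beta_0>0$ such that the following holds. Let $\beta\in(0,\min(\beta_0,\bar\beta)]$ and $\varepsilon\in(0,c_0\beta^2]$, and let $\delta>0$ be such that the triple $(\beta,\varepsilon,\delta)$ is admissible for $\bar r$ (as defined in the context). Let $\omega_0=\mathbf 1_{A_0}$ with $A_0$ $m$-fold symmetric, $A_0\subset B_{\bar r}$, $\|\omega_0-\omega^{m,\beta}\|_{L^1(\mathbb R^2)}\le\delta$, let $\omega(t)=\mathbf 1_{A(t)}$ be the solution of the 2D Euler equations with initial data $\omega_0$, let $0<T\le\infty$ be such that $\bigcup_{t\in[0,T)}A(t)\subset B_{\bar r}$, and let $\Theta:[0,T)\to\mathbb R$ be a function satisfying $\sup_{t\in[0,T)}\|\omega(t)-\omega^{m,\beta}_{\Theta(t)}\|_{L^1(\mathbb R^2)}\le\varepsilon$. Then $$\big|\mathcal T_m\big[\Theta(t')-(\Theta(t)+\Omega^{m,\beta}(t'-t))\big]\big|\le C_0\,\varepsilon^{1/2}\qquad\text{whenever } t,t'\in[0,T)\text{ satisfy }|t-t'|\le c_0\beta .$$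
   Context: The 2D Euler equations in vorticity form on $\mathbb R^2$ are $\partial_t\omega+u\cdot\nabla\omega=0$, $u=-\nabla^\perp(-\Delta)^{-1}\omega$, where $(-\Delta)^{-1}\omega(x)=\frac1{2\pi}\int\ln\frac1{|x-x'|}\,\omega(x')\,dx'$ and the sign convention for $\nabla^\perp$ is such that positive vorticity induces counterclockwise rotation. For initial data $\omega_0=\mathbf 1_{A_0}$ with $A_0$ bounded and measurable, the solution is the unique global weak (Yudovich) solution; it has the form $\omega(t)=\mathbf 1_{A(t)}$, where $A(t)$ is the image of $A_0$ under the flow of $u$. $B_r$ is the open ball of radius $r$ centered at the origin; $(r,\theta)$ are polar coordinates; $R_\alpha$ is the counterclockwise rotation by angle $\alpha$ about the origin; $\omega_\alpha(x):=\omega(R_{-\alpha}x)$. A set $A\subset\mathbb R^2$ is $m$-fold symmetric if $R_{2\pi/m}[A]=A$. The map $\mathcal T_m:\mathbb R\to\mathbb T_m:=[-\frac\pi m,\frac\pi m)$ sends $\alpha$ to the unique $\tilde\alpha\in[-\frac\pi m,\frac\pi m)$ with $\alpha-\tilde\alpha=2k\pi/m$ for some integer $k$. Kelvin waves (reference radius $1$): it is known that for each integer $m\ge2$ and each sufficiently small $\beta>0$ there is a (for small $\beta$ unique) smooth function $g^{m,\beta}$ of the form $g^{m,\beta}(\theta)=\beta\cos(m\theta)+o(\beta)$ as $\beta\to0$, where the $o(\beta)$ term consists only of modes $\cos(km\theta)$ with integers $k>1$, such that $\omega^{m,\beta}:=\mathbf 1_{A^{m,\beta}}$, $A^{m,\beta}:=\{(r,\theta):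 r<1+g^{m,\beta}(\theta)\}$, rotates uniformly: for some $\Omega^{m,\beta}\in\mathbb R$ the function $(t,x)\mapsto \omega^{m,\beta}_{\Omega^{m,\beta}t}(x)$ solves the Euler equations. Moreover $g^{m,\beta}\to0$ in $C^1$ and $\Omega^{m,\beta}\to\frac{m-1}{2m}$ as $\beta\to0$. Admissible triple for $\bar r$: $(\beta,\varepsilon,\delta)$ is admissible if for every $m$-fold symmetric $A_0\subset B_{\bar r}$ with $\|\mathbf 1_{A_0}-\omega^{m,\beta}\|_{L^1}\le\delta$ and every $0<T\le\infty$ such that the solution $\omega(t)=\mathbf 1_{A(t)}$ with initial data $\mathbf 1_{A_0}$ satisfies $\bigcup_{t\in[0,T)}A(t)\subset B_{\bar r}$, there exists $\Theta:[0,T)\to\mathbb R$ with $\sup_{t\in[0,T)}\|\omega(t)-\omega^{m,\beta}_{\Theta(t)}\|_{L^1}\le\varepsilon$. Orbital stability constants for $m$: numbers $\bar r>1$, $\bar\beta>0$ such that for every $0<\beta<\bar\beta$ and every $\varepsilon>0$ there is $\delta>0$ with $(\beta,\varepsilon,\delta)$ admissible for $\bar r$. (Such constants exist for every $m\ge2$.) *)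

(* Defs.v *)
From HB Require Import structures.
From mathcomp Require Import all_boot all_order all_algebra.
From mathcomp Require Import all_classical all_reals all_analysis.
From mathcomp Require Import measurable_realfun.
From mathcomp Require Import lra.
Set Implicit Arguments.
Unset Strict Implicit.
Unset Printing Implicit Defensive.
Import Order.TTheory GRing.Theory Num.Theory.
Import numFieldNormedType.Exports.
Local Open Scope classical_set_scope.
Local Open Scope ring_scope.

Section Plane.
Context {R : realType}.

(* The library norm on [R * R] is the max norm. *)
Definition enorm (x : R * R) : R := Num.sqrt (x.1 ^+ 2 + x.2 ^+ 2).

Definition Ball (r : R) : set (R * R) := [set x | enorm x < r].

Definition rot (a : R) (x : R * R) : R * R :=
  (cos a * x.1 - sin a * x.2, sin a * x.1 + cos a * x.2).

Definition rotf (a : R) (w : R * R -> R) : R * R -> R := w \o rot (- a).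

Definition mfold (m : nat) (A : set (R * R)) : Prop :=
  rot (2 * pi / m%:R) @` A = A.

Definition leb2 :
    {measure set (measurableTypeR R * measurableTypeR R) -> \bar R} :=
  (@lebesgue_measure R \x @lebesgue_measure R)%E.

(* The sigma-algebra of [leb2] is the Borel one; Lebesgue measurable sets are
   those in its completion. The library integral is a supremum over Borel
   simple functions below the positive and negative parts, hence also gives
   the right value for integrands that are only Lebesgue measurable. *)
Definition lebesgue_measurable (A : set (R * R)) : Prop :=
  completed_algebra_gen leb2 A.

Definition lebesgue_measurable_fun (f : R * R -> R) : Prop :=
  forall B : set R, measurable B -> lebesgue_measurable (f @^-1` B).

Definition L1norm (f : R * R -> R) : \bar R := ('N[leb2]_1 [EFin \o f])%E.

End Plane.

Section Euler.
Context {R : realType}.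
Local Notation leb1 := (@lebesgue_measure R).
Local Notation leb2 := (@leb2 R).

Definition inv_neg_laplacian (w : R * R -> R) (x : R * R) : R :=
  (2 * pi)^-1 * \int[leb2]_y (ln ((enorm (x - y))^-1) * w y).

(* With this sign, [- nabla_perp] of the potential of a point vortex of
   positive strength is a counterclockwise rotation. *)
Definition nabla_perp (f : R * R -> R) (x : R * R) : R * R :=
  (- 'D_(0, 1) f x, 'D_(1, 0) f x).

Definition velocity (w : R * R -> R) (x : R * R) : R * R :=
  - nabla_perp (inv_neg_laplacian w) x.

Definition C1 (f : R * (R * R) -> R) : Prop :=
  (forall p, differentiable f p) /\
  (forall v, continuous (fun p => 'D_v f p)).

Definition test_function (f : R * (R * R) -> R) : Prop :=
  C1 f /\ exists r, forall t x, r <= enorm x -> f (t, x) = 0.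

Definition material_derivative (u : R * R -> R * R) (f : R * (R * R) -> R)
    (t : R) (x : R * R) : R :=
  'D_(1, (0, 0)) f (t, x) +
  ((u x).1 * 'D_(0, (1, 0)) f (t, x) + (u x).2 * 'D_(0, (0, 1)) f (t, x)).

(* Global weak solutions of the vorticity equation in Yudovich's class
   C([0,oo); L^1) /\ L^oo, with spatial supports bounded locally uniformly in
   time (which is automatic for boundedly supported initial data, and makes
   the logarithmic potential well defined). Only times t >= 0 matter; the
   initial datum is [w 0]. *)
Record yudovich_solution (w : R -> R * R -> R) : Prop := {
  yudovich_meas : forall t : R, 0 <= t -> lebesgue_measurable_fun (w t);
  yudovich_bounded : exists M : R, forall (t : R) x, 0 <= t -> `|w t x| <= M;
  yudovich_support : forall T : R, exists r : R,
    forall (t : R) x, 0 <= t <= T ->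
    r <= enorm x -> w t x = 0;
  yudovich_cont : forall t : R, 0 <= t ->
    L1norm (w s \- w t) @[s --> within [set s : R | 0 <= s] (nbhs t)] --> 0%E;
  yudovich_weak : forall f, test_function f -> forall t : R, 0 <= t ->
    \int[leb2]_x (w t x * f (t, x)) - \int[leb2]_x (w 0 x * f (0, x)) =
    \int[leb1]_(s in `[0, t])
      (\int[leb2]_x (w s x * material_derivative (velocity (w s)) f s x))
}.

Definition flow (u : R -> R * R -> R * R) (Phi : R -> R * R -> R * R) : Prop :=
  forall x, [/\ Phi 0 x = x,
    {within [set t : R | 0 <= t], continuous (fun t => Phi t x)} &
    forall t : R, 0 < t ->
      is_derive t (1 : R) (fun s => Phi s x) (u t (Phi t x))].

Definition patch_solution (A0 : set (R * R)) (A : R -> set (R * R)) : Prop :=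
  yudovich_solution (fun t => \1_(A t)) /\
  exists2 Phi, flow (fun t => velocity \1_(A t)) Phi &
    forall t : R, 0 <= t -> A t = Phi t @` A0.

End Euler.

Section Kelvin.
Context {R : realType}.

Definition polar_patch (g : R -> R) : set (R * R) :=
  [set x | exists r a, [/\ 0 <= r, r < 1 + g a & x = (r * cos a, r * sin a)]].

Definition smooth (f : R -> R) : Prop :=
  forall n x, derivable (derive1n n f) x 1.

(* [f] consists only of modes [cos (k m .)] with [k > 1]; the Fourier series
   of a smooth function converges absolutely. *)
Definition higher_modes (m : nat) (f : R -> R) : Prop :=
  exists a : R^nat, cvgn (series (fun k => `|a k|)) /\
    forall x, \sum_(2 <= k < n) a k * cos ((k * m)%:R * x) @[n --> \oo] --> f x.

(* [g b] and [Om b] are the profile and the angular velocity of the m-fold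
   Kelvin wave with parameter [b], for all sufficiently small [b > 0]. *)
Record kelvin_waves (m : nat) (g : R -> R -> R) (Om : R -> R) : Prop := {
  kelvin_smooth : \forall b \near (0 : R)^'+, smooth (g b);
  kelvin_modes : \forall b \near (0 : R)^'+,
    higher_modes m (fun x => g b x - b * cos (m%:R * x));
  kelvin_asymptotics : forall e : R, 0 < e -> \forall b \near (0 : R)^'+,
    forall x, `|g b x - b * cos (m%:R * x)| <= e * b;
  kelvin_rotates : \forall b \near (0 : R)^'+,
    yudovich_solution (fun t => rotf (Om b * t) \1_(polar_patch (g b)));
  kelvin_C1 : forall e : R, 0 < e -> \forall b \near (0 : R)^'+,
    forall x, `|g b x| <= e /\ `|derive1 (g b) x| <= e;
  kelvin_velocity : Om b @[b --> (0 : R)^'+] --> ((m%:R - 1) / (2 * m%:R) : R)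
}.

Definition tracks (g : R -> R) (A : R -> set (R * R)) (T : \bar R)
    (eps : R) (Theta : R -> R) : Prop :=
  (ereal_sup [set L1norm (\1_(A t) \- rotf (Theta t) \1_(polar_patch g))%R
             | t in [set t : R | (0 <= t)%R /\ t%:E < T]] <= eps%:E)%E.

Definition confined_patch (m : nat) (g : R -> R) (rbar delta : R)
    (A0 : set (R * R)) (A : R -> set (R * R)) (T : \bar R) : Prop :=
  [/\ lebesgue_measurable A0, mfold m A0, A0 `<=` Ball rbar &
      (L1norm (\1_A0 \- \1_(polar_patch g))%R <= delta%:E)%E] /\
  [/\ patch_solution A0 A, (0 < T)%E &
      \bigcup_(t in [set t : R | 0 <= t /\ (t%:E < T)%E]) A t `<=` Ball rbar].

Definition admissible (m : nat) (g : R -> R -> R) (rbar b eps delta : R) : Prop :=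
  forall A0 A T, confined_patch m (g b) rbar delta A0 A T ->
    exists Theta, tracks (g b) A T eps Theta.

Definition orbital_stability_constants (m : nat) (g : R -> R -> R)
    (rbar bbar : R) : Prop :=
  [/\ 1 < rbar, 0 < bbar & forall b eps : R, 0 < b < bbar -> 0 < eps ->
    exists2 delta : R, 0 < delta & admissible m g rbar b eps delta].

Definition Tm (m : nat) (a : R) : R :=
  a - (2 * pi / m%:R) * (Num.floor ((a + pi / m%:R) / (2 * pi / m%:R)))%:~R.

Lemma TmP (m : nat) (a : R) : (0 < m)%N ->
  - (pi / m%:R) <= Tm m a < pi / m%:R /\
  exists k : int, a - Tm m a = 2 * k%:~R * pi / m%:R.
Proof.
move=> m0; rewrite /Tm -[2 * pi / _]mulrA; set q := pi / m%:R.
set f := Num.floor _.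
have p0 : 0 < 2 * q by rewrite mulr_gt0 // divr_gt0 ?pi_gt0 // ltr0n.
have : f%:~R <= (a + q) / (2 * q) by exact: floor_le.
have : (a + q) / (2 * q) < (f + 1)%:~R by exact: floorD1_gt.
rewrite ler_pdivlMr // ltr_pdivrMr // intrD => fg fl.
split; last by exists f; rewrite opprB addrC subrK mulrAC mulrA.
by clearbody q f; apply/andP; split; nra.
Qed.

End Kelvin.

(* Main.v *)
From HB Require Import structures.
From mathcomp Require Import all_boot all_order all_algebra.
From mathcomp Require Import all_classical all_reals all_analysis.
From mathcomp Require Import measurable_realfun ring lra.
Require Import Defs.
Set Implicit Arguments.
Unset Strict Implicit.
Unset Printing Implicit Defensive.
Import Order.TTheory GRing.Theory Num.Theory.
Import numFieldNormedType.Exports.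
Local Open Scope classical_set_scope.
Local Open Scope ring_scope.

(** Why the statement holds.  Let f be the m-th angular mode, cut off outside a
large disk and rotating rigidly with the speed of the wave, and consider the
moment of the vorticity against f(t, .).  By the weak formulation the moment of
a solution is the time integral of the transport functional [Lam f w t], that
is, of the integral of w times the material derivative of f along the velocity
generated by w.  Three facts about this functional carry the proof.

- It vanishes at every rotated copy of the wave ([Lam_rotating_solution],
  [Lam_rotated_wave]): along the rotating solution it is constant in time by
  rotation invariance, while the moment does not change.
- It is Lipschitz in w for the L1 distance ([transport_lipschitz]): it is a
  bilinear expression in w whose kernel, of size the reciprocal distance, is
  integrable in each variable uniformly in the other.
- Hence, as long as the solution is within eps of rotated copies of the wave,
  the moment moves at speed O(eps), and it differs by O(eps) from the moment of
  the rotated wave ([moment_increment]).  This comparison is made at the two end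
  times only, so the angle Theta may vary arbitrarily in between.

The moment of the wave rotated by Theta against f(t, .) is, up to a phase, a
fixed vector rotated by m (Theta - Omega t).  Its length is at least a constant
times beta ([moment_lower_bound]), because the profile is beta cos(m theta) to
first order.  Over a time interval of length at most one, two such vectors are
within O(eps), so that m (Theta - Omega t) varies by O(eps / beta) modulo full
turns ([Tm_le]); finally eps / beta is at most eps^(1/2) when eps is at most
beta^2.

The velocity is a pointwise derivative of the logarithmic potential, so the
Biot-Savart law has to be established first ([derive_inv_neg_laplacian]); the
integrals it involves are controlled by one majorant, the product of
1 + |s|^(-3/4) over the two coordinates, which dominates |z|^(-3/2).  Rotation
invariance of the plane measure comes from writing rotations as products of
shears.  Patches are only Lebesgue measurable, and the time integrand of the
weak formulation is not known to be measurable; both are dealt with by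
properties of the integral that hold for arbitrary integrands
([integral_eq_off_null], [Rintegral_itv_increment]). *)

(** * Integrals of arbitrary integrands *)

Section NullSets.
Local Open Scope ereal_scope.
Context d (T : measurableType d) (R : realType).
Variable mu : {measure set T -> \bar R}.
Import HBNNSimple.

(** A simple function below f, set to zero on N, lies below g and has the same
integral; taking suprema needs no measurability of f or g. *)
Lemma ge0_le_integral_off_null (N : set T) (f g : T -> \bar R) :
  measurable N -> mu N = 0 -> (forall x, 0 <= f x) -> (forall x, 0 <= g x) ->
  (forall x, ~ N x -> f x <= g x) -> \int[mu]_x f x <= \int[mu]_x g x.
Proof.
move=> mN N0 f0 g0 fg; rewrite [leLHS]ge0_integralTE//.
apply/ge_ereal_sup => _ [h /= hf <-].
have mh : measurable_fun setT (EFin \o h) by exact/measurable_EFinP.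
rewrite -integralT_nnsfun.
rewrite (ge0_negligible_integral (N:=N))//; last by move=> x _; rewrite lee_fin.
rewrite integral_mkcond [leRHS]ge0_integralTE//.
have mNC : measurable (~` N) by exact: measurableC.
pose h' : {nnsfun T >-> R} := (h \* indic_nnsfun R mNC)%R.
have -> : \int[mu]_x ((fun x => (h x)%:E) \_ (setT `\` N)) x = sintegral mu h'.
  rewrite -integralT_nnsfun; apply: eq_integral => x _ /=.
  rewrite [RHS](_ : _ = (h x * \1_(~` N) x)%:E)// patchE setTD; case: ifPn => xN.
    by rewrite indicE xN mulr1.
  by rewrite indicE (negbTE xN) mulr0.
apply: ereal_sup_ubound; exists h' => // x /=.
rewrite [leLHS](_ : _ = (h x * \1_(~` N) x)%:E)// indicE.
case: (boolP (x \in ~` N)) => /=; rewrite ?mulr1 ?mulr0// inE => Nx.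
by rewrite (le_trans (hf x))// fg.
Qed.

(** The library integral is meaningful for arbitrary integrands (a supremum
of integrals of simple functions), and its invariance under null-set changes
holds without any measurability; this is what lets Lebesgue measurable
densities be traded for Borel ones. *)
Lemma integral_eq_off_null (N : set T) (f g : T -> \bar R) :
  measurable N -> mu N = 0 -> (forall x, ~ N x -> f x = g x) ->
  \int[mu]_x f x = \int[mu]_x g x.
Proof.
move=> mN N0 fg; rewrite integralE [RHS]integralE; congr (_ - _);
  apply/eqP; rewrite eq_le; apply/andP; split;
  apply: (ge0_le_integral_off_null mN N0) => // x Nx;
  by rewrite ?funeposE ?funenegE /= fg.
Qed.

End NullSets.

Section LowerIntegral.
Context {R : realType}.
Local Notation leb1 := (@lebesgue_measure R).
Import HBNNSimple.

(** A simple function below G on the long interval restricts to simple functions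
on the two measurable pieces; the second piece costs at most K times its
length. *)
Lemma ge0_integral_itv_increment (G : R -> \bar R) (K t t' : R) :
  0 <= t -> t <= t' -> (forall s, 0 <= s <= t' -> (0 <= G s <= K%:E)%E) ->
  (\int[leb1]_(s in `[0%R, t]) G s <= \int[leb1]_(s in `[0%R, t']) G s /\
   \int[leb1]_(s in `[0%R, t']) G s <=
   \int[leb1]_(s in `[0%R, t]) G s + (K * (t' - t))%:E)%E.
Proof.
move=> t0 tt' GK.
have K0 : 0 <= K.
  have /andP[a b] := GK t' (introT andP (conj (le_trans t0 tt') (lexx _))).
  by rewrite -lee_fin (le_trans a b).
have G0 s : `[0, t']%classic s -> (0 <= G s)%E.
  by rewrite /= in_itv /= => /GK /andP[].
have sub : `[0, t]%classic `<=` `[0, t']%classic.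
  by move=> s /=; rewrite !in_itv/= => /andP[-> /le_trans->].
have GR0 u : u <= t' -> forall s, (0 <= (G \_ `[0%R, u]) s)%E.
  move=> ut' s; rewrite patchE; case: ifPn => //; rewrite inE => us.
  by apply: G0; move: us; rewrite /= !in_itv/= => /andP[-> /le_trans->].
split.
  rewrite integral_mkcond [leRHS]integral_mkcond.
  apply: (@ge0_le_integral_off_null _ _ _ leb1 set0) => //.
  - by [exact: (GR0 t)|exact: (GR0 t')].
  - by [exact: (GR0 t)|exact: (GR0 t')].
  - move=> s _; rewrite [leLHS]patchE; case: ifPn => st.
      by rewrite patchE ifT// inE; apply: sub; rewrite inE in st.
    by [exact: (GR0 t)|exact: (GR0 t')].
rewrite [leLHS]integral_mkcond ge0_integralTE; last by [exact: (GR0 t)|exact: (GR0 t')].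
apply/ge_ereal_sup => _ [h /= hG <-].
have mh D : measurable_fun D (EFin \o h).
  by apply/measurable_EFinP; exact: measurable_funTS.
have h0 x : (0 <= (EFin \o h) x)%E by rewrite /= lee_fin.
have UE : `[0, t']%classic = `[0, t]%classic `|` `]t, t']%classic.
  apply/seteqP; split => s /=; rewrite !in_itv/=.
    move=> /andP[s0 st']; case: (leP s t) => st; [left|right]; exact/andP.
  move=> [/andP[-> /le_trans->]//|/andP[ts ->]].
  by rewrite (ltW (le_lt_trans t0 ts)).
have -> : sintegral leb1 h = (\int[leb1]_(s in `[0%R, t']) (EFin \o h) s)%E.
  rewrite -integralT_nnsfun [RHS]integral_mkcond; apply: eq_integral => s _.
  rewrite patchE; case: ifPn => // sN; have := hG s.
  rewrite patchE (negbTE sN) lee_fin => hs.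
  by apply/eqP; rewrite eqe eq_le hs /=.
rewrite UE ge0_integral_setU//; last first.
 rewrite disj_set2E; apply/eqP/seteqP; split => // s [] /=.
  by rewrite !in_itv/= => /andP[_ st] /andP[ts _]; rewrite ltNge st in ts.
apply: leeD.
  rewrite integral_mkcond [leRHS]integral_mkcond.
  apply: (@ge0_le_integral_off_null _ _ _ leb1 set0) => //.
  - by move=> s; rewrite patchE; case: ifPn.
  - by [exact: (GR0 t)|exact: (GR0 t')].
  - move=> s _; rewrite [leLHS]patchE [leRHS]patchE; case: ifPn => // st.
    have := hG s; rewrite patchE ifT//= inE.
    by apply: sub; rewrite inE in st.
apply: (@le_trans _ _ (\int[leb1]_(s in `]t, t']) cst K%:E s)%E).
  apply: ge0_le_integral => //.
  move=> s; rewrite /= in_itv/= => /andP[ts st'].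
  have s0 : 0 <= s <= t' by rewrite (ltW (le_lt_trans t0 ts)).
  apply: (le_trans (hG s)); rewrite patchE ifT ?inE/= ?in_itv//=.
  by have /andP[] := GK s s0.
rewrite integral_cst//= lebesgue_measure_itv/= lte_fin.
case: ifPn => _; first by rewrite EFinM EFinB.
by rewrite mule0 lee_fin mulr_ge0// subr_ge0.
Qed.

Lemma ge0_integral_itv_fin (G : R -> \bar R) (K t : R) :
  0 <= t -> (forall s, 0 <= s <= t -> (0 <= G s <= K%:E)%E) ->
  (\int[leb1]_(s in `[0%R, t]) G s \is a fin_num)%E.
Proof.
move=> t0 GK; have [_] := ge0_integral_itv_increment (lexx 0) t0 GK.
rewrite set_itv1 integral_set1 add0e => h.
rewrite ge0_fin_numE; first exact: le_lt_trans h (ltry _).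
by apply: integral_ge0 => s; rewrite /= in_itv /= => /GK /andP[].
Qed.

(** Additivity over adjacent intervals persists for non-measurable bounded
integrands, so a pointwise bound on the integrand bounds the increments. *)
Lemma Rintegral_itv_increment (G : R -> R) (K t t' : R) :
  0 <= t -> t <= t' -> (forall s, 0 <= s <= t' -> `|G s| <= K) ->
  `|(\int[leb1]_(s in `[0, t']) G s) - (\int[leb1]_(s in `[0, t]) G s)|
   <= K * (t' - t).
Proof.
move=> t0 tt' GK; have t'0 := le_trans t0 tt'.
have KP s : 0 <= s <= t' -> (0 <= (EFin \o G)^\+ s <= K%:E)%E.
  move=> /GK; rewrite ler_norml => /andP[a b].
  rewrite funeposE /= -EFin_max !lee_fin le_max lexx orbT ge_max b /=; lra.
have KN s : 0 <= s <= t' -> (0 <= (EFin \o G)^\- s <= K%:E)%E.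
  move=> /GK; rewrite ler_norml => /andP[a b].
  rewrite funenegE /= -EFin_max !lee_fin le_max lexx orbT ge_max /=; lra.
have sub (H : R -> \bar R) : (forall s, 0 <= s <= t' -> (0 <= H s <= K%:E)%E) ->
    (forall s, 0 <= s <= t -> (0 <= H s <= K%:E)%E).
  by move=> h s /andP[s0 st]; apply: h; rewrite s0 (le_trans st).
have [P1 P2] := ge0_integral_itv_increment t0 tt' KP.
have [N1 N2] := ge0_integral_itv_increment t0 tt' KN.
rewrite /Rintegral integralE [X in _ - fine X]integralE.
have Pt' := ge0_integral_itv_fin t'0 KP.
have Pt := ge0_integral_itv_fin t0 (sub _ KP).
have Nt' := ge0_integral_itv_fin t'0 KN.
have Nt := ge0_integral_itv_fin t0 (sub _ KN).
move: P1 P2 N1 N2 Pt' Pt Nt' Nt.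
set p := integral _ _ _; set p' := integral _ _ _.
set n := integral _ _ _; set n' := integral _ _ _.
move: p p' n n' => [p| |] [p'| |] [n| |] [n'| |]//.
rewrite -!EFinD !lee_fin /= => P1 P2 N1 N2 _ _ _ _.
by rewrite ler_norml; lra.
Qed.

End LowerIntegral.

(** * Measure preserving maps of the plane *)

Section MeasurePreserving.
Context d (T : measurableType d) (R : realType).
Variable mu : {measure set T -> \bar R}.

Definition measure_preserving (phi : T -> T) : Prop :=
  measurable_fun setT phi /\
  forall A, measurable A -> mu (phi @^-1` A) = mu A.

Lemma measure_preserving_comp (phi psi : T -> T) :
  measure_preserving phi -> measure_preserving psi ->
  measure_preserving (phi \o psi).
Proof.
move=> [mphi phiE] [mpsi psiE]; split; first exact: measurableT_comp.
move=> A mA; rewrite comp_preimage psiE ?phiE//.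
by rewrite -[X in measurable X]setTI; exact: mphi.
Qed.

Lemma ge0_integral_measure_preserving (phi : T -> T) (f : T -> \bar R) :
  measure_preserving phi -> measurable_fun setT f -> (forall x, 0 <= f x)%E ->
  (\int[mu]_x f (phi x) = \int[mu]_x f x)%E.
Proof.
move=> [mphi phiE] mf f0.
have <- := @ge0_integral_pushforward _ _ _ _ _ _ mphi mu setT f measurableT mf
  (fun y _ => f0 y).
by apply: eq_measure_integral => A mA _; exact: phiE.
Qed.

Lemma integral_measure_preserving (phi : T -> T) (f : T -> \bar R) :
  measure_preserving phi -> measurable_fun setT f ->
  (\int[mu]_x f (phi x) = \int[mu]_x f x)%E.
Proof.
move=> pphi mf; rewrite integralE [RHS]integralE; congr (_ - _)%E.
  rewrite -[RHS](ge0_integral_measure_preserving pphi)//.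
    by apply: eq_integral => x _; rewrite !funeposE.
  exact: measurable_funepos.
rewrite -[RHS](ge0_integral_measure_preserving pphi)//.
  by apply: eq_integral => x _; rewrite !funenegE.
exact: measurable_funeneg.
Qed.

End MeasurePreserving.

Section PlaneIsometries.
Context {R : realType}.
Local Notation line := (measurableTypeR R).
Local Notation plane := (measurableTypeR R * measurableTypeR R)%type.
Local Notation leb1 := (@lebesgue_measure R).
Local Notation leb2 := (@leb2 R).

Lemma measure_preserving_addr (a : R) :
  measure_preserving leb1 (fun s : line => s + a : line).
Proof.
have ma : measurable_fun setT (fun s : line => s + a : line).
  exact: measurable_funD.
split=> // A mA; apply/esym.
apply: (lebesgue_measure_unique (mu := pushforward leb1 (fun s : line => s + a : line))) => //.
move=> _ [[u v]] _ <-; rewrite /pushforward /=.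
transitivity (leb1 `](u - a), (v - a)]%classic).
  rewrite !lebesgue_measure_itv/= !lte_fin ltrD2r; case: ifPn => // _.
  by rewrite -!EFinB; congr EFin; ring.
congr (leb1 _).
by apply/seteqP; split => s /=; rewrite !in_itv/= ltrBlDr lerBrDr.
Qed.

Lemma measure_preserving_subl (a : R) :
  measure_preserving leb1 (fun s : line => a - s : line).
Proof.
have mN : measure_preserving leb1 (-%R : line -> line).
  split; first exact: oppr_measurable.
  by move=> A mA; exact: lebesgue_measureN.
have := measure_preserving_comp (measure_preserving_addr a) mN.
by congr measure_preserving; apply/funext => s /=; rewrite addrC.
Qed.

(** Cavalieri's principle: every vertical slice is moved by a length preserving
map. *)
Lemma measure_preserving_fiberwise (phi : R -> line -> line) :
  measurable_fun setT (fun p : plane => phi p.1 p.2) ->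
  (forall x, measure_preserving leb1 (phi x)) ->
  measure_preserving leb2 (fun p : plane => (p.1, phi p.1 p.2) : plane).
Proof.
move=> mphi pphi.
have mp : measurable_fun setT (fun p : plane => (p.1, phi p.1 p.2) : plane).
  by apply: measurable_fun_pair => //; exact: measurable_fst.
split=> // A mA; rewrite /leb2 /= /product_measure1.
apply: eq_integral => x _ /=.
rewrite -[in RHS](pphi x).2; last exact: measurable_xsection.
by congr (lebesgue_measure _); apply/seteqP; split => y /=; rewrite /xsection /= !inE.
Qed.

Lemma measure_preserving_swap :
  measure_preserving leb2 (fun p : plane => (p.2, p.1) : plane).
Proof.
have ms : measurable_fun setT (fun p : plane => (p.2, p.1) : plane).
  by apply: measurable_fun_pair; [exact: measurable_snd|exact: measurable_fst].
split=> // A mA; apply/esym.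
apply: (@product_measure_unique _ _ _ _ _ leb1 leb1
  (pushforward leb2 (fun p : plane => (p.2, p.1) : plane))) => // B C mB mC.
rewrite /pushforward /=.
transitivity (leb2 (C `*` B)).
  by congr (leb2 _); apply/seteqP; split => -[x y] /= [].
transitivity (leb1 C * leb1 B)%E; first exact: product_measure1E.
by rewrite muleC.
Qed.

Lemma measure_preserving_subl2 (x : R * R) :
  measure_preserving leb2 (fun y : plane => (x - y : plane)).
Proof.
have H (a : R) : measure_preserving leb2 (fun p : plane => (p.1, a - p.2) : plane).
  apply: (@measure_preserving_fiberwise (fun _ s => a - s)).
    by apply: measurable_funB => //; exact: measurable_snd.
  by move=> _; exact: measure_preserving_subl.
have := measure_preserving_comp (H x.2)
  (measure_preserving_comp measure_preserving_swap
    (measure_preserving_comp (H x.1) measure_preserving_swap)).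
by congr measure_preserving; apply/funext => -[y1 y2] /=; case: x => x1 x2.
Qed.

Lemma measure_preserving_shear_snd (c : R) :
  measure_preserving leb2 (fun p : plane => (p.1, p.2 + c * p.1) : plane).
Proof.
apply: (@measure_preserving_fiberwise (fun x s => s + c * x)).
  apply: measurable_funD; first exact: measurable_snd.
  by apply: measurable_funM => //; exact: measurable_fst.
by move=> x; exact: measure_preserving_addr.
Qed.

Lemma measure_preserving_shear_fst (c : R) :
  measure_preserving leb2 (fun p : plane => (p.1 + c * p.2, p.2) : plane).
Proof.
have := measure_preserving_comp measure_preserving_swap
  (measure_preserving_comp (measure_preserving_shear_snd c) measure_preserving_swap).
by congr measure_preserving; apply/funext => -[].
Qed.

Lemma rotD (a b : R) (x : R * R) : rot (a + b) x = rot a (rot b x).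
Proof. by rewrite /rot /= cosD sinD; congr pair; ring. Qed.

(** The right-hand side is the rotation by twice the angle of cosine c and sine s,
the left-hand side a product of shears of slopes - s / c, 2 s c and - s / c. *)
Lemma three_shears (c s x y : R) : c != 0 -> c ^+ 2 + s ^+ 2 = 1 ->
  (x + - (s / c) * y + - (s / c) * (y + (s * c + c * s) * (x + - (s / c) * y)),
   y + (s * c + c * s) * (x + - (s / c) * y)) =
  ((c * c - s * s) * x - (s * c + c * s) * y,
   (s * c + c * s) * x + (c * c - s * s) * y).
Proof.
move=> c0 cs.
have tt : - (s / c) * (s * c + c * s) = - (2 * s ^+ 2) by field.
have e1 : 1 + - (s / c) * (s * c + c * s) = c * c - s * s by rewrite tt -[X in X + _]cs; ring.
congr pair.
- transitivity ((1 + - (s / c) * (s * c + c * s)) * x +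
      (- (s / c) * (1 + (1 + - (s / c) * (s * c + c * s)))) * y); first ring.
  have e2 : 1 + (c * c - s * s) = 2 * c ^+ 2 by rewrite -[X in X + _]cs; ring.
  have e3 : - (s / c) * (2 * c ^+ 2) = - (s * c + c * s) by field.
  by rewrite e1 e2 e3 mulNr.
- transitivity ((s * c + c * s) * x +
      (1 + - (s / c) * (s * c + c * s)) * y); first ring.
  by rewrite e1.
Qed.

(** A rotation is a product of three shears as long as the half angle has a
nonzero cosine; halving the angle once more covers the remaining case. Shears
preserve the product measure by translation invariance on each line. *)
Lemma measure_preserving_rot (a : R) :
  measure_preserving leb2 (rot a : plane -> plane).
Proof.
have gen (b : R) : cos (b / 2) != 0 ->
    measure_preserving leb2 (rot b : plane -> plane).
  move=> cb0; set t := sin (b / 2) / cos (b / 2).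
  have := measure_preserving_comp (measure_preserving_shear_fst (- t))
    (measure_preserving_comp (measure_preserving_shear_snd (sin b))
      (measure_preserving_shear_fst (- t))).
  congr measure_preserving; apply/funext => -[x y]; rewrite /rot /=.
  have bE : b = b / 2 + b / 2 by field.
  have := cos2Dsin2 (b / 2).
  rewrite [in sin b]bE [in cos b]bE cosD sinD /t.
  exact: three_shears.
have [c0|c0] := eqVneq (cos (a / 2)) 0; last exact: gen.
have c1 : cos (a / 2 / 2) != 0.
  apply/eqP => c1; have aE : a / 2 = a / 2 / 2 + a / 2 / 2 by field.
  have c0' : cos (a / 2 / 2 + a / 2 / 2) = 0 by rewrite -aE.
  have := cos2Dsin2 (a / 2 / 2); move: c0'; rewrite cosD c1.
  rewrite mul0r sub0r => /eqP; rewrite oppr_eq0 mulf_eq0 orbb => /eqP ->.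
  by rewrite !expr0n addr0 => /eqP; rewrite eq_sym oner_eq0.
have := measure_preserving_comp (gen _ c1) (gen _ c1).
congr measure_preserving; apply/funext => x /=; rewrite -rotD; congr rot.
by field.
Qed.

End PlaneIsometries.

(** * An integrable majorant for the singular kernels *)

Section SingularMajorant.
Context {R : realType}.
Local Notation line := (measurableTypeR R).
Local Notation plane := (measurableTypeR R * measurableTypeR R)%type.
Local Notation leb1 := (@lebesgue_measure R).
Local Notation leb2 := (@leb2 R).

Lemma measurable_fun_line2plane (f : R -> R) (u : plane -> R) :
  continuous f -> measurable_fun setT u -> measurable_fun setT (f \o u).
Proof. by move=> cf mu; apply: measurableT_comp => //; exact: continuous_measurable_fun. Qed.

Lemma measurable_enorm : measurable_fun setT (enorm : plane -> R).
Proof.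
apply: (measurable_fun_line2plane (f := Num.sqrt) (u := fun x => x.1 ^+ 2 + x.2 ^+ 2)).
  exact: sqrt_continuous.
by apply: measurable_funD; apply: measurable_funX;
  [exact: measurable_fst|exact: measurable_snd].
Qed.

Lemma measurable_Ball (r : R) : measurable (Ball r : set plane).
Proof.
have -> : (Ball r : set plane) = (enorm : plane -> R) @^-1` `]-oo, r[.
  by apply/seteqP; split => x; rewrite /Ball /= in_itv.
by rewrite -[X in measurable X]setTI; exact: measurable_enorm.
Qed.

(** The exponent 3/4 is below 1, hence locally integrable on the line, and large
enough for the product over two coordinates to dominate |z|^(-3/2).  The value
at the origin is infinite so that pointwise bounds hold everywhere. *)
Definition kap (s : R) : \bar R :=
  if s == 0 then +oo%E else (1 + `|s| `^ (- (3 / 4)))%:E.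

Lemma kap_ge1 s : (1 <= kap s)%E.
Proof.
by rewrite /kap; case: ifP => _; rewrite ?leey// lee_fin lerDl powR_ge0.
Qed.

Lemma kap_ge0 s : (0 <= kap s)%E.
Proof. exact: le_trans (kap_ge1 s). Qed.

Lemma kapN s : kap (- s) = kap s.
Proof. by rewrite /kap oppr_eq0 normrN. Qed.

Lemma measurable_kap : measurable_fun setT (kap : line -> \bar R).
Proof.
apply: measurable_fun_ifT => //.
  exact: measurable_fun_eqr.
apply/measurable_EFinP; apply: measurable_funD => //.
apply: (measurableT_comp (f := @powR R ^~ _)); first exact: measurable_powR.
exact: normr_measurable.
Qed.

Lemma integral_powRN34_le (a : R) : 0 < a -> a < 1 ->
  (\int[leb1]_(s in `[a, 1%R]) (s `^ (- (3 / 4)))%:E <= 4%:E)%E.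
Proof.
move=> a0 a1.
have dF (x : R) : 0 < x ->
    is_derive x 1 (fun s : R => 4 * s `^ (1 / 4)) (x `^ (- (3 / 4))).
  move=> x0; have := is_derive1_powR (1 / 4) x0 => dx.
  have := is_deriveZ 4 dx.
  rewrite (_ : 4 *: _ = x `^ (- (3 / 4)))//.
  rewrite /GRing.scale /= (_ : 1 / 4 - 1 = - (3 / 4)); last by field.
  by rewrite mulrA mul1r mulfV ?mul1r.
have cF (x : R) : 0 < x -> {for x, continuous (fun s : R => 4 * s `^ (1 / 4))}.
  move=> x0; apply: differentiable_continuous; apply/derivable1_diffP.
  by have [] := dF _ x0.
rewrite (@continuous_FTC2 _ _ (fun s : R => 4 * s `^ (1 / 4)))//.
- rewrite powR1 mulr1 -EFinB lee_fin gerBl mulr_ge0//; exact: powR_ge0.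
- apply: continuous_in_subspaceT => x; rewrite inE/= in_itv/= => /andP[ax _].
  have x0 : 0 < x by exact: lt_le_trans ax.
  apply: differentiable_continuous; apply/derivable1_diffP.
  by have [] := is_derive1_powR (- (3 / 4)) x0.
- split.
  + move=> x; rewrite in_itv/= => /andP[ax _].
    by have [] := dF x (lt_trans a0 ax).
  + by apply: cvg_at_right_filter; exact: cF.
  + by apply: cvg_at_left_filter; exact: cF.
- move=> x; rewrite in_itv/= => /andP[ax _].
  rewrite derive1E; exact: (@derive_val _ _ _ _ _ _ _ (dF x (lt_trans a0 ax))).
Qed.

Lemma integral_kap_unit_le :
  (\int[leb1]_(s in `]0%R, 1%R]) kap s <= 5%:E)%E.
Proof.
have mp : measurable_fun setT (fun s : line => (s `^ (- (3 / 4)))%:E).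
  by apply/measurable_EFinP; exact: measurable_powR.
have : (\int[leb1]_(s in `]0%R, 1%R]) (s `^ (- (3 / 4)))%:E <= 4%:E)%E.
  pose F n : set line := `[(n.+2%:R^-1)%R, 1%R]%classic.
  have UE : `]0%R, 1%R]%classic = \bigcup_n F n.
    apply/seteqP; split => s /=.
      rewrite in_itv/= => /andP[s0 s1].
      have [n ns] : exists n : nat, s^-1 < n%:R.
        by exists (Num.trunc s^-1).+1; exact: truncnS_gt.
      exists n => //=; rewrite /F /= in_itv/= s1 andbT.
      rewrite invf_ple ?posrE//; apply: ltW; apply: (lt_le_trans ns).
      by rewrite ler_nat -addn2 leq_addr.
    move=> [n _] /=; rewrite /F set_itvcc in_itv/= => /andP[ns ->]; rewrite andbT.
    by apply: lt_le_trans ns; rewrite invr_gt0.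
  have cu : (\int[leb1]_(s in F n) (s `^ (- (3 / 4)))%:E)%E @[n --> \oo] -->
      (\int[leb1]_(s in \bigcup_n F n) (s `^ (- (3 / 4)))%:E)%E.
    apply: ge0_nondecreasing_set_cvg_integral.
    - move=> p q pq; rewrite subsetEset /F !set_itvcc => s /= /andP[ps ->].
      by rewrite andbT (le_trans _ ps)// lef_pV2 ?posrE// ler_nat !ltnS.
    - by move=> n; exact: measurable_itv.
    - by move=> n; exact: measurable_funTS.
    - by move=> n s _; rewrite lee_fin powR_ge0.
  rewrite UE; apply: (cvge_to_le cu); near=> n.
  apply: integral_powRN34_le; first by rewrite invr_gt0.
  by rewrite invf_lt1// ltr1n.
move=> h.
rewrite (eq_integral (fun s : line => 1%:E + (s `^ (- (3 / 4)))%:E)%E); last first.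
  move=> s; rewrite inE/= in_itv/= => /andP[s0 _].
  by rewrite /kap gt_eqF// gtr0_norm.
rewrite ge0_integralD//=; last 2 first.
- by move=> s _; rewrite lee_fin powR_ge0.
- exact: measurable_funTS.
rewrite integral_cst//= lebesgue_measure_itv/= lte01 sube0 mule1.
by rewrite (_ : 5%:E = 1 + 4%:E)%E ?leeD2l// -EFinD; congr EFin; ring.
Unshelve. all: by end_near.
Qed.

End SingularMajorant.

Section SingularMajorant2.
Context {R : realType}.
Local Notation line := (measurableTypeR R).
Local Notation plane := (measurableTypeR R * measurableTypeR R)%type.
Local Notation leb1 := (@lebesgue_measure R).
Local Notation leb2 := (@leb2 R).

Lemma powRN_le1 (u a : R) : 1 <= u -> 0 <= a -> u `^ (- a) <= 1.
Proof.
move=> u1 a0; rewrite powRN invf_le1 ?powR_gt0//; last exact: lt_le_trans u1.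
have <- : 1 `^ a = 1 :> R by rewrite powR1.
by rewrite ge0_ler_powR// nnegrE ?ler01// (le_trans ler01).
Qed.

(** At distance at least one from its singularity the majorant is at most 2;
closer to it, translation and reflection reduce to the unit interval. *)
Lemma integral_kap_le (L x : R) : 0 <= L ->
  (\int[leb1]_(s in `[(- L)%R, L]) kap (x - s)%R <= (4 * L + 10)%:E)%E.
Proof.
move=> L0.
pose k : line -> \bar R := kap \_ `]0, 1]%classic.
have k0 s : (0 <= k s)%E by apply: erestrict_ge0 => ? _; exact: kap_ge0.
have mk : measurable_fun setT k.
  by apply/(measurable_restrictT _ _).1 => //; apply: measurable_funTS; exact: measurable_kap.
have ik : (\int[leb1]_s k s <= 5%:E)%E.
  by rewrite -integral_mkcond; exact: integral_kap_unit_le.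
have pl := measure_preserving_subl x.
have pr := measure_preserving_addr (- x).
pose c : line -> \bar R := cst 2%:E \_ `[- L, L]%classic.
have c0 s : (0 <= c s)%E by apply: erestrict_ge0 => ? _; rewrite lee_fin.
have mc : measurable_fun setT c by apply/(measurable_restrictT _ _).1.
rewrite integral_mkcond.
apply: (@le_trans _ _ (\int[leb1]_s (c s + (k (x - s)%R + k (s - x)%R)))%E).
  apply: (@ge0_le_integral_off_null _ _ _ leb1 [set x]) => //.
  - exact: lebesgue_measure_set1.
  - by apply: erestrict_ge0 => ? _; exact: kap_ge0.
  - by move=> s; rewrite !adde_ge0.
  move=> s sx; rewrite patchE; case: ifPn => // sL; last by rewrite !adde_ge0.
  have u0 : x - s != 0 by rewrite subr_eq0; apply/eqP => xs; apply: sx.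
  have [u1|u1] := leP 1 `|x - s|.
    apply: (@le_trans _ _ (c s)); last by rewrite leeDl// adde_ge0.
    rewrite /c patchE sL /kap (negbTE u0) lee_fin.
    by have := powRN_le1 (a := 3 / 4) u1 ltac:(by []); lra.
  apply: (@le_trans _ _ (k (x - s)%R + k (s - x)%R)%E); last by rewrite leeDr.
  have [ugt|ult] := ltP 0 (x - s).
    apply: (@le_trans _ _ (k (x - s))); last by rewrite leeDl.
    rewrite /k patchE ifT// inE/= in_itv/= ugt /= -(gtr0_norm ugt); exact: ltW.
  apply: (@le_trans _ _ (k (s - x))); last by rewrite leeDr.
  have sx0 : 0 < s - x by rewrite -opprB oppr_gt0 lt_neqAle u0.
  rewrite /k patchE ifT; first by rewrite -[X in (_ <= kap X)%E]opprB kapN.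
  by rewrite inE/= in_itv/= sx0 /= -(gtr0_norm sx0) distrC ltW.
have mkl : measurable_fun setT (fun s : line => k (x - s)).
  by apply: (measurableT_comp mk); exact: pl.1.
have mkr : measurable_fun setT (fun s : line => k (s - x)).
  by apply: (measurableT_comp mk); exact: pr.1.
rewrite ge0_integralD//; last 2 first.
- by move=> s _; rewrite adde_ge0.
- exact: emeasurable_funD.
rewrite ge0_integralD//.
rewrite (ge0_integral_measure_preserving pl mk k0).
rewrite (ge0_integral_measure_preserving pr mk k0).
rewrite -integral_mkcond integral_cst//= lebesgue_measure_itv/= lte_fin.
have -> : ((4 * L + 10)%:E = (4 * L)%:E + (5%:E + 5%:E) :> \bar R)%E.
  by rewrite -!EFinD; congr EFin; ring.
apply: leeD; last exact: leeD.
case: ifPn => _; last by rewrite mule0 lee_fin mulr_ge0.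
by rewrite -EFinB -EFinM lee_fin; lra.
Qed.

Definition kap2 (z : R * R) : \bar R := (kap z.1 * kap z.2)%E.

Lemma kap2_ge1 z : (1 <= kap2 z)%E.
Proof.
by rewrite -[X in (X <= _)%E]mul1e /kap2 lee_pmul ?kap_ge1.
Qed.

Lemma kap2_ge0 z : (0 <= kap2 z)%E.
Proof. exact: le_trans (kap2_ge1 z). Qed.

Lemma kap2N z : kap2 (- z) = kap2 z.
Proof. by rewrite /kap2 /= !kapN. Qed.

Lemma measurable_kap2 : measurable_fun setT (kap2 : plane -> \bar R).
Proof.
by apply: emeasurable_funM; apply: (measurableT_comp measurable_kap);
  [exact: measurable_fst|exact: measurable_snd].
Qed.

Lemma norm_le_enorm1 (z : R * R) : `|z.1| <= enorm z.
Proof. by rewrite /enorm -sqrtr_sqr ler_wsqrtr// lerDl sqr_ge0. Qed.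

Lemma norm_le_enorm2 (z : R * R) : `|z.2| <= enorm z.
Proof. by rewrite /enorm -sqrtr_sqr ler_wsqrtr// lerDr sqr_ge0. Qed.

Lemma integral_kap2_Ball_le (L : R) (x : R * R) : 0 <= L ->
  (\int[leb2]_(y in Ball L) kap2 (x - y)%R <= ((4 * L + 10) ^+ 2)%:E)%E.
Proof.
move=> L0.
pose k (a : R) : line -> \bar R := (fun s : line => kap (a - s)) \_ `[- L, L]%classic.
have k0 a s : (0 <= k a s)%E by apply: erestrict_ge0 => ? _; exact: kap_ge0.
have mk a : measurable_fun setT (k a).
  apply/(measurable_restrictT _ _).1 => //; apply: measurable_funTS.
  by apply: (measurableT_comp measurable_kap); exact: (measure_preserving_subl a).1.
have mkk : measurable_fun setT (fun y : plane => k x.1 y.1 * k x.2 y.2)%E.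
  by apply: emeasurable_funM; apply: (measurableT_comp (mk _));
    [exact: measurable_fst|exact: measurable_snd].
rewrite integral_mkcond.
apply: (@le_trans _ _ (\int[leb2]_y (k x.1 y.1 * k x.2 y.2))%E).
  apply: (@ge0_le_integral_off_null _ _ _ leb2 set0) => //.
  - by apply: erestrict_ge0 => ? _; exact: kap2_ge0.
  - by move=> y; rewrite mule_ge0.
  move=> y _; rewrite patchE; case: ifPn; rewrite ?mule_ge0// inE => yL.
  have /ler_normlP[a1 b1] := le_trans (norm_le_enorm1 y) (ltW yL).
  have /ler_normlP[a2 b2] := le_trans (norm_le_enorm2 y) (ltW yL).
  rewrite /k !patchE !ifT// inE/= in_itv/= ?b1 ?b2 andbT lerNl//.
have -> : (\int[leb2]_y (k x.1 y.1 * k x.2 y.2) =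
           \int[leb1]_s (k x.1 s) * \int[leb1]_s (k x.2 s))%E.
  transitivity (\int[leb1]_s \int[leb1]_t (k x.1 s * k x.2 t))%E.
    by apply: (fubini_tonelli1 (m1 := leb1) (m2 := leb1) _ mkk) => y; rewrite mule_ge0.
  rewrite -ge0_integralZr//; last by apply: integral_ge0.
  by apply: eq_integral => s _; rewrite ge0_integralZl.
rewrite EFin_expe expe2 lee_pmul ?integral_ge0//.
- by rewrite -integral_mkcond; exact: integral_kap_le.
- by rewrite -integral_mkcond; exact: integral_kap_le.
Qed.

End SingularMajorant2.

(** * Pointwise bounds on the logarithmic kernel *)

Section KernelBounds.
Context {R : realType}.
Implicit Types z v : R * R.

Definition dot z v : R := z.1 * v.1 + z.2 * v.2.

(** The directional derivative of the logarithm of the Euclidean norm. *)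
Definition riesz_kernel v z : R := dot z v / enorm z ^+ 2.

Lemma enorm_ge0 z : 0 <= enorm z.
Proof. exact: sqrtr_ge0. Qed.

Lemma sqr_enorm z : enorm z ^+ 2 = z.1 ^+ 2 + z.2 ^+ 2.
Proof. by rewrite sqr_sqrtr// addr_ge0// sqr_ge0. Qed.

Lemma enorm_gt0 z : z != 0 -> 0 < enorm z.
Proof.
move=> z0; rewrite /enorm sqrtr_gt0 lt_neqAle addr_ge0 ?sqr_ge0// andbT eq_sym.
rewrite paddr_eq0 ?sqr_ge0// !sqrf_eq0; apply: contra z0 => /andP[/eqP a /eqP b].
by apply/eqP; case: z a b => ? ? /= -> ->.
Qed.

Lemma enorm0 : enorm (0 : R * R) = 0.
Proof. by rewrite /enorm /= expr0n addr0 sqrtr0. Qed.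

Lemma normr_dot_le z v : enorm v = 1 -> `|dot z v| <= enorm z.
Proof.
move=> v1; rewrite -(ler_pXn2r (n := 2)) ?nnegrE ?enorm_ge0//.
rewrite real_normK ?num_real// sqr_enorm /dot.
have : v.1 ^+ 2 + v.2 ^+ 2 = 1 by rewrite -sqr_enorm v1 expr1n.
case: z v {v1} => [a b] [c d] /= cd.
rewrite -subr_ge0; have -> : a ^+ 2 + b ^+ 2 - (a * c + b * d) ^+ 2 =
    (a ^+ 2 + b ^+ 2) * (1 - (c ^+ 2 + d ^+ 2)) + (a * d - b * c) ^+ 2 by ring.
by rewrite cd subrr mulr0 add0r sqr_ge0.
Qed.

Lemma kap2_eqy z : (z.1 == 0) || (z.2 == 0) -> kap2 z = +oo%E.
Proof.
move=> z0; rewrite /kap2; have [/eqP z1|z1] := boolP (z.1 == 0).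
  by rewrite {1}/kap z1 eqxx gt0_mulye// (lt_le_trans _ (kap_ge1 _)).
move: z0; rewrite (negbTE z1) /= => /eqP z2.
by rewrite [in X in (_ * X)%E]/kap z2 eqxx gt0_muley// (lt_le_trans _ (kap_ge1 _)).
Qed.

(** Because |z|^2 is at least |z.1| |z.2|. *)
Lemma powRN32_le_kap2 z : ((enorm z `^ (- (3 / 2)))%:E <= kap2 z)%E.
Proof.
have [/kap2_eqy->|] := boolP ((z.1 == 0) || (z.2 == 0)); first by rewrite leey.
rewrite negb_or => /andP[z1 z2]; rewrite /kap2 /kap (negbTE z1) (negbTE z2).
rewrite -EFinM lee_fin.
have p1 : 0 < `|z.1| by rewrite normr_gt0.
have p2 : 0 < `|z.2| by rewrite normr_gt0.
set a := `|z.1| `^ _; set b := `|z.2| `^ _.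
apply: (@le_trans _ _ (a * b)); last first.
  have : 0 <= a by exact: powR_ge0.
  have : 0 <= b by exact: powR_ge0.
  by nra.
rewrite /a /b -powRM ?(ltW p1) ?(ltW p2)//.
have zz : 0 < `|z.1| * `|z.2| by exact: mulr_gt0.
have ez : 0 < enorm z by apply: lt_le_trans p1 _; exact: norm_le_enorm1.
have -> : enorm z `^ (- (3 / 2)) = (enorm z ^+ 2) `^ (- (3 / 4)).
  rewrite -powR_mulrn ?(ltW ez)// -powRrM; congr (_ `^ _); by field.
rewrite !powRN.
rewrite lef_pV2 ?posrE ?powR_gt0 ?exprn_gt0//.
rewrite ge0_ler_powR// ?nnegrE ?(ltW zz) ?sqr_ge0//.
rewrite sqr_enorm -[z.1 ^+ 2]real_normK ?num_real// -[z.2 ^+ 2]real_normK ?num_real//.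
by have := sqr_ge0 (`|z.1| - `|z.2|); nra.
Qed.

Lemma powRN32E (p : R) : 0 < p -> p `^ (- (3 / 2)) = (Num.sqrt p ^+ 3)^-1.
Proof.
move=> p0; rewrite powRN; congr (_^-1).
rewrite -(powR12_sqrt (ltW p0)) -powR_mulrn ?powR_ge0// -powRrM.
by congr (_ `^ _); field.
Qed.

Lemma inv_enorm_le_kap2 z : ((enorm z)^-1%:E <= kap2 z)%E.
Proof.
have [->|z0] := eqVneq z 0; first by rewrite enorm0 invr0 (le_trans _ (kap2_ge1 _)).
have p0 := enorm_gt0 z0.
have [p1|p1] := leP 1 (enorm z).
  by apply: le_trans (kap2_ge1 _); rewrite lee_fin invf_le1.
apply: le_trans (powRN32_le_kap2 z); rewrite lee_fin -(powR_inv1 (ltW p0)).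
by rewrite ger_powR// ?p0 ?(ltW p1)//; lra.
Qed.

Lemma normr_riesz_kernel_le v z : enorm v = 1 -> `|riesz_kernel v z| <= (enorm z)^-1.
Proof.
move=> v1; have [->|z0] := eqVneq z 0.
  by rewrite /riesz_kernel enorm0 expr0n invr0 mulr0 normr0.
have p0 := enorm_gt0 z0.
rewrite /riesz_kernel normrM normfV [`|_ ^+ 2|]ger0_norm ?sqr_ge0// expr2 invfM mulrA.
by rewrite ler_piMl ?invr_ge0 ?enorm_ge0// ler_pdivrMr// mul1r normr_dot_le.
Qed.

Lemma normr_ln_inv_le (p : R) : 0 <= p -> `|ln p^-1| <= p + p^-1.
Proof.
rewrite le_eqVlt => /predU1P[<-|p0].
  by rewrite invr0 addr0 ln0// normr0.
have pV : 0 < p^-1 by rewrite invr_gt0.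
have l1 := ln_sublinear p0; have := ln_sublinear pV.
rewrite lnV ?posrE// => l2.
by rewrite ler_norml; apply/andP; split; lra.
Qed.

Lemma ln_ratio_le (p q H : R) : 0 < p -> 0 < q -> `|q - p| <= H ->
  ln q - ln p <= H / p.
Proof.
move=> p0 q0 /ler_normlP[_ qp].
rewrite -ln_div ?posrE//.
have -> : q / p = 1 + (q - p) / p by field; lra.
apply: (@le_trans _ _ ((q - p) / p)).
  apply: le_ln1Dx; have : 0 < q / p by rewrite divr_gt0.
  have -> : q / p = 1 + (q - p) / p by field; lra.
  by lra.
by rewrite ler_pM2r ?invr_gt0.
Qed.

(** With q^2 = p^2 (1 + t), the logarithm of 1 + t lies between t - 4 t^2 and t, as
1 + t is at least 1/4.  The term h^2 / (2 p^2) of t / 2 and the bound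
|t| <= 5 |h| / (2 p) make up the constant 13 = 1/2 + 2 (5/2)^2. *)
Lemma log_quotient_bound_far (p q s h : R) : 0 < p -> 0 < q ->
  q ^+ 2 = p ^+ 2 + 2 * h * s + h ^+ 2 -> `|s| <= p -> h != 0 -> `|h| <= p / 2 ->
  `|(ln q^-1 - ln p^-1) / h + s / p ^+ 2| <= 13 * `|h| / p ^+ 2.
Proof.
move=> p0 q0 qE sp h0 hp; have H0 : 0 < `|h| by rewrite normr_gt0.
have p20 : 0 < p ^+ 2 by rewrite exprn_gt0.
set t := (2 * h * s + h ^+ 2) / p ^+ 2.
have tE : 1 + t = q ^+ 2 / p ^+ 2 by rewrite qE /t; field; lra.
have t1 : 1 / 4 <= 1 + t.
  rewrite tE ler_pdivlMr// qE.
  have : - (`|h| * p) <= h * s.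
    rewrite -normrN lerNl (le_trans (ler_norm _))// -mulNr normrM !normrN.
    by rewrite ler_wpM2l.
  by have := real_normK (num_real h); nra.
have lnE : ln q - ln p = ln (1 + t) / 2.
  rewrite tE ln_div ?posrE ?exprn_gt0// !lnXn//; by field.
have up : ln (1 + t) <= t by apply: le_ln1Dx; lra.
have lo : t / (1 + t) <= ln (1 + t).
  have -> : ln (1 + t) = - ln (1 + t)^-1 by rewrite lnV ?posrE ?opprK//; lra.
  rewrite lerNr.
  have -> : ln (1 + t)^-1 = ln (1 + (- (t / (1 + t)))) by congr ln; field; lra.
  apply: le_ln1Dx.
  have -> : - (t / (1 + t)) = (1 + t)^-1 - 1 by field; lra.
  by have : 0 < (1 + t)^-1 by [rewrite invr_gt0; lra]; lra.
have tb : `|t| <= 5 / 2 * (`|h| / p).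
  have -> : t = h / p * (2 * s + h) / p by rewrite /t; field; lra.
  rewrite !normrM normfV (gtr0_norm p0) -mulrA mulrC ler_pM2r; last by rewrite divr_gt0.
  rewrite ler_pdivrMr// (le_trans (ler_normD _ _))// normrM normr_nat.
  by lra.
have t2 : t ^+ 2 <= 25 / 4 * (`|h| ^+ 2 / p ^+ 2).
  rewrite -[t ^+ 2]real_normK ?num_real//.
  have -> : 25 / 4 * (`|h| ^+ 2 / p ^+ 2) = (5 / 2 * (`|h| / p)) ^+ 2 by field; lra.
  by rewrite ler_pXn2r ?nnegrE// mulr_ge0// divr_ge0// (ltW p0).
have lo2 : t - 4 * t ^+ 2 <= ln (1 + t).
  apply: le_trans lo; rewrite ler_pdivlMr; last by lra.
  by have := sqr_ge0 t; nra.
rewrite !lnV ?posrE//.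
have -> : (- ln q - - ln p) / h + s / p ^+ 2 =
    - ((ln q - ln p - h * s / p ^+ 2) / h) by field; rewrite h0; lra.
rewrite normrN normrM normfV ler_pdivrMr// lnE.
have -> : 13 * `|h| / p ^+ 2 * `|h| = 13 * (`|h| ^+ 2 / p ^+ 2) by field; lra.
have hs : h * s / p ^+ 2 = t / 2 - `|h| ^+ 2 / p ^+ 2 / 2.
  by rewrite real_normK ?num_real// /t; field; lra.
rewrite hs; have : 0 <= `|h| ^+ 2 / p ^+ 2 by rewrite divr_ge0 ?sqr_ge0.
set X := `|h| ^+ 2 / p ^+ 2 in t2 *; move=> X0.
by rewrite ler_norml; apply/andP; split; lra.
Qed.

Lemma log_quotient_bound_near (p q s h : R) : 0 < p -> 0 < q ->
  `|q - p| <= `|h| -> `|s| <= p -> h != 0 ->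
  `|(ln q^-1 - ln p^-1) / h + s / p ^+ 2| <= 2 / p + q^-1.
Proof.
move=> p0 q0 qp sp h0; have H0 : 0 < `|h| by rewrite normr_gt0.
rewrite !lnV ?posrE//; apply: le_trans (ler_normD _ _) _.
have -> : 2 / p + q^-1 = (p^-1 + q^-1) + p^-1 by ring.
apply: lerD.
  rewrite normrM normfV ler_pdivrMr//.
  have a := ln_ratio_le p0 q0 qp.
  have b : ln p - ln q <= `|h| / q by apply: ln_ratio_le => //; rewrite distrC.
  have hp : 0 < `|h| / p by rewrite divr_gt0.
  have hq : 0 < `|h| / q by rewrite divr_gt0.
  by rewrite mulrDl mulrC [_ * `|h|]mulrC ler_norml; apply/andP; split; lra.
rewrite normrM normfV [`|_ ^+ 2|]ger0_norm ?sqr_ge0// expr2 invfM mulrA.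
by rewrite ler_piMl ?invr_ge0 ?(ltW p0)// ler_pdivrMr// mul1r.
Qed.

(** Far from the singularity the Taylor remainder is quadratic in h; near it,
the difference quotient is bounded by the reciprocal distances, which are
themselves at least comparable to 1/h. Interpolating both regimes at exponent
3/2 gives a locally integrable majorant with a factor vanishing with h. *)
Lemma log_quotient_bound z v (h : R) : enorm v = 1 -> h != 0 ->
  (`|(ln (enorm (z + h *: v))^-1 - ln (enorm z)^-1) / h + riesz_kernel v z|%:E <=
    (13 * Num.sqrt `|h|)%:E * (kap2 z + kap2 (z + h *: v)%R))%E.
Proof.
move=> v1 h0; have H0 : 0 < `|h| by rewrite normr_gt0.
have G0 : 0 < Num.sqrt `|h| by rewrite sqrtr_gt0.
have c0 : (0 < (13 * Num.sqrt `|h|)%:E)%E by rewrite lte_fin mulr_gt0.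
have [->|z0] := eqVneq z 0.
  by rewrite (@kap2_eqy 0) ?eqxx// addye -?ltNye ?(lt_le_trans _ (kap2_ge0 _))// gt0_muley// leey.
have [->|w0] := eqVneq (z + h *: v) 0.
  by rewrite (@kap2_eqy 0) ?eqxx// addey -?ltNye ?(lt_le_trans _ (kap2_ge0 _))// gt0_muley// leey.
have p0 := enorm_gt0 z0; have q0 := enorm_gt0 w0.
set p := enorm z in p0 *; set q := enorm (z + _) in q0 *.
have sp := normr_dot_le z v1; rewrite -/p in sp.
have qE : q ^+ 2 = p ^+ 2 + 2 * h * dot z v + h ^+ 2.
  rewrite !sqr_enorm /dot /=.
  have : v.1 ^+ 2 + v.2 ^+ 2 = 1 by rewrite -sqr_enorm v1 expr1n.
  rewrite /GRing.scale /= => vv.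
  transitivity (z.1 ^+ 2 + z.2 ^+ 2 + 2 * h * (z.1 * v.1 + z.2 * v.2) +
    h ^+ 2 * (v.1 ^+ 2 + v.2 ^+ 2)); first ring.
  by rewrite vv mulr1.
apply: (@le_trans _ _ (13 * Num.sqrt `|h| *
    (p `^ (- (3 / 2)) + q `^ (- (3 / 2))))%:E); last first.
  rewrite EFinM EFinD; apply: lee_wpmul2l; first exact: ltW.
  by apply: leeD; exact: powRN32_le_kap2.
rewrite lee_fin !powRN32E//.
set P := Num.sqrt p; set Q := Num.sqrt q; set G := Num.sqrt `|h|.
have P0 : 0 < P by rewrite sqrtr_gt0.
have Q0 : 0 < Q by rewrite sqrtr_gt0.
have pE : p = P ^+ 2 by rewrite sqr_sqrtr// ltW.
have qQ : q = Q ^+ 2 by rewrite sqr_sqrtr// ltW.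
have hE : `|h| = G ^+ 2 by rewrite sqr_sqrtr.
have hh : h ^+ 2 = `|h| ^+ 2 by rewrite real_normK ?num_real.
have P3 : 0 < (P ^+ 3)^-1 by rewrite invr_gt0 exprn_gt0.
have Q3 : 0 < (Q ^+ 3)^-1 by rewrite invr_gt0 exprn_gt0.
have hs : `|h * dot z v| <= `|h| * p by rewrite normrM ler_wpM2l.
have /ler_normlP[hs1 hs2] := hs.
have qp : `|q - p| <= `|h|.
  rewrite ler_norml; apply/andP; split.
    rewrite lerBrDl; have [ph|/ltW ph] := leP p `|h|; first by lra.
    rewrite -(ler_pXn2r (n := 2)) ?nnegrE ?subr_ge0 ?(ltW q0) ?ph// qE hh; nra.
  rewrite lerBlDl -(ler_pXn2r (n := 2)) ?nnegrE ?addr_ge0 ?(ltW p0) ?(ltW q0)// qE hh; nra.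
have [hp|hp] := leP `|h| (p / 2).
  apply: (le_trans (log_quotient_bound_far p0 q0 qE sp h0 hp)).
  have GP : G <= P by rewrite ler_sqrt ?(ltW p0)//; lra.
  apply: (@le_trans _ _ (13 * G * (P ^+ 3)^-1)); last first.
    by rewrite ler_wpM2l ?lerDl ?mulr_ge0 ?(ltW Q3) ?(ltW G0).
  rewrite hE pE.
  have -> : 13 * G ^+ 2 / (P ^+ 2) ^+ 2 = 13 * G * (P ^+ 3)^-1 * (G / P) by field; lra.
  by rewrite ler_piMr ?mulr_ge0 ?(ltW P3) ?(ltW G0)// ler_pdivrMr// mul1r.
apply: (le_trans (log_quotient_bound_near p0 q0 qp sp h0)).
have GP : P <= 2 * G.
  rewrite -(ler_pXn2r (n := 2)) ?nnegrE ?mulr_ge0 ?(ltW P0) ?(ltW G0)// exprMn -hE -pE; lra.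
have GQ : Q <= 2 * G.
  rewrite -(ler_pXn2r (n := 2)) ?nnegrE ?mulr_ge0 ?(ltW Q0) ?(ltW G0)// exprMn -hE -qQ.
  by move: qp => /ler_normlP[_]; lra.
have e1 : 2 / p <= 4 * G * (P ^+ 3)^-1.
  have -> : 2 / p = 2 * P * (P ^+ 3)^-1 by rewrite pE; field; lra.
  by rewrite ler_pM2r//; lra.
have e2 : q^-1 <= 2 * G * (Q ^+ 3)^-1.
  have -> : q^-1 = Q * (Q ^+ 3)^-1 by rewrite qQ; field; lra.
  by rewrite ler_pM2r//; lra.
have := mulr_gt0 G0 P3; have := mulr_gt0 G0 Q3; rewrite -/G; nra.
Qed.

End KernelBounds.

(** * The Biot-Savart law *)

Section BiotSavart.
Context {R : realType}.
Local Notation line := (measurableTypeR R).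
Local Notation plane := (measurableTypeR R * measurableTypeR R)%type.
Local Notation leb1 := (@lebesgue_measure R).
Local Notation leb2 := (@leb2 R).

Definition density (L : R) (w : plane -> R) : Prop :=
  [/\ measurable_fun setT w, forall x, `|w x| <= 1 &
      forall x, L <= enorm x -> w x = 0].

(** The integral of the majorant over a disk of radius L is at most this
constant, wherever its singularity sits. *)
Definition majorant_mass (L : R) : R := (4 * L + 10) ^+ 2.

Lemma majorant_mass_ge0 L : 0 <= majorant_mass L.
Proof. exact: sqr_ge0. Qed.

Lemma measurable_fun_subl2 (x : R * R) :
  measurable_fun setT (fun y : plane => (x - y : plane)).
Proof. exact: (measure_preserving_subl2 x).1. Qed.

Lemma measurable_dot (v : R * R) : measurable_fun setT (fun z : plane => dot z v).
Proof.
by apply: measurable_funD; apply: measurable_funM.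
Qed.

Lemma measurable_inv_enorm : measurable_fun setT (fun z : plane => (enorm z)^-1).
Proof.
have -> : (fun z : plane => (enorm z)^-1) = (@powR R ^~ (-1)) \o (enorm : plane -> R).
  by apply/funext => z /=; rewrite powR_inv1// enorm_ge0.
by apply: measurableT_comp; [exact: measurable_powR|exact: measurable_enorm].
Qed.

Lemma measurable_riesz_kernel (v : R * R) :
  measurable_fun setT (riesz_kernel v : plane -> R).
Proof.
have -> : (riesz_kernel v : plane -> R) =
    (fun z => dot z v * ((enorm z)^-1 ^+ 2)).
  by apply/funext => z; rewrite /riesz_kernel exprVn.
apply: measurable_funM; first exact: measurable_dot.
by apply: measurable_funX; exact: measurable_inv_enorm.
Qed.

Lemma measurable_log_kernel :
  measurable_fun setT (fun z : plane => ln (enorm z)^-1).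
Proof.
have -> : (fun z : plane => ln (enorm z)^-1) =
    (@ln R) \o (fun z : plane => (enorm z)^-1) by [].
by apply: measurableT_comp; [exact: measurable_ln|exact: measurable_inv_enorm].
Qed.

(** Two centres are allowed since a difference quotient of the potential is
singular at both of its end points. *)
Lemma integral_le_majorant (L c : R) (x x' : R * R) (f : plane -> R) :
  0 <= L -> 0 <= c -> measurable_fun setT f ->
  (forall y, L <= enorm y -> f y = 0) ->
  (forall y, enorm y < L ->
    (`|f y|%:E <= c%:E * (kap2 (x - y)%R + kap2 (x' - y)%R))%E) ->
  (\int[leb2]_y `|f y|%:E <= (2 * c * majorant_mass L)%:E)%E.
Proof.
move=> L0 c0 mf f0 fb.
have mk (z : R * R) : measurable_fun setT (fun y : plane => kap2 (z - y)).
  by apply: (measurableT_comp measurable_kap2); exact: measurable_fun_subl2.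
pose K (y : plane) := (c%:E * (kap2 (x - y)%R + kap2 (x' - y)%R))%E.
have k0 (z : R * R) (y : plane) : (0 <= kap2 (z - y)%R)%E by exact: kap2_ge0.
have K0 y : (0 <= K y)%E by rewrite mule_ge0// ?lee_fin// adde_ge0.
apply: (@le_trans _ _ (\int[leb2]_(y in Ball L) K y)%E).
  rewrite [leRHS]integral_mkcond.
  apply: (@ge0_le_integral_off_null _ _ _ leb2 set0) => //.
  - by apply: erestrict_ge0.
  move=> y _; rewrite patchE; case: ifPn; rewrite ?inE ?notin_setE /Ball /=.
    by move=> yL; exact: fb.
  by move=> /negP; rewrite -leNgt => yL; rewrite f0// normr0.
have mB := measurable_Ball L.
rewrite ge0_integralZl//; last 2 first.
- by apply: measurable_funTS; exact: emeasurable_funD.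
- by move=> y _; rewrite adde_ge0.
rewrite ge0_integralD//; last 2 first.
- exact: measurable_funTS.
- exact: measurable_funTS.
have -> : (2 * c * majorant_mass L)%:E =
    (c%:E * ((majorant_mass L)%:E + (majorant_mass L)%:E))%E.
  by rewrite -EFinD -EFinM; congr EFin; ring.
rewrite lee_wpmul2l//.
by apply: leeD; exact: integral_kap2_Ball_le.
Qed.

Lemma integrable_le_majorant (L c : R) (x x' : R * R) (f : plane -> R) :
  0 <= L -> 0 <= c -> measurable_fun setT f ->
  (forall y, L <= enorm y -> f y = 0) ->
  (forall y, enorm y < L ->
    (`|f y|%:E <= c%:E * (kap2 (x - y)%R + kap2 (x' - y)%R))%E) ->
  leb2.-integrable setT (EFin \o f).
Proof.
move=> L0 c0 mf f0 fb; apply/integrableP; split; first exact/measurable_EFinP.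
have := integral_le_majorant L0 c0 mf f0 fb => h.
by apply: le_lt_trans (ltry (2 * c * majorant_mass L)).
Qed.

Lemma density_mul_measurable L w (k : plane -> R) : density L w ->
  measurable_fun setT k -> measurable_fun setT (fun y => k y * w y).
Proof. by move=> [mw _ _] mk; exact: measurable_funM. Qed.

Lemma density_mul_eq0 L w (k : plane -> R) : density L w ->
  forall y, L <= enorm y -> k y * w y = 0.
Proof. by move=> [_ _ w0] y /w0 ->; rewrite mulr0. Qed.

Lemma density_mul_le L w (k : plane -> R) y : density L w -> `|k y * w y| <= `|k y|.
Proof. by move=> [_ w1 _]; rewrite normrM ler_piMr. Qed.

Lemma integrable_riesz (L : R) w v x : 0 <= L -> density L w -> enorm v = 1 ->
  leb2.-integrable setT (EFin \o (fun y => riesz_kernel v (x - y) * w y)).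
Proof.
move=> L0 dw v1; apply: (@integrable_le_majorant L 1 x x) => //.
- apply: density_mul_measurable dw _.
  by apply: (measurableT_comp (measurable_riesz_kernel v)); exact: measurable_fun_subl2.
- exact: density_mul_eq0 dw.
move=> y _; rewrite mul1e; apply: (@le_trans _ _ (kap2 (x - y))); last first.
  by rewrite leeDl// kap2_ge0.
apply: le_trans (inv_enorm_le_kap2 _); rewrite lee_fin.
apply: le_trans (normr_riesz_kernel_le _ v1).
exact: density_mul_le (fun y => riesz_kernel v (x - y)) y dw.
Qed.

Lemma enorm_le_normD (z : R * R) : enorm z <= `|z.1| + `|z.2|.
Proof.
rewrite -(ler_pXn2r (n := 2)) ?nnegrE ?enorm_ge0 ?addr_ge0// sqr_enorm.
rewrite -[z.1 ^+ 2]real_normK ?num_real// -[z.2 ^+ 2]real_normK ?num_real//.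
by have := normr_ge0 z.1; have := normr_ge0 z.2; nra.
Qed.

Lemma integrable_log (L : R) w x : 0 <= L -> density L w ->
  leb2.-integrable setT (EFin \o (fun y => ln (enorm (x - y))^-1 * w y)).
Proof.
move=> L0 dw; set M := `|x.1| + `|x.2| + 2 * L + 1.
have M0 : 1 <= M by rewrite /M lerDr !addr_ge0// mulr_ge0.
apply: (@integrable_le_majorant L M x x) => //; first lra.
- apply: density_mul_measurable dw _.
  by apply: (measurableT_comp measurable_log_kernel); exact: measurable_fun_subl2.
- exact: density_mul_eq0 dw.
move=> y yL.
apply: (@le_trans _ _ (M%:E * kap2 (x - y)%R + M%:E * kap2 (x - y)%R)%E); last first.
  by rewrite ge0_muleDr ?kap2_ge0.
apply: (@le_trans _ _ ((enorm (x - y)%R)%:E + ((enorm (x - y)%R)^-1)%:E)%E).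
  rewrite -EFinD lee_fin; apply: le_trans (normr_ln_inv_le (enorm_ge0 _)).
  exact: density_mul_le (fun y => ln (enorm (x - y))^-1) y dw.
apply: leeD.
  apply: (@le_trans _ _ (M%:E * 1)%E); last first.
    by rewrite lee_wpmul2l ?kap2_ge1// lee_fin; lra.
  rewrite mule1 lee_fin; apply: le_trans (enorm_le_normD _) _ => /=.
  have a := ler_normB x.1 y.1; have b := ler_normB x.2 y.2.
  have c := norm_le_enorm1 y; have d := norm_le_enorm2 y.
  rewrite /M; lra.
apply: le_trans (inv_enorm_le_kap2 _) _.
by rewrite -[leLHS]mul1e lee_wpmul2r ?kap2_ge0// lee_fin.
Qed.

(** Up to the factor - 1 / (2 pi), the derivative in direction v of the
logarithmic potential of w. *)
Definition riesz v (w : plane -> R) (x : R * R) : R :=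
  \int[leb2]_y (riesz_kernel v (x - y) * w y).

Lemma normr_riesz_le (L : R) w v x : 0 <= L -> density L w -> enorm v = 1 ->
  `|riesz v w x| <= 2 * majorant_mass L.
Proof.
move=> L0 dw v1.
apply: le_trans (le_normr_Rintegral _ (integrable_riesz x L0 dw v1)) _ => //.
rewrite -lee_fin /Rintegral fineK.
  rewrite -[2 * _]mul1r mulrA [1 * 2]mulrC.
  apply: (@integral_le_majorant L 1 x x) => //.
  - apply: density_mul_measurable dw _.
    by apply: (measurableT_comp (measurable_riesz_kernel v)); exact: measurable_fun_subl2.
  - exact: density_mul_eq0 dw.
  move=> y _; rewrite mul1e; apply: (@le_trans _ _ (kap2 (x - y))); last first.
    by rewrite leeDl// kap2_ge0.
  apply: le_trans (inv_enorm_le_kap2 _); rewrite lee_fin.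
  apply: le_trans (normr_riesz_kernel_le _ v1).
  exact: density_mul_le (fun y => riesz_kernel v (x - y)) y dw.
have /integrable_abse h := integrable_riesz x L0 dw v1.
exact: (integrable_fin_num _ h).
Qed.

(** Differentiating the logarithmic potential under the integral sign: the
error of the difference quotient is of order the square root of the
increment, uniformly over densities of a given radius. *)
Lemma potential_quotient_bound (L : R) w v x (h : R) :
  0 <= L -> density L w -> enorm v = 1 -> h != 0 ->
  `|h^-1 * (inv_neg_laplacian w (x + h *: v) - inv_neg_laplacian w x) -
    - (2 * pi)^-1 * riesz v w x|
  <= (2 * pi)^-1 * (26 * majorant_mass L) * Num.sqrt `|h|.
Proof.
move=> L0 dw v1 h0.
have p0 : 0 < (2 * pi)^-1 :> R by rewrite invr_gt0 mulr_gt0 ?pi_gt0.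
rewrite /inv_neg_laplacian.
set I1 := Rintegral _ _ _; set I0 := Rintegral _ _ _.
have -> : h^-1 * ((2 * pi)^-1 * I1 - (2 * pi)^-1 * I0) - - (2 * pi)^-1 * riesz v w x =
  (2 * pi)^-1 * (h^-1 * (I1 - I0) + riesz v w x) by ring.
set M := 26 * majorant_mass L.
have -> : (2 * pi)^-1 * M * Num.sqrt `|h| = (2 * pi)^-1 * (M * Num.sqrt `|h|) by ring.
rewrite normrM (gtr0_norm p0) ler_pM2l//.
have i1 := integrable_log (x + h *: v) L0 dw.
have i0 := integrable_log x L0 dw.
have ir := integrable_riesz x L0 dw v1.
pose E y := h^-1 * (ln (enorm (x + h *: v - y))^-1 * w y - ln (enorm (x - y))^-1 * w y)
   + riesz_kernel v (x - y) * w y.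
have iB : leb2.-integrable setT (EFin \o (fun y => ln (enorm (x + h *: v - y))^-1 * w y
    - ln (enorm (x - y))^-1 * w y)).
  by have := integrableB measurableT i1 i0; apply: eq_integrable.
have iZ : leb2.-integrable setT (EFin \o (fun y => h^-1 *
    (ln (enorm (x + h *: v - y))^-1 * w y - ln (enorm (x - y))^-1 * w y))).
  by have := integrableZl measurableT h^-1 iB; apply: eq_integrable.
have iE : leb2.-integrable setT (EFin \o E).
  by have := integrableD measurableT iZ ir; apply: eq_integrable.
have -> : h^-1 * (I1 - I0) + riesz v w x = \int[leb2]_y E y.
  by rewrite RintegralD// RintegralZl// RintegralB.
apply: le_trans (le_normr_Rintegral _ iE) _ => //.
rewrite -lee_fin /Rintegral fineK; last first.
  have /integrable_abse hE := iE; exact: (integrable_fin_num _ hE).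
have -> : M * Num.sqrt `|h| = 2 * (13 * Num.sqrt `|h|) * majorant_mass L.
  by rewrite /M; ring.
have EE y : E y = ((ln (enorm (x - y + h *: v))^-1 - ln (enorm (x - y))^-1) / h
    + riesz_kernel v (x - y)) * w y.
  by rewrite /E (_ : x + h *: v - y = x - y + h *: v); [ring|rewrite addrAC].
apply: (@integral_le_majorant L _ x (x + h *: v)) => //.
- by have /integrableP[/measurable_EFinP] := iE.
- by move=> y yL; rewrite EE; exact: (density_mul_eq0 (fun=> _) dw).
move=> y _; rewrite EE.
apply: (@le_trans _ _ (`|(ln (enorm (x - y + h *: v))^-1 - ln (enorm (x - y))^-1) / h
    + riesz_kernel v (x - y)|)%:E).
  by rewrite lee_fin; exact: (density_mul_le (fun=> _) y dw).
have -> : x + h *: v - y = x - y + h *: v by rewrite addrAC.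
exact: log_quotient_bound.
Qed.

Lemma derive_inv_neg_laplacian (L : R) w v x :
  0 <= L -> density L w -> enorm v = 1 ->
  'D_v (inv_neg_laplacian w) x = - (2 * pi)^-1 * riesz v w x.
Proof.
move=> L0 dw v1; rewrite /derive; apply: cvg_lim => //.
apply/cvgrPdist_le => e e0.
set C := (2 * pi)^-1 * (26 * majorant_mass L).
have C0 : 0 <= C.
  apply: mulr_ge0; first by rewrite invr_ge0 mulr_ge0// pi_ge0.
  by rewrite mulr_ge0// majorant_mass_ge0.
have C1 : 0 < C + 1 by rewrite ltr_wpDl.
have ec : 0 < e / (C + 1) by rewrite divr_gt0.
have d0 : 0 < (e / (C + 1)) ^+ 2 by rewrite exprn_gt0.
near=> h.
have h0 : h != 0 by near: h; exact: nbhs_dnbhs_neq.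
have B := potential_quotient_bound x L0 dw v1 h0.
rewrite [x + h *: v]addrC in B.
rewrite distrC /=; apply: le_trans B _; rewrite -/C.
have hd : `|h| <= (e / (C + 1)) ^+ 2.
  near: h; apply: dnbhs0_le; exact: d0.
have sh : Num.sqrt `|h| <= e / (C + 1).
  by rewrite -[leRHS](gtr0_norm ec) -[leRHS]sqrtr_sqr ler_wsqrtr.
apply: (@le_trans _ _ (C * (e / (C + 1)))); first exact: ler_wpM2l.
by rewrite mulrA ler_pdivrMr// mulrC ler_pM2l// lerDl.
Unshelve. all: by end_near.
Qed.

End BiotSavart.

(** * Lipschitz dependence of the transport functional *)

Section Transport.
Context {R : realType}.
Local Notation line := (measurableTypeR R).
Local Notation plane := (measurableTypeR R * measurableTypeR R)%type.
Local Notation leb1 := (@lebesgue_measure R).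
Local Notation leb2 := (@leb2 R).

(** Lebesgue measure on the plane with its sigma-finiteness attached, as
Tonelli's theorem over the product of two planes requires. *)
Definition sleb2 : set plane -> \bar R := (leb1 \x leb1)%E.

HB.instance Definition _ := Measure.on sleb2.

Let sleb2_sigma_finite : sigma_finite setT sleb2.
Proof.
pose F n : set line := `[- n%:R, n%:R]%classic.
exists (fun n => F n `*` F n).
  apply/seteqP; split => // -[x y] _.
  have [n [xn yn]] : exists n : nat, `|x| <= n%:R /\ `|y| <= n%:R.
    exists (Num.trunc (Num.max `|x| `|y|)).+1.
    have := truncnS_gt (Num.max `|x| `|y|).
    by rewrite gt_max => /andP[/ltW ? /ltW ?].
  exists n => //; rewrite /F /= !in_itv /=.
  by rewrite -!ler_norml.
move=> n; have mF : measurable (F n) by exact: measurable_itv.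
split; first exact: measurableX.
rewrite [X in (X < _)%E](_ : _ = leb1 (F n) * leb1 (F n))%E; last first.
  exact: product_measure1E.
have Fn : (leb1 (F n) < +oo)%E.
  rewrite lebesgue_measure_itv/=; case: ifPn => _; rewrite ?ltry//.
by rewrite lte_mul_pinfty// ge0_fin_numE.
Qed.

HB.instance Definition _ :=
  Measure_isSigmaFinite.Build _ plane R sleb2 sleb2_sigma_finite.

Lemma enorm_e1 : enorm ((1, 0) : R * R) = 1.
Proof. by rewrite /enorm /= expr0n addr0 expr1n sqrtr1. Qed.

Lemma enorm_e2 : enorm ((0, 1) : R * R) = 1.
Proof. by rewrite /enorm /= expr0n add0r expr1n sqrtr1. Qed.

Lemma velocityE (L : R) w x : 0 <= L -> density L w ->
  velocity w x = (- ((2 * pi)^-1 * riesz (0, 1) w x), (2 * pi)^-1 * riesz (1, 0) w x).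
Proof.
move=> L0 dw; rewrite /velocity /nabla_perp.
rewrite (derive_inv_neg_laplacian _ L0 dw enorm_e1).
rewrite (derive_inv_neg_laplacian _ L0 dw enorm_e2).
transitivity (- - (- (2 * pi)^-1 * riesz (0, 1) w x),
  - (- (2 * pi)^-1 * riesz (1, 0) w x)); first by [].
by congr pair; ring.
Qed.

Lemma measurable_convolution_integrand (k w : plane -> R) :
  measurable_fun setT k -> measurable_fun setT w ->
  measurable_fun setT (fun p : plane * plane => k (p.1 - p.2) * w p.2).
Proof.
move=> mk mw; apply: measurable_funM; last first.
  by apply: (measurableT_comp mw); exact: measurable_snd.
apply: (measurableT_comp mk).
apply: measurable_fun_pair => /=.
  apply: (measurable_funB (f := fun p : plane * plane => p.1.1)
    (g := fun p : plane * plane => p.2.1)).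
    by apply: (measurableT_comp (measurable_fst)); exact: measurable_fst.
  by apply: (measurableT_comp (measurable_fst)); exact: measurable_snd.
apply: (measurable_funB (f := fun p : plane * plane => p.1.2)
    (g := fun p : plane * plane => p.2.2)).
  by apply: (measurableT_comp (measurable_snd)); exact: measurable_fst.
by apply: (measurableT_comp (measurable_snd)); exact: measurable_snd.
Qed.

Lemma measurable_riesz (L : R) v w : density L w ->
  measurable_fun setT (riesz v w : plane -> R).
Proof.
move=> [mw _ _].
have mf := measurable_convolution_integrand (measurable_riesz_kernel v) mw.
pose f : plane * plane -> \bar R := EFin \o (fun p => riesz_kernel v (p.1 - p.2) * w p.2).
have mfe : measurable_fun setT f by exact/measurable_EFinP.
have mP := measurable_fun_fubini_tonelli_F (m2 := sleb2) (f^\+)%E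
  (measurable_funepos mfe) (funepos_ge0 f).
have mN := measurable_fun_fubini_tonelli_F (m2 := sleb2) (f^\-)%E
  (measurable_funeneg mfe) (funeneg_ge0 f).
have := emeasurable_funB mP mN => mD.
have -> : (riesz v w : plane -> R) = fine \o
   (fun x => fubini_F sleb2 (f^\+)%E x - fubini_F sleb2 (f^\-)%E x)%E.
  apply/funext => x /=; rewrite /riesz /Rintegral integralE; congr (fine (_ - _)%E).
  - by apply: eq_integral => y _; rewrite !funeposE.
  - by apply: eq_integral => y _; rewrite !funenegE.
by apply: measurableT_comp => //; exact: fine_measurable.
Qed.

Lemma riesz_dist_le (L : R) v w w' x : 0 <= L -> density L w -> density L w' ->
  enorm v = 1 ->
  (`|riesz v w x - riesz v w' x|%:E <=
     \int[leb2]_y (kap2 (x - y)%R * `|w y - w' y|%:E))%E.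
Proof.
move=> L0 dw dw' v1.
have i := integrable_riesz x L0 dw v1; have i' := integrable_riesz x L0 dw' v1.
have iB : leb2.-integrable setT (EFin \o (fun y => riesz_kernel v (x - y) * w y
    - riesz_kernel v (x - y) * w' y)).
  by have := integrableB measurableT i i'; apply: eq_integrable.
rewrite /riesz -RintegralB//.
apply: (@le_trans _ _ (\int[leb2]_y `|riesz_kernel v (x - y) * w y
    - riesz_kernel v (x - y) * w' y|)%:E).
  by rewrite lee_fin; apply: le_normr_Rintegral.
rewrite /Rintegral fineK; last first.
  by have /integrable_abse h := iB; exact: (integrable_fin_num _ h).
apply: (@ge0_le_integral_off_null _ _ _ leb2 set0) => //.
- by move=> y; rewrite mule_ge0// kap2_ge0.
move=> y _; rewrite -mulrBr normrM EFinM lee_wpmul2r//.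
apply: le_trans (inv_enorm_le_kap2 _); rewrite lee_fin.
exact: normr_riesz_kernel_le.
Qed.

(** The integrand of the weak formulation, with the time derivative a and the
gradient (b1, b2) of the test function kept as parameters. *)
Definition transport (a b1 b2 : R * R -> R) (w : R * R -> R) : R :=
  \int[leb2]_x (w x * (a x + ((velocity w x).1 * b1 x + (velocity w x).2 * b2 x))).

Section TransportLipschitz.
Variables (L K : R) (a b1 b2 : plane -> R).
Hypotheses (L0 : 0 <= L) (K0 : 0 <= K).
Hypotheses (ma : measurable_fun setT a) (mb1 : measurable_fun setT b1)
  (mb2 : measurable_fun setT b2).
Hypothesis bnd : forall x, enorm x < L -> [/\ `|a x| <= K, `|b1 x| <= K & `|b2 x| <= K].

Let F w x := a x + ((velocity w x).1 * b1 x + (velocity w x).2 * b2 x).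
Let M := K * (1 + 4 * majorant_mass L).

Let M0 : 0 <= M.
Proof. by rewrite mulr_ge0// addr_ge0// mulr_ge0// majorant_mass_ge0. Qed.

Let ipi : 0 < (2 * pi)^-1 :> R /\ (2 * pi)^-1 <= 1 :> R.
Proof.
have p := pi_ge2 R; split; first by rewrite invr_gt0; lra.
by rewrite invf_le1; lra.
Qed.

Let mF w : density L w -> measurable_fun setT (F w).
Proof.
move=> dw; apply: measurable_funD => //.
have vE : velocity w = (fun x =>
    (- ((2 * pi)^-1 * riesz (0, 1) w x), (2 * pi)^-1 * riesz (1, 0) w x)).
  by apply/funext => x; exact: velocityE L0 dw.
rewrite vE /=; apply: measurable_funD; apply: measurable_funM => //.
  apply: (measurable_funN (f := fun x => (2 * pi)^-1 * riesz (0, 1) w x)).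
  by apply: measurable_funM => //; exact: measurable_riesz dw.
by apply: measurable_funM => //; exact: measurable_riesz dw.
Qed.

Let Fle w x : density L w -> enorm x < L -> `|F w x| <= M.
Proof.
move=> dw /bnd [ba bb1 bb2].
have r1 := normr_riesz_le x L0 dw enorm_e1.
have r2 := normr_riesz_le x L0 dw enorm_e2.
have [i0 i1] := ipi.
have s r : `|r| <= 2 * majorant_mass L -> `|(2 * pi)^-1 * r| <= 2 * majorant_mass L.
  by move=> h; rewrite normrM (gtr0_norm i0) (le_trans _ h)// ler_piMl.
rewrite /F (velocityE x L0 dw) /=.
have -> : M = K + (2 * majorant_mass L * K + 2 * majorant_mass L * K).
  by rewrite /M; ring.
apply: le_trans (ler_normD _ _) _; apply: lerD => //.
apply: le_trans (ler_normD _ _) _; rewrite !(normrM, normrN).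
by apply: lerD; apply: ler_pM => //; rewrite -normrM; exact: s.
Qed.

Let phi_int w : density L w -> leb2.-integrable setT (EFin \o (fun x => w x * F w x)).
Proof.
move=> dw; have [mw w1 w0] := dw.
apply: (@integrable_le_majorant _ L M 0 0) => //.
- by apply: measurable_funM => //; exact: mF.
- by move=> y /w0 ->; rewrite mul0r.
move=> y yL; apply: (@le_trans _ _ (M%:E * 1)%E).
  rewrite mule1 lee_fin normrM -[leRHS]mul1r ler_pM//; exact: Fle.
rewrite lee_wpmul2l// (le_trans (kap2_ge1 (0 - y)))// leeDl//; exact: kap2_ge0.
Qed.

(** The quadratic dependence on the density is Lipschitz for the L1 distance:
the kernel of the Biot-Savart law is integrable in each variable, uniformly in
the other one, so an L1-small change of either factor has a small effect. *)
Lemma transport_lipschitz w w' (e : R) : density L w -> density L w' ->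
  (\int[leb2]_x `|w x - w' x|%:E <= e%:E)%E ->
  `|transport a b1 b2 w - transport a b1 b2 w'| <= K * (1 + 6 * majorant_mass L) * e.
Proof.
move=> dw dw' we.
have [mw w1 w0] := dw; have [mw' w1' w0'] := dw'.
have i := phi_int dw; have i' := phi_int dw'.
have iB : leb2.-integrable setT (EFin \o (fun x => w x * F w x - w' x * F w' x)).
  by have := integrableB measurableT i i'; apply: eq_integrable.
have -> : transport a b1 b2 w - transport a b1 b2 w' =
    \int[leb2]_x (w x * F w x - w' x * F w' x).
  exact: esym (RintegralB measurableT i i').
apply: le_trans (le_normr_Rintegral _ iB) _ => //.
rewrite -lee_fin /Rintegral fineK; last first.
  by have /integrable_abse h := iB; exact: (integrable_fin_num _ h).
have mk : measurable_fun setT (fun p : plane * plane =>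
    (kap2 (p.1 - p.2)%R * `|w p.2 - w' p.2|%:E)%E).
  apply: emeasurable_funM.
    apply: (measurableT_comp measurable_kap2).
    have := @measurable_fun_pair _ _ _ (plane * plane)%type line line
       (fun p => p.1.1 - p.2.1) (fun p => p.1.2 - p.2.2); apply.
      apply: (measurable_funB (f := fun p : plane * plane => p.1.1)
        (g := fun p : plane * plane => p.2.1)).
        by apply: (measurableT_comp (measurable_fst)); exact: measurable_fst.
      by apply: (measurableT_comp (measurable_fst)); exact: measurable_snd.
    apply: (measurable_funB (f := fun p : plane * plane => p.1.2)
      (g := fun p : plane * plane => p.2.2)).
      by apply: (measurableT_comp (measurable_snd)); exact: measurable_fst.
    by apply: (measurableT_comp (measurable_snd)); exact: measurable_snd.
  apply/measurable_EFinP; apply: measurableT_comp; first exact: normr_measurable.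
  apply: (measurable_funB (f := fun p : plane * plane => w p.2)
      (g := fun p : plane * plane => w' p.2)).
    by apply: (measurableT_comp mw); exact: measurable_snd.
  by apply: (measurableT_comp mw'); exact: measurable_snd.
pose P x := (\int[leb2]_y (kap2 (x - y)%R * `|w y - w' y|%:E))%E.
have k0 (x y : plane) : (0 <= kap2 (x - y)%R * `|w y - w' y|%:E)%E.
  by rewrite mule_ge0// kap2_ge0.
have P0 x : (0 <= P x)%E by apply: integral_ge0.
have mP : measurable_fun setT (P : plane -> \bar R).
  exact: (measurable_fun_fubini_tonelli_F (m2 := sleb2) _ mk (fun p => k0 p.1 p.2)).
have md : measurable_fun setT (fun x : plane => `|w x - w' x|%:E).
  apply/measurable_EFinP; apply: measurableT_comp; first exact: normr_measurable.
  exact: measurable_funB.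
have mBall := measurable_Ball L.
have e0 : 0 <= e by rewrite -lee_fin; apply: le_trans we; apply: integral_ge0.
have iP : (\int[leb2]_(x in Ball L) P x <= (majorant_mass L * e)%:E)%E.
  pose c : plane -> \bar R := cst 1%E \_ (Ball L).
  have c0 x : (0 <= c x)%E by apply: erestrict_ge0.
  have mc : measurable_fun setT c by apply/(measurable_restrictT _ _).1.
  have -> : (\int[leb2]_(x in Ball L) P x = \int[leb2]_x \int[leb2]_y
     (c x * (kap2 (x - y)%R * `|w y - w' y|%:E)))%E.
    rewrite integral_mkcond; apply: eq_integral => x _.
    rewrite patchE /c patchE; case: ifPn => _.
      by apply: eq_integral => y _; rewrite mul1e.
    by rewrite integral0_eq// => y _; rewrite mul0e.
  have mck : measurable_fun setT (fun p : plane * plane =>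
      (c p.1 * (kap2 (p.1 - p.2)%R * `|w p.2 - w' p.2|%:E))%E).
    by apply: emeasurable_funM => //; apply: (measurableT_comp mc); exact: measurable_fst.
  have := fubini_tonelli (m1 := sleb2) (m2 := sleb2) _ mck
    (fun p => mule_ge0 (c0 p.1) (k0 p.1 p.2)).
  move=> /= ->.
  apply: (@le_trans _ _ (\int[leb2]_y ((majorant_mass L)%:E * `|w y - w' y|%:E))%E).
    apply: (@ge0_le_integral_off_null _ _ _ leb2 set0) => //.
    - by move=> y; apply: integral_ge0 => x _; rewrite mule_ge0.
    - by move=> y; rewrite mule_ge0// lee_fin majorant_mass_ge0.
    move=> y _.
    have -> : (\int[leb2]_x (c x * (kap2 (x - y)%R * `|w y - w' y|%:E)) =
       (\int[leb2]_(x in Ball L) kap2 (y - x)%R) * `|w y - w' y|%:E)%E.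
      rewrite [X in (X * _)%E]integral_mkcond -ge0_integralZr//.
      - apply: eq_integral => x _; rewrite /c !patchE; case: ifPn => _.
          by rewrite mul1e -[in RHS]opprB kap2N.
        by rewrite !mul0e.
      - apply/(measurable_restrictT _ _).1 => //; apply: measurable_funTS.
        by apply: (measurableT_comp measurable_kap2); exact: measurable_fun_subl2.
      - by move=> x _; apply: erestrict_ge0 => ? _; exact: kap2_ge0.
    by rewrite lee_wpmul2r//; exact: integral_kap2_Ball_le.
  rewrite ge0_integralZl//; last by rewrite lee_fin majorant_mass_ge0.
  by rewrite [leRHS]EFinM; apply: lee_wpmul2l; rewrite // lee_fin majorant_mass_ge0.
apply: (@le_trans _ _ (\int[leb2]_x (M%:E * `|w x - w' x|%:E +
   (2 * K)%:E * (P \_ (Ball L)) x))%E).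
  have PB0 x : (0 <= (P \_ (Ball L)) x)%E by apply: erestrict_ge0.
  apply: (@ge0_le_integral_off_null _ _ _ leb2 set0) => //.
  - by move=> x; rewrite adde_ge0 ?mule_ge0// lee_fin ?mulr_ge0.
  move=> x _; have [xL|xL] := leP L (enorm x).
    have zero (p q r s : R) : p = 0 -> q = 0 -> p * r - q * s = 0.
      by move=> -> ->; rewrite !mul0r subrr.
    rewrite zero ?normr0; [|exact: w0|exact: w0'].
    by rewrite adde_ge0 ?mule_ge0// lee_fin ?mulr_ge0.
  have [ba bb1 bb2] := bnd xL.
  rewrite patchE ifT ?inE//.
  have split4 (p q r s : R) : p * r - q * s = (p - q) * r + q * (r - s) by ring.
  rewrite split4.
  apply: (@le_trans _ _ ((`|w x - w' x| * `|F w x|)%:E +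
      (`|w' x| * `|F w x - F w' x|)%:E)%E).
    by rewrite -EFinD lee_fin -!normrM ler_normD.
  apply: leeD.
    by rewrite -EFinM lee_fin mulrC ler_wpM2r//; exact: Fle.
  have [p0 p1] := ipi.
  have r1 := riesz_dist_le x L0 dw dw' enorm_e1.
  have r2 := riesz_dist_le x L0 dw dw' enorm_e2.
  rewrite -/(P x) in r1 r2.
  apply: (@le_trans _ _ (K%:E * (`|riesz (0, 1) w x - riesz (0, 1) w' x|%:E +
     `|riesz (1, 0) w x - riesz (1, 0) w' x|%:E))%E).
    rewrite -EFinD -EFinM lee_fin (le_trans (ler_piMl _ (w1' x)))//.
    have -> : F w x - F w' x = (2 * pi)^-1 *
      (- (riesz (0, 1) w x - riesz (0, 1) w' x) * b1 x +
       (riesz (1, 0) w x - riesz (1, 0) w' x) * b2 x).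
      by rewrite /F (velocityE x L0 dw) (velocityE x L0 dw') /=; ring.
    rewrite normrM (gtr0_norm p0) (le_trans (ler_piMl _ p1))//.
    rewrite (le_trans (ler_normD _ _))// !normrM normrN mulrDr.
    by apply: lerD; rewrite mulrC ler_wpM2r.
  rewrite [(2 * K)%R]mulrC EFinM -muleA lee_wpmul2l//.
  rewrite [(2%:E * _)%E]mule_natl mule2n; exact: leeD.
rewrite ge0_integralD//; last 4 first.
- by move=> x _; rewrite mule_ge0.
- exact: measurable_funeM.
- by move=> x _; rewrite mule_ge0 ?lee_fin ?mulr_ge0//; apply: erestrict_ge0.
- apply: measurable_funeM; apply/(measurable_restrictT _ _).1 => //.
  exact: measurable_funTS.
rewrite ge0_integralZl//.
rewrite ge0_integralZl//; last 3 first.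
- apply/(measurable_restrictT _ _).1 => //; exact: measurable_funTS.
- by move=> x _; apply: erestrict_ge0.
- by rewrite lee_fin mulr_ge0.
rewrite -integral_mkcond.
apply: (@le_trans _ _ (M%:E * e%:E + (2 * K)%:E * (majorant_mass L * e)%:E)%E).
  by apply: leeD; rewrite lee_wpmul2l// lee_fin mulr_ge0.
by rewrite -!EFinM -EFinD lee_fin le_eqVlt /M; apply/orP; left; apply/eqP; ring.
Qed.

End TransportLipschitz.
End Transport.

(** * Continuously differentiable functions *)

Section ContinuouslyDifferentiable.
Context {R : realType}.
Implicit Types V : normedModType R.

Definition cont_diff V (f : V -> R) : Prop :=
  (forall p, differentiable f p) /\ (forall v, continuous (fun p => 'D_v f p)).

Lemma cont_diff_continuous V (f : V -> R) : cont_diff f -> continuous f.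
Proof. by move=> [df _] p; exact: differentiable_continuous. Qed.

Lemma cont_diff_derivable V (f : V -> R) p v : cont_diff f -> derivable f p v.
Proof. by move=> [df _]; exact: diff_derivable. Qed.

Lemma cont_diff_cst V (c : R) : cont_diff (fun _ : V => c).
Proof.
split=> [p|v]; first exact: differentiable_cst.
have -> : (fun p : V => 'D_v (fun=> c) p) = fun=> 0.
  by apply/funext => p; rewrite derive_cst.
by move=> p; exact: cvg_cst.
Qed.

Lemma cont_diff_linear V (f : {linear V -> R}) : continuous f -> cont_diff f.
Proof.
move=> cf; split=> [p|v]; first exact: linear_differentiable.
have -> : (fun p : V => 'D_v f p) = fun=> f v.
  apply/funext => p; rewrite deriveE; last exact: linear_differentiable.
  by rewrite diff_lin.
by move=> p; exact: cvg_cst.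
Qed.

Lemma cont_diffD V (f g : V -> R) : cont_diff f -> cont_diff g ->
  cont_diff (fun p => f p + g p).
Proof.
move=> cf cg; split=> [p|v].
  by apply: differentiableD; [exact: cf.1|exact: cg.1].
have -> : (fun p : V => 'D_v (fun p => f p + g p) p) = fun p => 'D_v f p + 'D_v g p.
  by apply/funext => p; rewrite -deriveD//; exact: cont_diff_derivable.
by move=> p; apply: cvgD; [exact: cf.2|exact: cg.2].
Qed.

Lemma deriveM_cont_diff V (f g : V -> R) p v : cont_diff f -> cont_diff g ->
  'D_v (fun p => f p * g p) p = f p * 'D_v g p + g p * 'D_v f p.
Proof.
by move=> cf cg; rewrite (@deriveM _ _ f g)//; exact: cont_diff_derivable.
Qed.

Lemma deriveD_cont_diff V (f g : V -> R) p v : cont_diff f -> cont_diff g ->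
  'D_v (fun p => f p + g p) p = 'D_v f p + 'D_v g p.
Proof.
by move=> cf cg; rewrite (@deriveD _ _ _ f g)//; exact: cont_diff_derivable.
Qed.

Lemma cont_diffM V (f g : V -> R) : cont_diff f -> cont_diff g ->
  cont_diff (fun p => f p * g p).
Proof.
move=> cf cg; split=> [p|v].
  by apply: differentiableM; [exact: cf.1|exact: cg.1].
have -> : (fun p : V => 'D_v (fun p => f p * g p) p) =
    fun p => f p * 'D_v g p + g p * 'D_v f p.
  by apply/funext => p; rewrite deriveM_cont_diff.
have fc := cont_diff_continuous cf; have gc := cont_diff_continuous cg.
move=> p; apply: cvgD; apply: cvgM;
  [exact: fc|exact: cg.2|exact: gc|exact: cf.2].
Qed.

Lemma derive_comp_real V (phi : R -> R) (f : V -> R) p v :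
  derivable phi (f p) 1 -> differentiable f p ->
  'D_v (phi \o f) p = derive1 phi (f p) * 'D_v f p.
Proof.
move=> /derivable1_diffP dphi df.
rewrite deriveE; last exact: differentiable_comp.
rewrite diff_comp//= [in RHS]deriveE// derive1E' //.
by rewrite -[X in 'd phi _ X = _]mulr1 linearZ /= mulrC.
Qed.

Lemma cont_diff_comp_real V (phi dphi : R -> R) (f : V -> R) :
  (forall s : R, is_derive s 1 phi (dphi s)) -> continuous dphi ->
  cont_diff f -> cont_diff (fun p => phi (f p)).
Proof.
move=> dp cd cf.
have der (s : R) : derivable phi s 1 by have [] := dp s.
split=> [p|v].
  apply: (@differentiable_comp _ _ _ _ f phi); first exact: cf.1.
  exact/derivable1_diffP.
have -> : (fun p : V => 'D_v (fun p => phi (f p)) p) = fun p => dphi (f p) * 'D_v f p.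
  apply/funext => p; rewrite (@derive_comp_real _ phi f)//; last exact: cf.1.
  by rewrite derive1E (@derive_val _ _ _ _ _ _ _ (dp (f p))).
move=> p; apply: cvgM; last exact: cf.2.
apply: continuous_comp; last exact: cd.
exact: (cont_diff_continuous cf).
Qed.

Lemma differentiable_fst (U V : normedModType R) (p : U * V) :
  differentiable (fst : U * V -> U) p.
Proof.
pose F : {linear (U * V)%type -> U} := fst.
by apply: (@linear_differentiable _ _ _ F) => q; exact: cvg_fst.
Qed.

Lemma differentiable_snd (U V : normedModType R) (p : U * V) :
  differentiable (snd : U * V -> V) p.
Proof.
pose F : {linear (U * V)%type -> V} := snd.
by apply: (@linear_differentiable _ _ _ F) => q; exact: cvg_snd.
Qed.

Lemma cont_diff_snd (F : R * R -> R) : cont_diff F ->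
  cont_diff (fun q : R * (R * R) => F q.2).
Proof.
move=> cF; split=> [p|[a v]].
  apply: (@differentiable_comp _ _ _ _ snd F); first exact: differentiable_snd.
  exact: cF.1.
move=> p; apply: (@continuous_comp _ _ _ snd (fun x => 'D_v F x)).
  exact: cvg_snd.
exact: cF.2.
Qed.

Lemma cont_diff_fst (F : R -> R) : cont_diff F ->
  cont_diff (fun q : R * (R * R) => F q.1).
Proof.
move=> cF; split=> [p|[a v]].
  apply: (@differentiable_comp _ _ _ _ fst F); first exact: differentiable_fst.
  exact: cF.1.
move=> p; apply: (@continuous_comp _ _ _ fst (fun x => 'D_a F x)).
  exact: cvg_fst.
exact: cF.2.
Qed.

Lemma cont_diff_coord1 : cont_diff (fst : R * R -> R).
Proof.
pose F : {linear (R * R)%type -> R} := fst.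
by apply: (@cont_diff_linear _ F) => q; exact: cvg_fst.
Qed.

Lemma cont_diff_coord2 : cont_diff (snd : R * R -> R).
Proof.
pose F : {linear (R * R)%type -> R} := snd.
by apply: (@cont_diff_linear _ F) => q; exact: cvg_snd.
Qed.

Lemma bounded_on_Ball (G : R * R -> R) (L : R) : 0 <= L -> continuous G ->
  exists2 K, 0 <= K & forall x, enorm x < L -> `|G x| <= K.
Proof.
move=> L0 cG; pose A : set (R * R) := `[- L, L]%classic `*` `[- L, L]%classic.
have cA : compact A by apply: compact_setX; exact: segment_compact.
have [c cinA cmax] : exists2 c, c \in A & forall t, t \in A -> `|G t| <= `|G c|.
  apply: (@compact_EVT_max _ _ (fun x => `|G x|) A) => //.
    by exists 0; split; rewrite /= in_itv/= oppr_le0 L0.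
  apply: continuous_subspaceT => x.
  by apply: (@continuous_comp _ _ _ G (@Num.norm _ R)); [exact: cG|exact: norm_continuous].
exists `|G c| => // x xL; apply: cmax; rewrite inE; split; rewrite /= in_itv/= -ler_norml.
  exact: le_trans (norm_le_enorm1 x) (ltW xL).
exact: le_trans (norm_le_enorm2 x) (ltW xL).
Qed.

Local Notation plane := (measurableTypeR R * measurableTypeR R)%type.

(** Derivatives are Borel as pointwise limits of difference quotients. *)
Lemma measurable_derive (F : R * R -> R) v : (forall p, derivable F p v) ->
  measurable_fun setT (F : plane -> R) ->
  measurable_fun setT (fun x : plane => 'D_v F x : R).
Proof.
move=> dF mF.
pose u (n : nat) : R := n.+1%:R^-1.
apply: (@measurable_fun_cvg _ _ _ setT
  (fun n (x : plane) => (u n)^-1 * (F (u n *: v + x) - F x))).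
  move=> n; apply: measurable_funM => //; apply: measurable_funB => //.
  apply: (measurableT_comp mF); apply: measurable_fun_pair => /=.
    by apply: measurable_funD => //; exact: measurable_fst.
  by apply: measurable_funD => //; exact: measurable_snd.
move=> x _.
have u0 n : u n != 0 by rewrite /u invr_eq0 pnatr_eq0.
have cu : u n @[n --> \oo] --> (0 : R)^'.
  move=> A A0.
  have H : \forall n \near \oo, u n != 0 -> A (u n) by exact: (@cvg_harmonic R _ A0).
  rewrite /nbhs /=; apply: filterS H => n An; exact: An (u0 n).
have := @cvg_comp _ _ _ u (fun h => h^-1 *: (F (h *: v + x) - F x)) _ _ _ cu (dF x).
by apply.
Qed.

Lemma is_derive_quadratic_error (phi : R -> R) (s l : R) :
  (forall h, `|phi (h + s) - phi s - l * h| <= h ^+ 2) -> is_derive s 1 phi l.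
Proof.
move=> H.
have cv : h^-1 *: ((phi \o shift s) (h *: (1 : R)) - phi s) @[h --> 0^'] --> l.
  apply/cvgrPdist_le => e e0; near=> h.
  have h0 : h != 0 by near: h; exact: nbhs_dnbhs_neq.
  have he : `|h| <= e by near: h; apply: dnbhs0_le.
  apply: le_trans he; rewrite distrC /= /GRing.scale /= mulr1.
  have -> : h^-1 * (phi (h + s) - phi s) - l = h^-1 * (phi (h + s) - phi s - l * h).
    by field.
  rewrite normrM normfV ler_pdivrMl ?normr_gt0// (le_trans (H h))//.
  by rewrite -expr2 real_normK ?num_real.
split; first by apply/cvg_ex; exists l.
exact: cvg_lim cv.
Unshelve. all: by end_near.
Qed.

(** A continuously differentiable truncation, enough for a cutoff to be an
test function. *)
Definition sqr_pos (s : R) : R := Num.max 0 s ^+ 2.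

Lemma is_derive_sqr_pos (s : R) : is_derive s 1 sqr_pos (2 * Num.max 0 s).
Proof.
apply: is_derive_quadratic_error => h; rewrite /sqr_pos.
have h2 := sqr_ge0 h; have s2 := sqr_ge0 s; have hs2 := sqr_ge0 (h + s).
case: (leP 0 (h + s)) => a; case: (leP 0 s) => b; rewrite ler_norml; apply/andP; split;
  rewrite ?expr2 in h2 s2 hs2 *; nra.
Qed.

End ContinuouslyDifferentiable.

(** * Rotating test functions *)

Section RotatingTestFunctions.
Context {R : realType}.
Local Notation plane := (measurableTypeR R * measurableTypeR R)%type.
Implicit Types (x : R * R) (L Om c : R) (m n : nat).

(** Real and imaginary parts of the n-th power of x.1 + i x.2. *)
Fixpoint cpow n x : R * R :=
  if n is n'.+1 then
    (x.1 * (cpow n' x).1 - x.2 * (cpow n' x).2,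
     x.1 * (cpow n' x).2 + x.2 * (cpow n' x).1)
  else (1, 0).

Lemma cpow_rot n (a : R) x : cpow n (rot a x) =
  (cos (n%:R * a) * (cpow n x).1 - sin (n%:R * a) * (cpow n x).2,
   sin (n%:R * a) * (cpow n x).1 + cos (n%:R * a) * (cpow n x).2).
Proof.
elim: n => [|n IH] /=; first by rewrite mul0r cos0 sin0; congr pair; ring.
by rewrite IH /= -natr1 [(n%:R + 1) * a]mulrDl mul1r cosD sinD; congr pair; ring.
Qed.

Lemma cpow_polar n (r a : R) : cpow n (r * cos a, r * sin a) =
  (r ^+ n * cos (n%:R * a), r ^+ n * sin (n%:R * a)).
Proof.
elim: n => [|n IH] /=; first by rewrite mul0r cos0 sin0 expr0; congr pair; ring.
by rewrite IH /= -natr1 [(n%:R + 1) * a]mulrDl mul1r cosD sinD exprS; congr pair; ring.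
Qed.

Lemma enorm_rot (a : R) x : enorm (rot a x) = enorm x.
Proof.
rewrite /enorm; congr Num.sqrt; rewrite /rot /=.
transitivity ((cos a ^+ 2 + sin a ^+ 2) * (x.1 ^+ 2 + x.2 ^+ 2)); first ring.
by rewrite cos2Dsin2 mul1r.
Qed.

Lemma enorm_polar (r a : R) : 0 <= r -> enorm (r * cos a, r * sin a) = r.
Proof.
move=> r0; rewrite /enorm /=.
have -> : (r * cos a) ^+ 2 + (r * sin a) ^+ 2 = r ^+ 2 * (cos a ^+ 2 + sin a ^+ 2) by ring.
by rewrite cos2Dsin2 mulr1 sqrtr_sqr ger0_norm.
Qed.

Definition cutoff L x : R := sqr_pos (L ^+ 2 + 1 - (x.1 ^+ 2 + x.2 ^+ 2)).

(** The two real modes of angular frequency m, cut off outside a disk. *)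
Definition mode_cos L m x : R := cutoff L x * (cpow m x).1.
Definition mode_sin L m x : R := cutoff L x * (cpow m x).2.

Lemma cutoffE L x : cutoff L x = sqr_pos (L ^+ 2 + 1 - enorm x ^+ 2).
Proof. by rewrite (sqr_enorm x). Qed.

Lemma cutoff_rot L (a : R) x : cutoff L (rot a x) = cutoff L x.
Proof. by rewrite !cutoffE enorm_rot. Qed.

Lemma mode_cos_rot L m (a : R) x : mode_cos L m (rot a x) =
  cos (m%:R * a) * mode_cos L m x - sin (m%:R * a) * mode_sin L m x.
Proof. by rewrite /mode_cos /mode_sin cutoff_rot cpow_rot /=; ring. Qed.

(** A rigidly rotating mode, with phase c. *)
Definition wave L m Om c (p : R * (R * R)) : R :=
  mode_cos L m (rot (- (Om * p.1 + c)) p.2).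

Lemma waveE L m Om c : wave L m Om c =
  (fun p => cos (m%:R * (Om * p.1 + c)) * mode_cos L m p.2 +
            sin (m%:R * (Om * p.1 + c)) * mode_sin L m p.2).
Proof.
by apply/funext => p; rewrite /wave mode_cos_rot mulrN cosN sinN mulNr opprK.
Qed.

Lemma cont_diff_cpow n :
  cont_diff (fun x => (cpow n x).1) /\ cont_diff (fun x => (cpow n x).2).
Proof.
elim: n => [|n [IH1 IH2]] /=; first by split; exact: cont_diff_cst.
split.
  have h := cont_diffD (cont_diffM cont_diff_coord1 IH1)
    (cont_diffM (cont_diff_cst (R * R)%type (-1)) (cont_diffM cont_diff_coord2 IH2)).
  by move: h; congr cont_diff; apply/funext => x; rewrite mulN1r.
exact: (cont_diffD (cont_diffM cont_diff_coord1 IH2) (cont_diffM cont_diff_coord2 IH1)).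
Qed.

Lemma measurable_cpow n :
  measurable_fun setT (fun x : plane => (cpow n x).1 : R) /\
  measurable_fun setT (fun x : plane => (cpow n x).2 : R).
Proof.
elim: n => [|n [IH1 IH2]] /=; first by split; exact: measurable_cst.
split; [apply: measurable_funB|apply: measurable_funD]; apply: measurable_funM => //.
Qed.

Lemma cont_diff_cutoff L : cont_diff (cutoff L).
Proof.
have cq : cont_diff (fun x : R * R => L ^+ 2 + 1 - (x.1 ^+ 2 + x.2 ^+ 2)).
  have h := cont_diffD (cont_diff_cst (R * R)%type (L ^+ 2 + 1))
    (cont_diffM (cont_diff_cst (R * R)%type (-1))
      (cont_diffD (cont_diffM cont_diff_coord1 cont_diff_coord1)
         (cont_diffM cont_diff_coord2 cont_diff_coord2))).
  by move: h; congr cont_diff; apply/funext => x; rewrite mulN1r !expr2.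
apply: (cont_diff_comp_real is_derive_sqr_pos _ cq) => s.
apply: cvgM; first exact: cvg_cst.
apply: (@continuous_max _ _ (fun=> 0) id) => //; exact: cvg_cst.
Qed.

Lemma measurable_cutoff L : measurable_fun setT (cutoff L : plane -> R).
Proof.
apply: measurable_funX; apply: measurable_maxr => //.
apply: measurable_funB => //; apply: measurable_funD; apply: measurable_funX.
  exact: measurable_fst.
exact: measurable_snd.
Qed.

Lemma cont_diff_mode_cos L m : cont_diff (mode_cos L m).
Proof. exact: cont_diffM (cont_diff_cutoff L) (cont_diff_cpow m).1. Qed.

Lemma cont_diff_mode_sin L m : cont_diff (mode_sin L m).
Proof. exact: cont_diffM (cont_diff_cutoff L) (cont_diff_cpow m).2. Qed.

Lemma measurable_mode_cos L m : measurable_fun setT (mode_cos L m : plane -> R).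
Proof. exact: measurable_funM (measurable_cutoff L) (measurable_cpow m).1. Qed.

Lemma measurable_mode_sin L m : measurable_fun setT (mode_sin L m : plane -> R).
Proof. exact: measurable_funM (measurable_cutoff L) (measurable_cpow m).2. Qed.

Lemma is_derive_cos_phase m Om c (s : R) :
  is_derive s 1 (fun t : R => cos (m%:R * (Om * t + c)))
    (- (m%:R * Om * sin (m%:R * (Om * s + c)))).
Proof.
have d : is_derive s 1 (fun t : R => m%:R * (Om * t + c)) (m%:R * Om).
  apply: is_derive_quadratic_error => h.
  have -> : m%:R * (Om * (h + s) + c) - m%:R * (Om * s + c) - m%:R * Om * h = 0 by ring.
  by rewrite normr0 sqr_ge0.
have := @is_derive1_comp _ (@cos R) _ s _ _ (is_derive_cos _) d.
by move=> h; apply: is_derive_eq; ring.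
Qed.

Lemma is_derive_sin_phase m Om c (s : R) :
  is_derive s 1 (fun t : R => sin (m%:R * (Om * t + c)))
    (m%:R * Om * cos (m%:R * (Om * s + c))).
Proof.
have d : is_derive s 1 (fun t : R => m%:R * (Om * t + c)) (m%:R * Om).
  apply: is_derive_quadratic_error => h.
  have -> : m%:R * (Om * (h + s) + c) - m%:R * (Om * s + c) - m%:R * Om * h = 0 by ring.
  by rewrite normr0 sqr_ge0.
have := @is_derive1_comp _ (@sin R) _ s _ _ (is_derive_sin _) d.
by move=> h; apply: is_derive_eq; ring.
Qed.

Lemma cont_diff_id : cont_diff (id : R -> R).
Proof.
split=> [p|v]; first exact/derivable1_diffP/derivable_id.
by have -> : (fun p : R => 'D_v id p) = fun=> v;
  [apply/funext => p; rewrite derive_id|move=> p; exact: cvg_cst].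
Qed.

Lemma continuous_phase m Om c : continuous (fun t : R => m%:R * (Om * t + c)).
Proof.
move=> t; apply: cvgM; first exact: cvg_cst.
apply: cvgD; last exact: cvg_cst.
by apply: cvgM; [exact: cvg_cst|exact: cvg_id].
Qed.

Lemma cont_diff_cos_phase m Om c : cont_diff (fun t : R => cos (m%:R * (Om * t + c))).
Proof.
apply: (cont_diff_comp_real (is_derive_cos_phase m Om c) _ cont_diff_id) => t.
apply: cvgN; apply: cvgM; first exact: cvg_cst.
apply: continuous_comp; [exact: continuous_phase|exact: continuous_sin].
Qed.

Lemma cont_diff_sin_phase m Om c : cont_diff (fun t : R => sin (m%:R * (Om * t + c))).
Proof.
apply: (cont_diff_comp_real (is_derive_sin_phase m Om c) _ cont_diff_id) => t.
apply: cvgM; first exact: cvg_cst.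
apply: continuous_comp; [exact: continuous_phase|exact: continuous_cos].
Qed.

Lemma cont_diff_wave_terms L m Om c :
  cont_diff (fun p : R * (R * R) => cos (m%:R * (Om * p.1 + c)) * mode_cos L m p.2) /\
  cont_diff (fun p : R * (R * R) => sin (m%:R * (Om * p.1 + c)) * mode_sin L m p.2).
Proof.
split.
  exact: cont_diffM (cont_diff_fst (cont_diff_cos_phase m Om c))
    (cont_diff_snd (cont_diff_mode_cos L m)).
exact: cont_diffM (cont_diff_fst (cont_diff_sin_phase m Om c))
    (cont_diff_snd (cont_diff_mode_sin L m)).
Qed.

Lemma cont_diff_wave L m Om c : cont_diff (wave L m Om c).
Proof.
by rewrite waveE; apply: cont_diffD; [exact: (cont_diff_wave_terms _ _ _ _).1|
  exact: (cont_diff_wave_terms _ _ _ _).2].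
Qed.

Lemma derive_wave L m Om c (a : R) (v : R * R) (t : R) x : 'D_(a, v) (wave L m Om c) (t, x) =
  cos (m%:R * (Om * t + c)) * 'D_v (mode_cos L m) x +
  mode_cos L m x * 'D_a (fun t : R => cos (m%:R * (Om * t + c))) t +
  (sin (m%:R * (Om * t + c)) * 'D_v (mode_sin L m) x +
  mode_sin L m x * 'D_a (fun t : R => sin (m%:R * (Om * t + c))) t).
Proof.
have [h1 h2] := cont_diff_wave_terms L m Om c.
rewrite waveE (deriveD_cont_diff _ _ h1 h2).
rewrite (deriveM_cont_diff _ _ (cont_diff_fst (cont_diff_cos_phase m Om c))
    (cont_diff_snd (cont_diff_mode_cos L m))).
by rewrite (deriveM_cont_diff _ _ (cont_diff_fst (cont_diff_sin_phase m Om c))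
    (cont_diff_snd (cont_diff_mode_sin L m))).
Qed.

Lemma derive_wave_time L m Om c (t : R) x : 'D_(1, (0, 0)) (wave L m Om c) (t, x) =
  m%:R * Om * (cos (m%:R * (Om * t + c)) * mode_sin L m x -
               sin (m%:R * (Om * t + c)) * mode_cos L m x).
Proof.
rewrite derive_wave.
rewrite (@derive_val _ _ _ _ _ _ _ (is_derive_cos_phase m Om c t)).
rewrite (@derive_val _ _ _ _ _ _ _ (is_derive_sin_phase m Om c t)).
rewrite (_ : ((0, 0) : R * R) = 0)// !derive0; ring.
Qed.

Lemma derive_wave_space L m Om c (v : R * R) (t : R) x : 'D_(0, v) (wave L m Om c) (t, x) =
  cos (m%:R * (Om * t + c)) * 'D_v (mode_cos L m) x +
  sin (m%:R * (Om * t + c)) * 'D_v (mode_sin L m) x.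
Proof. by rewrite derive_wave !derive0 !mulr0 !addr0. Qed.

Lemma measurable_derive_wave L m Om c (t : R) :
  [/\ measurable_fun setT (fun x : plane => 'D_(1, (0, 0)) (wave L m Om c) (t, x)),
      measurable_fun setT (fun x : plane => 'D_(0, (1, 0)) (wave L m Om c) (t, x)) &
      measurable_fun setT (fun x : plane => 'D_(0, (0, 1)) (wave L m Om c) (t, x))].
Proof.
have mc := measurable_mode_cos L m; have ms := measurable_mode_sin L m.
have dc v : measurable_fun setT (fun x : plane => 'D_v (mode_cos L m) x : R).
  by apply: measurable_derive => // p; exact: cont_diff_derivable (cont_diff_mode_cos L m).
have ds v : measurable_fun setT (fun x : plane => 'D_v (mode_sin L m) x : R).
  by apply: measurable_derive => // p; exact: cont_diff_derivable (cont_diff_mode_sin L m).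
have sp v : measurable_fun setT (fun x : plane => 'D_(0, v) (wave L m Om c) (t, x)).
  under eq_fun do rewrite derive_wave_space.
  by apply: measurable_funD; apply: measurable_funM.
split; [|exact: sp|exact: sp].
under eq_fun do rewrite derive_wave_time.
apply: measurable_funM => //.
by apply: measurable_funB; apply: measurable_funM.
Qed.

Lemma test_function_wave L m Om c : 0 <= L -> test_function (wave L m Om c).
Proof.
move=> L0; split; first exact: (cont_diff_wave L m Om c).
exists (L + 1) => t x Lx; rewrite /wave /mode_cos cutoff_rot cutoffE /sqr_pos.
rewrite max_l ?expr0n ?mul0r//=.
have := ler_pM (addr_ge0 L0 ler01) (addr_ge0 L0 ler01) Lx Lx.
by rewrite -!expr2; nra.
Qed.

Lemma normr_combination_le (a u b w K : R) :
  `|a| <= 1 -> `|b| <= 1 -> `|u| <= K -> `|w| <= K -> `|a * u + b * w| <= 2 * K.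
Proof.
move=> a1 b1 uK wK; rewrite (le_trans (ler_normD _ _))// !normrM.
have -> : 2 * K = 1 * K + 1 * K by ring.
by apply: lerD; exact: ler_pM.
Qed.

Lemma wave_bounds L m : 0 <= L -> exists2 K, 0 <= K &
  forall (Om c t : R) (x : R * R), `|Om| <= 1 -> enorm x < L ->
  [/\ `|'D_(1, (0, 0)) (wave L m Om c) (t, x)| <= K,
      `|'D_(0, (1, 0)) (wave L m Om c) (t, x)| <= K,
      `|'D_(0, (0, 1)) (wave L m Om c) (t, x)| <= K &
      `|wave L m Om c (t, x)| <= K].
Proof.
move=> L0.
have cc := cont_diff_mode_cos L m; have cs := cont_diff_mode_sin L m.
have [K1 K10 B1] := bounded_on_Ball L0 (cont_diff_continuous cc).
have [K2 K20 B2] := bounded_on_Ball L0 (cont_diff_continuous cs).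
have [K3 K30 B3] := bounded_on_Ball L0 (cc.2 (1, 0)).
have [K4 K40 B4] := bounded_on_Ball L0 (cs.2 (1, 0)).
have [K5 K50 B5] := bounded_on_Ball L0 (cc.2 (0, 1)).
have [K6 K60 B6] := bounded_on_Ball L0 (cs.2 (0, 1)).
set S := K1 + K2 + K3 + K4 + K5 + K6.
have le_S : [/\ K1 <= S, K2 <= S & K3 <= S] /\ [/\ K4 <= S, K5 <= S & K6 <= S].
  by clear -K10 K20 K30 K40 K50 K60; split; split; rewrite /S; lra.
have [[k1 k2 k3] [k4 k5 k6]] := le_S.
have S0 : 0 <= S by rewrite /S !addr_ge0.
have m0 : 0 <= m%:R :> R by exact: ler0n.
exists (2 * S * (m%:R + 1)); first by rewrite !mulr_ge0// addr_ge0.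
have SS : 2 * S <= 2 * S * (m%:R + 1) by rewrite ler_peMr ?mulr_ge0// lerDr.
move=> Om c t x Om1 xL.
have := B1 x xL; have := B2 x xL; have := B3 x xL; have := B4 x xL.
have := B5 x xL; have := B6 x xL => b6 b5 b4 b3 b2 b1.
have C1 := cos_max (m%:R * (Om * t + c)); have S1 := sin_max (m%:R * (Om * t + c)).
split.
- rewrite derive_wave_time normrM [X in _ <= X]mulrC.
  apply: ler_pM => //.
    rewrite normrM ger0_norm// (@le_trans _ _ m%:R) ?lerDl//.
    by rewrite -[leRHS]mulr1 ler_wpM2l.
  rewrite -mulNr; apply: normr_combination_le => //; rewrite ?normrN//.
    exact: le_trans b2 k2.
  exact: le_trans b1 k1.
- rewrite derive_wave_space; apply: le_trans SS; apply: normr_combination_le => //.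
    exact: le_trans b3 k3.
  exact: le_trans b4 k4.
- rewrite derive_wave_space; apply: le_trans SS; apply: normr_combination_le => //.
    exact: le_trans b5 k5.
  exact: le_trans b6 k6.
- rewrite waveE; apply: le_trans SS; apply: normr_combination_le => //.
    exact: le_trans b1 k1.
  exact: le_trans b2 k2.
Qed.

End RotatingTestFunctions.

(** * Rotation equivariance and the rotating wave *)

Section BorelVersions.
Context {R : realType}.
Local Notation plane := (measurableTypeR R * measurableTypeR R)%type.
Local Notation leb2 := (@leb2 R).
Implicit Types w : R * R -> R.

Definition eq_off_null w w' : Prop := exists N : set plane,
  [/\ measurable N, leb2 N = 0%E & forall x, ~ N x -> w x = w' x].

Lemma Rintegral_eq_off_null w w' (k : R * R -> R) : eq_off_null w w' ->
  \int[leb2]_x (w x * k x) = \int[leb2]_x (w' x * k x).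
Proof.
move=> [N [mN N0 ww']]; rewrite /Rintegral; congr fine.
by apply: (integral_eq_off_null mN N0) => x Nx; rewrite ww'.
Qed.

Lemma velocity_eq_off_null w w' : eq_off_null w w' -> velocity w = velocity w'.
Proof.
move=> ww'; apply/funext => x.
suff E : inv_neg_laplacian w = inv_neg_laplacian w' by rewrite /velocity E.
apply/funext => {}x; rewrite /inv_neg_laplacian; congr (_ * _).
have := Rintegral_eq_off_null (fun y => ln (enorm (x - y))^-1) ww'.
by under eq_Rintegral do rewrite mulrC; move=> ->; apply: eq_Rintegral => y _; rewrite mulrC.
Qed.

Lemma integral_dist_eq_off_null w w' v v' : eq_off_null w w' -> eq_off_null v v' ->
  (\int[leb2]_x `|w x - v x|%:E = \int[leb2]_x `|w' x - v' x|%:E)%E.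
Proof.
move=> [N [mN N0 ww']] [N' [mN' N0' vv']].
transitivity (\int[leb2]_x `|w' x - v x|%:E)%E.
  by apply: (integral_eq_off_null mN N0) => x Nx; rewrite ww'.
by apply: (integral_eq_off_null mN' N0') => x Nx; rewrite vv'.
Qed.

Lemma borel_version_indic (L : R) (A : set (R * R)) :
  lebesgue_measurable A -> A `<=` Ball L ->
  exists2 w, density L w & eq_off_null \1_A w.
Proof.
move=> [B mB [N [N' [mN' N'0 NN']] BNA]] AL; exists \1_B.
  split.
  - exact: measurable_indic.
  - by move=> x; rewrite indicE; case: (x \in B); rewrite ?normr1 ?normr0.
  - move=> x Lx; rewrite indicE; case: (boolP (x \in B)) => //; rewrite inE => Bx.
    have : A x by rewrite -BNA; left.
    by move=> /AL; rewrite /Ball /= ltNge Lx.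
exists N'; split => // x N'x; rewrite !indicE -BNA; congr ((nat_of_bool _)%:R).
by apply/idP/idP; rewrite !inE; [case=> // /NN'|left].
Qed.

End BorelVersions.

Section Rotations.
Context {R : realType}.
Local Notation plane := (measurableTypeR R * measurableTypeR R)%type.
Local Notation leb2 := (@leb2 R).
Implicit Types (w : R * R -> R) (x : R * R) (a L : R).

Lemma rot0 x : rot 0 x = x.
Proof. by case: x => u v; rewrite /rot cos0 sin0 /=; congr pair; ring. Qed.

Lemma rotK a : cancel (rot a) (rot (- a) : R * R -> R * R).
Proof. by move=> x; rewrite -rotD addNr rot0. Qed.

Lemma rotB a x y : rot a (x - y) = rot a x - rot a y.
Proof. by case: x y => [? ?] [? ?]; rewrite /rot /=; congr pair; rewrite /=; ring. Qed.

Lemma density_rotf L a w : density L w -> density L (rotf a w).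
Proof.
move=> [mw w1 w0]; split.
- by apply: (measurableT_comp mw); exact: (measure_preserving_rot _).1.
- by move=> x; exact: w1.
- by move=> x Lx; rewrite /rotf /= w0// enorm_rot.
Qed.

Lemma eq_off_null_rotf a w w' : eq_off_null w w' -> eq_off_null (rotf a w) (rotf a w').
Proof.
move=> [N [mN N0 ww']]; have [mr rE] := measure_preserving_rot (- a).
exists (rot (- a) @^-1` N); split.
- by rewrite -[X in measurable X]setTI; exact: mr.
- by rewrite rE.
- by move=> x Nx; rewrite /rotf /= ww'.
Qed.

Lemma Rintegral_rotf L a w (k : plane -> R) : density L w -> measurable_fun setT k ->
  \int[leb2]_x (rotf a w x * k x) = \int[leb2]_x (w x * k (rot a x)).
Proof.
move=> dw mk; rewrite /Rintegral; congr fine.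
have [mw _ _] := density_rotf a dw.
rewrite -(integral_measure_preserving (measure_preserving_rot a)); last first.
  by apply/measurable_EFinP; exact: measurable_funM.
by apply: eq_integral => x _; rewrite /rotf /= rotK.
Qed.

Lemma riesz_kernel_rot v a z : riesz_kernel v (rot a z) = riesz_kernel (rot (- a) v) z.
Proof. by rewrite /riesz_kernel enorm_rot /dot /rot /= cosN sinN; congr (_ / _); ring. Qed.

Lemma riesz_rotf L v a w x : density L w ->
  riesz v (rotf a w) (rot a x) = riesz (rot (- a) v) w x.
Proof.
move=> dw; rewrite /riesz.
under eq_Rintegral do rewrite mulrC.
rewrite (Rintegral_rotf a (k := fun y : plane => riesz_kernel v (rot a x - y)) dw).
  by apply: eq_Rintegral => y _; rewrite -rotB riesz_kernel_rot mulrC.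
by apply: (measurableT_comp (measurable_riesz_kernel v)); exact: measurable_fun_subl2.
Qed.

Lemma riesz_combination L w u v x : 0 <= L -> density L w ->
  riesz (u, v) w x = u * riesz (1, 0) w x + v * riesz (0, 1) w x.
Proof.
move=> L0 dw; rewrite /riesz.
have i1 := integrable_riesz x L0 dw enorm_e1.
have i2 := integrable_riesz x L0 dw enorm_e2.
rewrite -!RintegralZl// -RintegralD//.
- apply: eq_Rintegral => y _; rewrite /riesz_kernel /dot /=; ring.
- by have := integrableZl measurableT u i1; apply: eq_integrable.
- by have := integrableZl measurableT v i2; apply: eq_integrable.
Qed.

Lemma velocity_rotf L a w x : 0 <= L -> density L w ->
  velocity (rotf a w) (rot a x) = rot a (velocity w x).
Proof.
move=> L0 dw; rewrite (velocityE _ L0 (density_rotf a dw)) (velocityE _ L0 dw).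
rewrite (riesz_rotf (0, 1) a x dw) (riesz_rotf (1, 0) a x dw).
have -> : rot (- a) ((0, 1) : R * R) = (sin a, cos a).
  by rewrite /rot cosN sinN /=; congr pair; ring.
have -> : rot (- a) ((1, 0) : R * R) = (cos a, - sin a).
  by rewrite /rot cosN sinN /=; congr pair; ring.
rewrite (riesz_combination (sin a) (cos a) x L0 dw).
rewrite (riesz_combination (cos a) (- sin a) x L0 dw).
by rewrite /rot /=; congr pair; ring.
Qed.

Lemma derive_space_linear (G : R * (R * R) -> R) (u v : R) p : cont_diff G ->
  'D_(0, (u, v)) G p = u * 'D_(0, (1, 0)) G p + v * 'D_(0, (0, 1)) G p.
Proof.
move=> [dG _]; rewrite !deriveE//.
have -> : ((0, (u, v)) : R * (R * R)) = u *: (0, (1, 0)) + v *: (0, (0, 1)).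
  transitivity ((u * 0 + v * 0, (u * 1 + v * 0, u * 0 + v * 1)) : R * (R * R)); last by [].
  by rewrite !mulr0 !mulr1 !addr0 add0r.
by rewrite linearD !linearZ.
Qed.

(** The screw motion (t, x) |-> (t + s, rot a x) is affine, so the difference
quotients on the two sides coincide. *)
Lemma derive_screw (G : R * (R * R) -> R) (al s a : R) (v x : R * R) :
  'D_(al, v) (fun p : R * (R * R) => G (p.1 + s, rot a p.2)) (0, x) =
  'D_(al, rot a v) G (s, rot a x).
Proof.
rewrite /derive; apply: (congr1 (fun F : R -> R => lim (F @ (0 : R)^'))).
apply/funext => h /=.
rewrite add0r; congr (_ *: (G _ - _)).
congr pair; first by rewrite /=; ring.
by case: x v => [? ?] [? ?]; rewrite /rot /=; congr pair; rewrite /= /GRing.scale /=; ring.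
Qed.

(** The integrand in time of the weak formulation. *)
Definition Lam (f : R * (R * R) -> R) w (s : R) : R :=
  \int[leb2]_x (w x * material_derivative (velocity w) f s x).

Lemma Lam_eq_off_null f w w' s : eq_off_null w w' -> Lam f w s = Lam f w' s.
Proof.
move=> ww'; rewrite /Lam (velocity_eq_off_null ww').
exact: Rintegral_eq_off_null.
Qed.

Lemma wave_screw L m Om c s a : wave L m Om (c + Om * s - a) =
  (fun p => wave L m Om c (p.1 + s, rot a p.2)).
Proof.
apply/funext => p; rewrite /wave -rotD.
by have -> : - (Om * (p.1 + s) + c) + a = - (Om * p.1 + (c + Om * s - a)) by ring.
Qed.

Lemma measurable_velocity L w : 0 <= L -> density L w ->
  measurable_fun setT (fun x : plane => (velocity w x).1 : R) /\
  measurable_fun setT (fun x : plane => (velocity w x).2 : R).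
Proof.
move=> L0 dw; split; under eq_fun do rewrite (velocityE _ L0 dw) /=.
  apply: (measurable_funN (f := fun x => (2 * pi)^-1 * riesz (0, 1) w x)).
  by apply: measurable_funM => //; exact: measurable_riesz dw.
by apply: measurable_funM => //; exact: measurable_riesz dw.
Qed.

Lemma measurable_material_derivative L w m Om c s : 0 <= L -> density L w ->
  measurable_fun setT
    (fun x : plane => material_derivative (velocity w) (wave L m Om c) s x : R).
Proof.
move=> L0 dw; have [m1 m2] := measurable_velocity L0 dw.
have [d0 d1 d2] := measurable_derive_wave L m Om c s.
apply: measurable_funD; first exact: d0.
by apply: measurable_funD; [exact: measurable_funM m1 d1|exact: measurable_funM m2 d2].
Qed.

(** A rotation of the density commutes with the Biot-Savart law, and moving it to
the test function only shifts the phase of the wave. *)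
Lemma Lam_rotf L m Om c w a s : 0 <= L -> density L w ->
  Lam (wave L m Om c) (rotf a w) s = Lam (wave L m Om (c + Om * s - a)) w 0.
Proof.
move=> L0 dw; rewrite /Lam (Rintegral_rotf _ dw); last first.
  exact: measurable_material_derivative (density_rotf a dw).
apply: eq_Rintegral => x _; congr (_ * _).
rewrite /material_derivative (velocity_rotf _ _ L0 dw) wave_screw !derive_screw.
have -> : rot a ((0, 0) : R * R) = (0, 0) by rewrite /rot /= !mulr0 subrr addr0.
have -> : rot a ((1, 0) : R * R) = (cos a, sin a) by rewrite /rot /=; congr pair; ring.
have -> : rot a ((0, 1) : R * R) = (- sin a, cos a) by rewrite /rot /=; congr pair; ring.
rewrite (derive_space_linear (cos a) (sin a) _ (cont_diff_wave L m Om c)).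
rewrite (derive_space_linear (- sin a) (cos a) _ (cont_diff_wave L m Om c)).
set W := wave L m Om c; set p := (s, rot a x).
move: (velocity w x) ('D_(1, (0, 0)) W p) ('D_(0, (1, 0)) W p) ('D_(0, (0, 1)) W p).
by move=> v d0 d1 d2; rewrite /rot /=; ring.
Qed.

Lemma wave_rot L m Om c s a x :
  wave L m Om c (s, rot a x) = wave L m Om (c + Om * s - a) (0, x).
Proof. by rewrite wave_screw /= add0r. Qed.

Lemma measurable_wave L m Om c s :
  measurable_fun setT (fun x : plane => wave L m Om c (s, x) : R).
Proof.
rewrite waveE /=.
apply: measurable_funD; apply: measurable_funM; try exact: measurable_cst.
  exact: (measurable_mode_cos L m).
exact: (measurable_mode_sin L m).
Qed.

(** Testing the rotating solution against a mode rotating at the same speed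
leaves nothing time dependent in the weak formulation: the moment is constant
and so is the integrand, which therefore vanishes. *)
Lemma Lam_rotating_solution L m Om c w wB : 0 <= L -> density L wB ->
  eq_off_null w wB -> yudovich_solution (fun t => rotf (Om * t) w) ->
  Lam (wave L m Om c) wB 0 = 0.
Proof.
move=> L0 dwB wwB sol.
have mom (t : R) : \int[leb2]_x (rotf (Om * t) w x * wave L m Om c (t, x)) =
    \int[leb2]_x (wB x * wave L m Om c (0, x)).
  rewrite (Rintegral_eq_off_null _ (eq_off_null_rotf _ wwB)).
  rewrite (Rintegral_rotf _ dwB (measurable_wave _ _ _ _ _)).
  by apply: eq_Rintegral => x _; rewrite wave_rot addrK.
have := yudovich_weak sol (test_function_wave m Om c L0) ler01.
rewrite !mom subrr => /esym.
under eq_Rintegral => s _.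
  rewrite -/(Lam (wave L m Om c) (rotf (Om * s) w) s).
  rewrite (Lam_eq_off_null _ _ (eq_off_null_rotf (Om * s) wwB)).
  rewrite (Lam_rotf m Om c (Om * s) s L0 dwB) addrK.
  over.
by rewrite Rintegral_cst//= lebesgue_measure_itv/= lte01 /= subr0 mulr1.
Qed.

Lemma Lam_rotated_wave L m Om c w wB a s : 0 <= L -> density L wB ->
  eq_off_null w wB -> yudovich_solution (fun t => rotf (Om * t) w) ->
  Lam (wave L m Om c) (rotf a wB) s = 0.
Proof.
move=> L0 dwB wwB sol; rewrite (Lam_rotf m Om c a s L0 dwB).
exact: Lam_rotating_solution wwB sol.
Qed.

End Rotations.

(** * Areas of plane regions *)

Section PlaneRegions.
Context {R : realType}.
Local Notation line := (measurableTypeR R).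
Local Notation plane := (measurableTypeR R * measurableTypeR R)%type.
Local Notation leb1 := (@lebesgue_measure R).
Local Notation leb2 := (@leb2 R).
Implicit Types (x : R * R) (b k : R).

Lemma polar_exists x : exists a, x = (enorm x * cos a, enorm x * sin a).
Proof.
have [->|x0] := eqVneq x 0; first by exists 0; rewrite enorm0 !mul0r.
have r0 := enorm_gt0 x0; set r := enorm x in r0 *.
have rE : x.1 ^+ 2 + x.2 ^+ 2 = r ^+ 2 by rewrite sqr_enorm.
set c := x.1 / r.
have c1 : -1 <= c <= 1.
  by rewrite -ler_norml normrM normfV (gtr0_norm r0) ler_pdivrMr// mul1r norm_le_enorm1.
have ca := acosK (x := c) c1; have sa := sin_acos c1.
have s2 : 1 - c ^+ 2 = (`|x.2| / r) ^+ 2.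
  rewrite [RHS]exprMn real_normK ?num_real// /c exprMn exprVn.
  have -> : x.2 ^+ 2 = r ^+ 2 - x.1 ^+ 2 by rewrite -rE; ring.
  by field; rewrite gt_eqF.
have {}sa : sin (acos c) = `|x.2| / r.
  by rewrite sa s2 sqrtr_sqr ger0_norm// divr_ge0// ltW.
have xE1 : r * c = x.1 by rewrite /c mulrC divfK ?gt_eqF.
have xE2 : r * (`|x.2| / r) = `|x.2| by rewrite mulrC divfK ?gt_eqF.
have [y0|y0] := leP 0 x.2.
  by exists (acos c); rewrite ca sa xE1 xE2 ger0_norm//; case: (x).
exists (- acos c); rewrite cosN sinN ca sa mulrN xE1 xE2 ltr0_norm// opprK.
by case: (x).
Qed.

(** Both functions are set to zero on N, which changes neither integral. *)
Lemma Rintegral_le_off_null (N : set plane) (f h : plane -> R) :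
  measurable N -> leb2 N = 0%E ->
  leb2.-integrable setT (EFin \o f) -> leb2.-integrable setT (EFin \o h) ->
  (forall x, ~ N x -> f x <= h x) -> \int[leb2]_x f x <= \int[leb2]_x h x.
Proof.
move=> mN N0 fi hi fh.
have mf : measurable_fun setT f by have /integrableP[/measurable_EFinP] := fi.
have mh : measurable_fun setT h by have /integrableP[/measurable_EFinP] := hi.
have mC : measurable (~` N) by exact: measurableC.
pose cut (u : plane -> R) x := u x * \1_(~` N) x.
have cutE u : \int[leb2]_x u x = \int[leb2]_x cut u x.
  rewrite /Rintegral; congr fine; apply: (integral_eq_off_null mN N0) => x Nx.
  by rewrite /cut indicE mem_set// mulr1.
have cut_int u : measurable_fun setT u -> leb2.-integrable setT (EFin \o u) ->
    leb2.-integrable setT (EFin \o cut u).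
  move=> mu ui; apply: (le_integrable measurableT _ _ ui).
    by apply/measurable_EFinP; apply: measurable_funM => //; exact: measurable_indic.
  move=> x _ /=; rewrite lee_fin /cut normrM ler_piMr// indicE.
  by case: (x \in _); rewrite ?normr1 ?normr0.
rewrite cutE [leRHS]cutE; apply: le_Rintegral => //; try exact: cut_int.
move=> x _; rewrite /cut indicE; case: (boolP (x \in ~` N)).
  by rewrite inE !mulr1 => /fh.
by rewrite !mulr0.
Qed.

Lemma integrable_density_mul (L K : R) w (k : plane -> R) : 0 <= L -> 0 <= K ->
  density L w -> measurable_fun setT k -> (forall x, enorm x < L -> `|k x| <= K) ->
  leb2.-integrable setT (EFin \o (fun x => w x * k x)).
Proof.
move=> L0 K0 dw mk kK; have [mw w1 w0] := dw.
apply: (@integrable_le_majorant _ L K 0 0) => //.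
- exact: measurable_funM.
- by move=> y /w0 ->; rewrite mul0r.
move=> y yL; apply: (@le_trans _ _ (K%:E * 1)%E).
  by rewrite mule1 lee_fin normrM -[leRHS]mul1r ler_pM// kK.
rewrite lee_wpmul2l// (le_trans (kap2_ge1 (0 - y)))// leeDl//; exact: kap2_ge0.
Qed.

Lemma density_indic (L : R) (D : set plane) : measurable D -> D `<=` Ball L ->
  density L \1_D.
Proof.
move=> mD DL; split; first exact: measurable_indic.
  by move=> x; rewrite indicE; case: (x \in D); rewrite ?normr1 ?normr0.
move=> x Lx; rewrite indicE; case: (boolP (x \in D)) => //; rewrite inE => /DL.
by rewrite /Ball /= ltNge Lx.
Qed.

Lemma leb2_ysection (D : set plane) : measurable D ->
  leb2 D = (\int[leb1]_y leb1 [set s | D (s, y)])%E.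
Proof.
move=> mD; have mi : measurable_fun setT (fun p : plane => (\1_D p)%:E : \bar R).
  by apply/measurable_EFinP; exact: measurable_indic.
transitivity (\int[leb2]_p (\1_D p)%:E)%E; first by rewrite integral_indic// setIT.
transitivity (\int[leb1]_y \int[leb1]_s (\1_D (s, y))%:E)%E.
  by apply: (fubini_tonelli2 (m1 := leb1) (m2 := leb1) _ mi) => p; rewrite lee_fin.
apply: eq_integral => y _.
have mS : measurable ([set s | D (s, y)] : set line).
  have := measurable_ysection y mD; congr measurable.
  by apply/seteqP; split => s /=; rewrite /ysection /= inE.
transitivity (\int[leb1]_s (\1_[set s | D (s, y)] s)%:E)%E; last first.
  by rewrite integral_indic// setIT.
by apply: eq_integral => s _; rewrite !indicE; congr ((nat_of_bool _)%:R)%:E.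
Qed.

Lemma leb1_small_diameter (E : set line) (d : R) : measurable E -> 0 <= d ->
  (forall s s', E s -> E s' -> `|s - s'| <= d) -> (leb1 E <= (2 * d)%:E)%E.
Proof.
move=> mE d0 Ed; have [->|/set0P[s0 Es0]] := eqVneq E set0.
  by rewrite measure0 lee_fin mulr_ge0.
apply: (@le_trans _ _ (leb1 `[s0 - d, s0 + d]%classic)).
  apply: le_measure; rewrite ?inE// => s Es /=; rewrite in_itv/=.
  by have := Ed _ _ Es Es0; rewrite ler_norml => /andP[? ?]; apply/andP; split; lra.
rewrite lebesgue_measure_itv/=; case: ifPn => _; last by rewrite lee_fin mulr_ge0.
by rewrite -EFinB lee_fin; lra.
Qed.

Definition annulus b : set plane := [set x | 1 - 2 * b <= enorm x <= 1 + 2 * b].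

Lemma measurable_annulus b : measurable (annulus b).
Proof.
have -> : annulus b = (enorm : plane -> R) @^-1` `[1 - 2 * b, 1 + 2 * b]%classic.
  by apply/seteqP; split => x; rewrite /annulus /= in_itv.
by rewrite -[X in measurable X]setTI; exact: measurable_enorm.
Qed.

Let right_part b : set plane := annulus b `&` [set x | 1 / 2 <= x.1].

Let measurable_right_part b : measurable (right_part b).
Proof.
apply: measurableI; first exact: measurable_annulus.
have -> : [set x : plane | 1 / 2 <= x.1] = fst @^-1` `[1 / 2, +oo[%classic.
  by apply/seteqP; split => x; rewrite /= in_itv/= andbT.
by rewrite -[X in measurable X]setTI; exact: measurable_fst.
Qed.

Let leb2_right_part b : 0 < b -> b <= 1 / 8 -> (leb2 (right_part b) <= (64 * b)%:E)%E.
Proof.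
move=> b0 b8; rewrite leb2_ysection//.
have mS y : measurable ([set s | right_part b (s, y)] : set line).
  have := measurable_ysection y (measurable_right_part b); congr measurable.
  by apply/seteqP; split => s /=; rewrite /ysection /= inE.
apply: (@le_trans _ _ (\int[leb1]_(y in `[(-2)%R, 2%R]) (16 * b)%:E)%E); last first.
  rewrite integral_cst//= lebesgue_measure_itv/= lte_fin ifT; last by lra.
  by rewrite -EFinB -EFinM lee_fin; lra.
rewrite [leRHS]integral_mkcond.
apply: (@ge0_le_integral_off_null _ _ _ leb1 set0) => //.
  by apply: erestrict_ge0 => y _; rewrite lee_fin; lra.
move=> y _; rewrite patchE; case: ifPn => yy; last first.
  have -> : [set s | right_part b (s, y)] = set0.
    apply/seteqP; split => // s [/= /andP[_ sy] _]; move: yy; rewrite notin_setE; apply.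
    rewrite /= in_itv/= -ler_norml; apply: le_trans (norm_le_enorm2 (s, y)) _; lra.
  by rewrite measure0.
rewrite (_ : 16 * b = 2 * (8 * b)); last by ring.
apply: leb1_small_diameter => //; first lra.
(* Two points of a slice have squares within 8 b and a sum of at least 1. *)
have sq s : right_part b (s, y) ->
    (1 - 2 * b) ^+ 2 <= s ^+ 2 + y ^+ 2 <= (1 + 2 * b) ^+ 2 /\ 1 / 2 <= s.
  move=> [/= /andP[a c] d]; split=> //.
  rewrite -(sqr_enorm (s, y)) !ler_pXn2r ?a ?c ?nnegrE ?enorm_ge0//; lra.
move=> s s' /sq[/andP[a1 a2] a3] /sq[/andP[c1 c2] c3].
have h : `|s - s'| * (s + s') <= 8 * b.
  have s0 : 0 <= s + s' by lra.
  rewrite -[X in _ * X](ger0_norm s0) -normrM ler_norml; apply/andP; split; nra.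
apply: le_trans h; rewrite ler_peMr//; lra.
Qed.

(** The annulus is covered by four congruent pieces on which one coordinate is
bounded away from zero; there the slices have length of order b. *)
Lemma leb2_annulus_le b : 0 < b -> b <= 1 / 8 -> (leb2 (annulus b) <= (256 * b)%:E)%E.
Proof.
move=> b0 b8; set V := right_part b.
have mV : measurable V by exact: measurable_right_part.
have ps := @measure_preserving_swap R.
have pp := @measure_preserving_rot R pi.
have psp := measure_preserving_comp ps pp.
have m1 : measurable ((rot pi : plane -> plane) @^-1` V).
  by rewrite -[X in measurable X]setTI; exact: pp.1.
have m2 : measurable ((fun p : plane => (p.2, p.1) : plane) @^-1` V).
  by rewrite -[X in measurable X]setTI; exact: ps.1.
have m3 : measurable (((fun p : plane => (p.2, p.1) : plane) \o rot pi) @^-1` V).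
  by rewrite -[X in measurable X]setTI; exact: psp.1.
set V1 := _ @^-1` V in m1; set V2 := _ @^-1` V in m2; set V3 := _ @^-1` V in m3.
have rp x : rot pi x = (- x.1, - x.2).
  by rewrite /rot cospi sinpi !mul0r !mulN1r subr0 add0r.
have sub : annulus b `<=` (V `|` V1) `|` (V2 `|` V3).
  move=> x Ax; have := Ax; rewrite /annulus /= => /andP[h1 h2].
  have an y : enorm y = enorm x -> annulus b y by rewrite /annulus /= => ->.
  have es : enorm (x.2, x.1) = enorm x by rewrite /enorm /= addrC.
  have [p|n] := leP (1 / 2) x.1; first by left; left.
  have [p1|n1] := leP (1 / 2) (- x.1).
    left; right; split; first by apply: an; rewrite enorm_rot.
    by change (1 / 2 <= (rot pi x).1); rewrite rp.
  have [p2|n2] := leP (1 / 2) x.2; first by right; left; split => //; exact: an.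
  have [p3|n3] := leP (1 / 2) (- x.2).
    right; right; split; last by change (1 / 2 <= (rot pi x).2); rewrite rp.
    apply: an; change (enorm ((rot pi x).2, (rot pi x).1) = enorm x).
    by rewrite rp -es /enorm /= !sqrrN.
  exfalso; have r : (1 - 2 * b) ^+ 2 <= enorm x ^+ 2.
    by rewrite ler_pXn2r ?nnegrE ?enorm_ge0//; lra.
  have q1 : x.1 ^+ 2 <= 1 / 4 by nra.
  have q2 : x.2 ^+ 2 <= 1 / 4 by nra.
  by rewrite sqr_enorm in r; nra.
have lV := leb2_right_part b0 b8.
apply: (@le_trans _ _ (leb2 ((V `|` V1) `|` (V2 `|` V3)))).
  by apply: le_measure; rewrite ?inE//; [exact: measurable_annulus|do !apply: measurableU].
apply: (@le_trans _ _ ((leb2 V + leb2 V1) + (leb2 V2 + leb2 V3))%E).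
  apply: le_trans (measureU2 _ _ _) _; [exact: measurableU|exact: measurableU|].
  by apply: leeD; exact: measureU2.
have -> : leb2 V1 = leb2 V by exact: pp.2.
have -> : leb2 V2 = leb2 V by exact: ps.2.
have -> : leb2 V3 = leb2 V by exact: psp.2.
have -> : (256 * b)%:E = ((64 * b)%:E + (64 * b)%:E + ((64 * b)%:E + (64 * b)%:E))%E.
  by rewrite -!EFinD; congr EFin; ring.
by do !apply: leeD.
Qed.

(** A crescent hugging the unit circle from outside near (1, 0), cut so that its
horizontal slices are intervals of length exactly b. *)
Definition crescent k b : set plane := [set x |
  `|x.2| < k /\ Num.sqrt (1 - x.2 ^+ 2) < x.1 < Num.sqrt (1 - x.2 ^+ 2) + b].

Lemma measurable_crescent k b : measurable (crescent k b).
Proof.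
have ms : measurable_fun setT (fun x : plane => Num.sqrt (1 - x.2 ^+ 2) : R).
  apply: (measurable_fun_line2plane (f := Num.sqrt) (u := fun x => 1 - x.2 ^+ 2)).
    exact: sqrt_continuous.
  by apply: measurable_funB => //; apply: measurable_funX; exact: measurable_snd.
have md : measurable_fun setT (fun x : plane => x.1 - Num.sqrt (1 - x.2 ^+ 2) : R).
  by apply: measurable_funB => //; exact: measurable_fst.
have -> : crescent k b = (snd : plane -> R) @^-1` `](- k), k[%classic `&`
   (fun x : plane => x.1 - Num.sqrt (1 - x.2 ^+ 2) : R) @^-1` `]0, b[%classic.
  apply/seteqP; split => x /=; rewrite !in_itv/= -ltr_norml => -[h /andP[? ?]];
    by split; [exact: h|apply/andP; split; lra].
apply: measurableI; rewrite -[X in measurable X]setTI.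
  exact: measurable_snd.
exact: md.
Qed.

Lemma leb2_crescent k b : 0 < k -> 0 < b -> leb2 (crescent k b) = (2 * k * b)%:E.
Proof.
move=> k0 b0; rewrite leb2_ysection; last exact: measurable_crescent.
transitivity (\int[leb1]_(y in `](- k)%R, k[) b%:E)%E; last first.
  rewrite integral_cst//= lebesgue_measure_itv/= lte_fin ifT; last by lra.
  by rewrite -EFinB -EFinM; congr EFin; ring.
rewrite [RHS]integral_mkcond; apply: eq_integral => y _.
rewrite patchE; case: ifPn => yk.
  have -> : [set s | crescent k b (s, y)] =
      `]Num.sqrt (1 - y ^+ 2), Num.sqrt (1 - y ^+ 2) + b[%classic.
    apply/seteqP; split => s /=; rewrite in_itv/=; first by case.
    by move=> h; split=> //=; move: yk; rewrite inE/= in_itv/= -ltr_norml.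
  rewrite lebesgue_measure_itv/= lte_fin ltrDl b0 -EFinB; congr EFin; ring.
have -> : [set s | crescent k b (s, y)] = set0.
  apply/seteqP; split => // s [/= h _]; move: yk; rewrite notin_setE; apply.
  by rewrite /= in_itv/= -ltr_norml.
by rewrite measure0.
Qed.

Lemma enorm_crescent k b x : 0 < b -> k <= 1 -> crescent k b x ->
  1 <= enorm x < 1 + b.
Proof.
move=> b0 k1 [yk /andP[a c]]; set s := Num.sqrt _ in a c.
have y1 : `|x.2| <= 1 by apply: ltW; apply: lt_le_trans yk _.
have y2 : x.2 ^+ 2 <= 1 by rewrite -real_normK ?num_real// exprn_ile1.
have s0 : 0 <= s by exact: sqrtr_ge0.
have sE : s ^+ 2 = 1 - x.2 ^+ 2 by rewrite sqr_sqrtr// subr_ge0.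
have s1 : s <= 1 by have := sqr_ge0 x.2; nra.
apply/andP; split.
  rewrite -(ler_pXn2r (n := 2)) ?nnegrE ?enorm_ge0// expr1n sqr_enorm; nra.
rewrite -(ltr_pXn2r (n := 2)) ?nnegrE ?enorm_ge0//; last by lra.
rewrite sqr_enorm; nra.
Qed.

End PlaneRegions.

(** * Lower bound for the moment of the wave *)

Section MomentLowerBound.
Context {R : realType}.
Local Notation plane := (measurableTypeR R * measurableTypeR R)%type.
Local Notation leb2 := (@leb2 R).
Implicit Types (x : R * R) (b k L e : R) (m : nat).

Lemma cpow_one n : cpow n ((1, 0) : R * R) = (1, 0).
Proof. by elim: n => //= n ->; congr pair; rewrite /=; ring. Qed.

Lemma sqr_cpow n x :
  (cpow n x).1 ^+ 2 + (cpow n x).2 ^+ 2 = (enorm x ^+ 2) ^+ n.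
Proof.
elim: n => [|n IH] /=; first by rewrite expr1n expr0n addr0 expr0.
rewrite [RHS]exprS -IH sqr_enorm; ring.
Qed.

(** The cosine of m times the polar angle is the ratio of (cpow m x).1 to the m-th
power of the radius; for radii at least 1 it is bounded below once
(cpow m x).1 exceeds half of the square of that power, an algebraic condition
that holds near (1, 0) by continuity. *)
Lemma cpow_near_one m : exists2 k : R, 0 < k <= 1 / 2 &
  forall x, `|x.1 - 1| < k -> `|x.2| < k -> (enorm x ^+ 2) ^+ m / 2 < (cpow m x).1.
Proof.
have [c1 c2] := @cont_diff_cpow R m.
pose G x := (cpow m x).1 + (- (1 / 2)) *
   ((cpow m x).1 * (cpow m x).1 + (cpow m x).2 * (cpow m x).2).
have cG : continuous G.
  exact: cont_diff_continuous (cont_diffD c1 (cont_diffM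
    (cont_diff_cst (R * R)%type (- (1 / 2)))
    (cont_diffD (cont_diffM c1 c1) (cont_diffM c2 c2)))).
have G1 : 0 < G (1, 0) by rewrite /G cpow_one /=; lra.
have : \forall x \near ((1, 0) : R * R), 0 < G x.
  have cG1 : G x @[x --> ((1, 0) : R * R)] --> G (1, 0) by exact: cG.
  exact: (cvgr_gt _ cG1 _ G1).
move=> /nbhs_ballP[r /= r0 rG].
exists (Num.min r (1 / 2)); first by rewrite lt_min r0 ge_min lexx orbT /= andbT; lra.
move=> x; rewrite !lt_min => /andP[x1 _] /andP[x2 _].
have /rG : ball ((1, 0) : R * R) r x.
  split; rewrite /ball /=; first by rewrite distrC.
  by rewrite sub0r normrN.
by rewrite /= /G -!expr2 sqr_cpow; lra.
Qed.

Lemma cutoff_ge1 L x : 0 <= L -> enorm x <= L -> 1 <= cutoff L x.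
Proof.
move=> L0 xL; rewrite cutoffE /sqr_pos.
have h : enorm x ^+ 2 <= L ^+ 2 by rewrite ler_pXn2r ?nnegrE ?enorm_ge0.
rewrite max_r; last by lra.
by rewrite exprn_ege1//; lra.
Qed.

Lemma cutoff_ge0 L x : 0 <= cutoff L x.
Proof. by rewrite /cutoff /sqr_pos sqr_ge0. Qed.

Lemma cutoff_le L x : cutoff L x <= (L ^+ 2 + 1) ^+ 2.
Proof.
rewrite cutoffE /sqr_pos; have := sqr_ge0 (enorm x); have := sqr_ge0 L => a c.
rewrite ler_pXn2r ?nnegrE ?le_max ?lexx//; last by lra.
by rewrite ge_max; apply/andP; split; lra.
Qed.

Definition mode_bound L m : R := (L ^+ 2 + 1) ^+ 2 * 2 ^+ m.

Lemma cutoff_mul_le L m x r : 0 <= r -> r <= 2 -> cutoff L x * r ^+ m <= mode_bound L m.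
Proof.
move=> r0 r2; rewrite /mode_bound ler_pM ?cutoff_ge0 ?exprn_ge0 ?cutoff_le//.
by rewrite lerXn2r ?nnegrE// (le_trans r0).
Qed.

Lemma mode_cos_polar L m x a : x = (enorm x * cos a, enorm x * sin a) ->
  mode_cos L m x = cutoff L x * (enorm x ^+ m * cos (m%:R * a)).
Proof.
by move=> xE; rewrite /mode_cos; congr (_ * _); rewrite [in LHS]xE cpow_polar.
Qed.

(** Size conditions under which the patch of profile g is close enough to the
unit disk for its mode to be read off from b cos(m a) alone. *)
Definition small_profile m L k b e (g : R -> R) : Prop :=
  [/\ 2 <= L /\ 0 < k <= 1 / 2,
      forall x, `|x.1 - 1| < k -> `|x.2| < k -> (enorm x ^+ 2) ^+ m / 2 < (cpow m x).1,
      [/\ 0 < b, b <= 1 / 8 & b <= k], 0 < e <= 1 / 4 &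
      forall a, `|g a - b * cos (m%:R * a)| <= e * b].

(** Near (1, 0) the profile exceeds b / 4, while the crescent has radii below
1 + b / 8. *)
Lemma crescent_sub_patch m L k b e g x : small_profile m L k b e g -> crescent k (b / 8) x ->
  [/\ polar_patch g x, ~ Ball 1 x & 1 / 2 <= mode_cos L m x].
Proof.
move=> [[L2 /andP[k0 k12]] near1 [b0 b8 bk] /andP[e0 e14] gE] Sx.
have b80 : 0 < b / 8 by rewrite divr_gt0.
have k1 : k <= 1 by lra.
have /andP[r1 rb] := enorm_crescent b80 k1 Sx.
have [a xE] := polar_exists x.
have [yk /andP[s1 s2]] := Sx; set s := Num.sqrt _ in s1 s2.
have y2 : x.2 ^+ 2 <= k / 2.
  rewrite -real_normK ?num_real// expr2; have := normr_ge0 x.2.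
  by have := ltW yk; nra.
have s0 : 0 <= s by exact: sqrtr_ge0.
have sE : s ^+ 2 = 1 - x.2 ^+ 2 by rewrite sqr_sqrtr// subr_ge0; lra.
have sl1 : s <= 1 by have := sqr_ge0 x.2; nra.
have ss : s ^+ 2 <= s by rewrite expr2 ler_piMl.
have sl : 1 - k / 2 <= s by lra.
have x1k : `|x.1 - 1| < k by rewrite ltr_norml; apply/andP; split; lra.
have PE : (cpow m x).1 = enorm x ^+ m * cos (m%:R * a).
  by rewrite [in LHS]xE cpow_polar.
have r0 : 0 <= enorm x by exact: enorm_ge0.
have rm1 : 1 <= enorm x ^+ m by rewrite exprn_ege1.
have nr := near1 x x1k yk.
have cos12 : 1 / 2 < cos (m%:R * a).
  move: nr; rewrite PE exprAC expr2.
  have q : 0 < enorm x ^+ m by lra.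
  rewrite -mulrA ltr_pM2l// => q2; lra.
split.
- exists (enorm x), a; split => //.
  have := gE a; rewrite ler_norml => /andP[ga _].
  by have := ltr_pM2l b0 (1 / 2) (cos (m%:R * a)); rewrite cos12 => h; nra.
- by rewrite /Ball /= => h; lra.
- rewrite (mode_cos_polar L m xE).
  have c1 : 1 <= cutoff L x by apply: cutoff_ge1; lra.
  have : 1 / 2 <= enorm x ^+ m * cos (m%:R * a) by nra.
  by nra.
Qed.

(** Where the patch sticks out of the disk the profile is nonnegative, so the
cosine is at least - e. *)
Lemma outer_mode_ge m L k b e g x : small_profile m L k b e g ->
  polar_patch g x -> ~ Ball 1 x ->
  annulus b x /\ - (e * mode_bound L m) <= mode_cos L m x.
Proof.
move=> [[L2 /andP[k0 k12]] near1 [b0 b8 bk] /andP[e0 e14] gE]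
  [r [a [r0 rg xE]]] /negP; rewrite -leNgt => r1.
have er : enorm x = r by rewrite xE enorm_polar.
rewrite er in r1.
have := gE a; rewrite ler_norml => /andP[g1 g2].
have c1 := cos_le1 (m%:R * a).
have bc : b * cos (m%:R * a) <= b by rewrite ler_piMr// ltW.
have eb : e * b <= b / 4 by nra.
have r2 : r <= 1 + 2 * b by lra.
split; first by rewrite /annulus /= er; apply/andP; split; lra.
have xE' : x = (enorm x * cos a, enorm x * sin a) by rewrite er.
rewrite (mode_cos_polar L m xE') er mulrA.
have ce : - e <= cos (m%:R * a).
  have : b * - e <= b * cos (m%:R * a) by lra.
  by rewrite ler_pM2l.
have r22 : r <= 2 by lra.
have H := cutoff_mul_le L m x r0 r22.
have q0 : 0 <= cutoff L x * r ^+ m by rewrite mulr_ge0 ?cutoff_ge0 ?exprn_ge0.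
set q := cutoff L x * r ^+ m in H q0 *; nra.
Qed.

(** Where the disk sticks out of the patch the profile is negative, so the cosine
is at most e. *)
Lemma inner_mode_le m L k b e g x : small_profile m L k b e g ->
  ~ polar_patch g x -> Ball 1 x ->
  annulus b x /\ mode_cos L m x <= e * mode_bound L m.
Proof.
move=> [[L2 /andP[k0 k12]] near1 [b0 b8 bk] /andP[e0 e14] gE] Ax.
rewrite /Ball /= => r1.
have [a xE] := polar_exists x.
have r0 := enorm_ge0 x; set r := enorm x in r0 r1 xE *.
have rg : 1 + g a <= r.
  by rewrite leNgt; apply/negP => rg; apply: Ax; exists r, a; split.
have := gE a; rewrite ler_norml => /andP[g1 g2].
have c1 := cos_geN1 (m%:R * a).
have bc : - b <= b * cos (m%:R * a) by rewrite -mulrN1 ler_pM2l.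
have eb : e * b <= b / 4 by nra.
split; first by rewrite /annulus /= -/r; apply/andP; split; lra.
rewrite (mode_cos_polar L m xE) -/r mulrA.
have ce : cos (m%:R * a) <= e.
  have : b * cos (m%:R * a) <= b * e by lra.
  by rewrite ler_pM2l.
have r2 : r <= 2 by lra.
have H := cutoff_mul_le L m x r0 r2.
have q0 : 0 <= cutoff L x * r ^+ m by rewrite mulr_ge0 ?cutoff_ge0 ?exprn_ge0.
set q := cutoff L x * r ^+ m in H q0 *; nra.
Qed.

Lemma patch_mode_pointwise m L k b e g x : small_profile m L k b e g ->
  1 / 2 * \1_(crescent k (b / 8)) x - e * mode_bound L m * \1_(annulus b) x <=
  \1_(polar_patch g) x * mode_cos L m x - \1_(Ball 1) x * mode_cos L m x.
Proof.
move=> sp; have [_ _ _ /andP[e0 _] _] := sp.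
have M0 : 0 <= e * mode_bound L m.
  by rewrite mulr_ge0 ?(ltW e0)// mulr_ge0 ?sqr_ge0 ?exprn_ge0.
have A0 : 0 <= e * mode_bound L m * \1_(annulus b) x.
  by rewrite mulr_ge0// indicE ler0n.
have inE1 (D : set (R * R)) : D x -> \1_D x = 1 :> R by move=> Dx; rewrite indicE mem_set.
have inE0 (D : set (R * R)) : ~ D x -> \1_D x = 0 :> R by move=> Dx; rewrite indicE memNset.
have [Sx|Sx] := pselect (crescent k (b / 8) x).
  have [Ax Bx h] := crescent_sub_patch sp Sx.
  by rewrite (inE1 _ Sx) (inE1 _ Ax) (inE0 _ Bx); lra.
rewrite (inE0 _ Sx).
have [Ax|Ax] := pselect (polar_patch g x); have [Bx|Bx] := pselect (Ball 1 x).
- by rewrite (inE1 _ Ax) (inE1 _ Bx); lra.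
- have [/inE1 an h] := outer_mode_ge sp Ax Bx.
  by rewrite (inE1 _ Ax) (inE0 _ Bx) an; lra.
- have [/inE1 an h] := inner_mode_le sp Ax Bx.
  by rewrite (inE0 _ Ax) (inE1 _ Bx) an; lra.
- by rewrite (inE0 _ Ax) (inE0 _ Bx); lra.
Qed.

(** A rotation by half a period changes the sign of the mode and preserves the
disk. *)
Lemma disk_mode_eq0 L m : (0 < m)%N -> 1 <= L ->
  \int[leb2]_x (\1_(Ball 1) x * mode_cos L m x) = 0.
Proof.
move=> m0 L1; have B1 : Ball 1 `<=` Ball L.
  by move=> x; rewrite /Ball /= => h; exact: lt_le_trans h L1.
have d1 := density_indic (measurable_Ball 1) B1.
pose a : R := pi / m%:R.
have ma : m%:R * a = pi by rewrite /a mulrC divfK// pnatr_eq0 -lt0n.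
have rB : rotf a \1_(Ball 1) = \1_(Ball 1) :> (R * R -> R).
  apply/funext => x; rewrite /rotf /= !indicE; congr ((nat_of_bool _)%:R).
  by apply/idP/idP; rewrite !inE /Ball /= enorm_rot.
have := Rintegral_rotf a d1 (measurable_mode_cos L m).
rewrite rB.
have -> : (fun x => \1_(Ball 1) x * mode_cos L m (rot a x)) =
    (fun x => -1 * (\1_(Ball 1) x * mode_cos L m x)).
  by apply/funext => x; rewrite mode_cos_rot ma cospi sinpi; ring.
have L0 : 0 <= L by lra.
have [K K0 KB] := bounded_on_Ball L0 (cont_diff_continuous (cont_diff_mode_cos L m)).
rewrite RintegralZl//; first by lra.
exact: (integrable_density_mul L0 K0 d1 (measurable_mode_cos L m) KB).
Qed.

Lemma integrable_indic_Ball L (D : set plane) : 0 <= L -> measurable D ->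
  D `<=` Ball L -> leb2.-integrable setT (EFin \o \1_D).
Proof.
move=> L0 mD DL.
have := integrable_density_mul L0 ler01 (density_indic mD DL)
  (k := fun=> 1) (measurable_cst _) (fun _ _ => ltac:(by rewrite normr1)).
by apply: eq_integrable => // x _ /=; rewrite mulr1.
Qed.

(** Only the first-order shape of the profile matters: the crescent contributes
a multiple of b, while the sign of the mode can disagree with the displacement
only where the cosine is at most e, at a cost of e b. *)
Lemma moment_lower_bound L m : (0 < m)%N -> 2 <= L ->
  exists e c b1 : R, [/\ 0 < e, 0 < c, 0 < b1 &
    forall b (g : R -> R) w, 0 < b <= b1 ->
      (forall a, `|g a - b * cos (m%:R * a)| <= e * b) ->
      density L w -> eq_off_null \1_(polar_patch g) w ->
      c * b <= \int[leb2]_x (w x * mode_cos L m x)].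
Proof.
move=> m0 L2; have L0 : 0 <= L by lra.
have [k /andP[k0 k12] near1] := cpow_near_one m.
set H := mode_bound L m.
have H0 : 0 < H by rewrite mulr_gt0 ?exprn_gt0// ltr_wpDl ?sqr_ge0.
have H1 : 0 < 64 * (64 * H) by apply: mulr_gt0 => //; apply: mulr_gt0.
(* The error e H times the area 256 b of the annulus must stay below half of the
contribution k b / 8 of the crescent. *)
pose e := Num.min (1 / 4) (k / (64 * (64 * H))).
have e0 : 0 < e by rewrite lt_min divr_gt0// divr_gt0.
have e14 : e <= 1 / 4 by rewrite ge_min lexx.
have eH : 256 * (e * H) <= k / 16.
  have : e <= k / (64 * (64 * H)) by rewrite ge_min lexx orbT.
  by rewrite ler_pdivlMr//; lra.
exists e, (k / 16), (Num.min (1 / 8) k); split => //.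
- by rewrite divr_gt0.
- by rewrite lt_min k0 andbT.
move=> b g w /andP[b0]; rewrite le_min => /andP[b8 bk] gE dw [N [mN N0 wN]].
have [K K0 KB] := bounded_on_Ball L0 (cont_diff_continuous (cont_diff_mode_cos L m)).
have mc := measurable_mode_cos L m.
have B1 : Ball 1 `<=` Ball L.
  by move=> x; rewrite /Ball /= => h; apply: lt_le_trans h _; lra.
have i1 := integrable_density_mul L0 K0 (density_indic (measurable_Ball 1) B1) mc KB.
have iw := integrable_density_mul L0 K0 dw mc KB.
have SL : crescent k (b / 8) `<=` Ball L.
  have b80 : 0 < b / 8 by rewrite divr_gt0.
  have k1 : k <= 1 by lra.
  by move=> x /(enorm_crescent b80 k1)/andP[_ h]; rewrite /Ball /=; lra.
have AL : annulus b `<=` Ball L.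
  by move=> x /andP[_ h]; rewrite /Ball /=; lra.
have mS := measurable_crescent k (b / 8); have mA := measurable_annulus b.
have iS := integrable_indic_Ball L0 mS SL.
have iA := integrable_indic_Ball L0 mA AL.
have iS' : leb2.-integrable setT (EFin \o (fun x => 1 / 2 * \1_(crescent k (b / 8)) x)).
  by have := integrableZl measurableT (1 / 2) iS; apply: eq_integrable.
have iA' : leb2.-integrable setT (EFin \o (fun x => e * H * \1_(annulus b) x)).
  by have := integrableZl measurableT (e * H) iA; apply: eq_integrable.
rewrite -[leRHS]subr0 -(disk_mode_eq0 m0 (le_trans _ L2)); last by lra.
rewrite -RintegralB//.
have iL : leb2.-integrable setT (EFin \o (fun x =>
    1 / 2 * \1_(crescent k (b / 8)) x - e * H * \1_(annulus b) x)).
  by have := integrableB measurableT iS' iA'; apply: eq_integrable.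
have iR : leb2.-integrable setT (EFin \o (fun x =>
    w x * mode_cos L m x - \1_(Ball 1) x * mode_cos L m x)).
  by have := integrableB measurableT iw i1; apply: eq_integrable.
apply: le_trans (Rintegral_le_off_null mN N0 iL iR _); last first.
  move=> x Nx; rewrite -wN//.
  by apply: patch_mode_pointwise; split=> //; [rewrite k0|rewrite e0].
rewrite RintegralB// !RintegralZl//.
have -> : \int[leb2]_x \1_(crescent k (b / 8)) x = 2 * k * (b / 8).
  rewrite /Rintegral integral_indic// setIT leb2_crescent//; lra.
have : \int[leb2]_x \1_(annulus b) x <= 256 * b.
  have h := leb2_annulus_le b0 b8.
  rewrite /Rintegral integral_indic// setIT -lee_fin fineK//.
  by rewrite ge0_fin_numE//; apply: le_lt_trans h (ltry _).
set I := Rintegral _ _ _ => Ib.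
have eH0 : 0 <= e * H by rewrite mulr_ge0// ltW.
have : e * H * I <= e * H * (256 * b) by rewrite ler_wpM2l.
have : b * (256 * (e * H)) <= b * (k / 16) by rewrite ler_pM2l.
by lra.
Qed.

End MomentLowerBound.

(** * From moments to angles *)

Section AngleEstimates.
Context {R : realType}.
Implicit Types x y : R.

Lemma sin_le_id x : 0 <= x -> sin x <= x.
Proof.
rewrite le_eqVlt => /predU1P[<-|x0]; first by rewrite sin0.
have cs : {within `[0, x], continuous (@sin R)}.
  by apply: continuous_subspaceT; exact: continuous_sin.
have [z _] := MVT x0 (fun z _ => is_derive_sin z) cs.
rewrite sin0 !subr0 => ->; rewrite ler_piMl ?cos_le1//; exact: ltW.
Qed.

Lemma one_minus_cos x : 1 - cos x = 2 * sin (x / 2) ^+ 2.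
Proof.
have xE : x = x / 2 + x / 2 by field.
rewrite [in LHS]xE cosD -!expr2 [in LHS]cos2sin2; ring.
Qed.

Lemma sin_ge_half x : 0 <= x <= 1 -> x / 2 <= sin x.
Proof.
move=> /andP[]; rewrite le_eqVlt => /predU1P[<- _|x0 x1]; first by rewrite mul0r sin0.
have cs : {within `[0, x], continuous (@sin R)}.
  by apply: continuous_subspaceT; exact: continuous_sin.
have [z] := MVT x0 (fun z _ => is_derive_sin z) cs.
rewrite in_itv/= sin0 !subr0 => /andP[z0 zx] ->.
have s1 : sin (z / 2) <= z / 2 by apply: sin_le_id; lra.
have s0 : 0 <= sin (z / 2).
  by apply: ltW; apply: sin2_gt0; apply/andP; split; lra.
have : 1 - cos z <= 1 / 2 by rewrite one_minus_cos; nra.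
by nra.
Qed.

Lemma sin_ge_quarter x : 0 <= x <= pi / 2 -> x / 4 <= sin x.
Proof.
move=> /andP[x0 xp]; have [x1|x1] := leP x 1.
  by have := @sin_ge_half x; rewrite x0 x1 => /(_ isT); lra.
have p := pihalf_lt2 R; have q := pihalf_ge1 R.
have : sin 1 < sin x.
  by rewrite ltr_sin// !in_itv/=; apply/andP; split; lra.
have := @sin_ge_half 1; rewrite ler01 lexx => /(_ isT); lra.
Qed.

Lemma one_minus_cos_ge y : `|y| <= pi -> y ^+ 2 / 32 <= 1 - cos y.
Proof.
move=> yp; rewrite -cos_norm -[y ^+ 2]real_normK ?num_real//.
have y0 := normr_ge0 y; set z := `|y| in yp y0 *.
have := @sin_ge_quarter (z / 2); rewrite one_minus_cos.
have -> : (0 <= z / 2 <= pi / 2) by apply/andP; split; lra.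
move=> /(_ isT) h; have zz : 0 <= z / 2 / 4 by lra.
by nra.
Qed.

Lemma cos_subr_period y (k : int) : cos (y - 2 * k%:~R * pi) = cos y.
Proof.
have pn (n : nat) (u : R) : cos (u + pi *+ 2 *+ n) = cos u.
  by apply: periodicn; exact: cosD2pi.
case: k => n.
  rewrite -(pn n (y - _)); congr cos.
  by rewrite -[_ *+ n]mulr_natr -[_ *+ 2]mulr_natr /=; ring.
rewrite -(pn n.+1 y); congr cos.
by rewrite NegzE -[_ *+ n.+1]mulr_natr -[_ *+ 2]mulr_natr mulrNz /=; ring.
Qed.

Lemma cos_Tm m y : (0 < m)%N -> cos (m%:R * Tm m y) = cos (m%:R * y).
Proof.
move=> m0; have [_ [k kE]] := TmP y m0.
rewrite -(cos_subr_period (m%:R * y) k); congr cos.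
have mn : m%:R != 0 :> R by rewrite pnatr_eq0 -lt0n.
have -> : Tm m y = y - 2 * k%:~R * pi / m%:R by rewrite -kE; ring.
by field.
Qed.

Lemma normr_mul_Tm m y : (0 < m)%N -> `|m%:R * Tm m y| <= pi.
Proof.
move=> m0; have [/andP[a b] _] := TmP y m0.
have mp : 0 < m%:R :> R by rewrite ltr0n.
have mpi : m%:R * (pi / m%:R) = pi :> R by rewrite mulrC divfK// gt_eqF.
rewrite ler_norml; apply/andP; split.
  by rewrite -mpi -mulrN ler_pM2l.
by rewrite -mpi ler_pM2l// ltW.
Qed.

(** The vector (u, v) is rotated by the angles m p and m q.  The squared distance
of the results is 2 (1 - cos (m (q - p))) times the squared length of (u, v),
and 1 - cos y is at least y^2 / 32 for the representative y of m (q - p) of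
absolute value at most pi. *)
Lemma Tm_le m (u v p q E : R) : (0 < m)%N -> 0 < u -> 0 <= E ->
  `|(cos (m%:R * q) * u - sin (m%:R * q) * v) -
    (cos (m%:R * p) * u - sin (m%:R * p) * v)| <= E ->
  `|(sin (m%:R * q) * u + cos (m%:R * q) * v) -
    (sin (m%:R * p) * u + cos (m%:R * p) * v)| <= E ->
  `|Tm m (q - p)| <= 6 * E / u.
Proof.
move=> m0 u0 E0; set X := (X in `|X| <= _ -> _); set Y := (Y in _ -> `|Y| <= _ -> _).
move=> XE YE.
have sq (Z : R) : `|Z| <= E -> Z ^+ 2 <= E ^+ 2.
  by move=> ZE; rewrite -[Z ^+ 2]real_normK ?num_real// ler_pXn2r ?nnegrE.
have XY : X ^+ 2 + Y ^+ 2 = (u ^+ 2 + v ^+ 2) * (2 * (1 - cos (m%:R * (q - p)))).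
  have -> : m%:R * (q - p) = m%:R * q - m%:R * p by ring.
  rewrite cosB /X /Y.
  have cp := cos2Dsin2 (m%:R * p); have cq := cos2Dsin2 (m%:R * q).
  set c := cos (m%:R * p) in cp *; set s := sin (m%:R * p) in cp *.
  set c' := cos (m%:R * q) in cq *; set s' := sin (m%:R * q) in cq *.
  transitivity ((u ^+ 2 + v ^+ 2) *
    ((c' ^+ 2 + s' ^+ 2) + (c ^+ 2 + s ^+ 2) - 2 * (c' * c + s' * s))); first ring.
  by rewrite cp cq; ring.
have h := one_minus_cos_ge (normr_mul_Tm (q - p) m0).
rewrite cos_Tm// in h.
set y := m%:R * Tm m (q - p) in h.
have X2 := sq _ XE; have Y2 := sq _ YE.
have c0 : 0 <= 1 - cos (m%:R * (q - p)) by have := cos_le1 (m%:R * (q - p)); lra.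
have uy : u ^+ 2 * (y ^+ 2 / 32) <= E ^+ 2.
  apply: (@le_trans _ _ (u ^+ 2 * (1 - cos (m%:R * (q - p))))).
    by rewrite ler_wpM2l// sqr_ge0.
  have := sqr_ge0 v; nra.
have yE : `|y| <= 6 * E / u.
  rewrite ler_pdivlMr// -(ler_pXn2r (n := 2)) ?nnegrE ?mulr_ge0// ?(ltW u0)//.
  rewrite exprMn real_normK ?num_real// [leRHS]exprMn; have := sqr_ge0 E; lra.
apply: le_trans yE; rewrite /y normrM normr_nat ler_peMl// ler1n.
by [].
Qed.

End AngleEstimates.

(** * Evolution of the moment of a tracked solution *)

Section Tracking.
Context {R : realType}.
Local Notation plane := (measurableTypeR R * measurableTypeR R)%type.
Local Notation leb2 := (@leb2 R).
Implicit Types (w : R * R -> R) (x : R * R).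

Lemma at_right0_interval (Q : R -> Prop) : (\forall b \near (0 : R)^'+, Q b) ->
  exists2 d, 0 < d & forall b, 0 < b <= d -> Q b.
Proof.
move=> /nbhs_ballP[r /= r0 rQ]; exists (r / 2); first by rewrite divr_gt0.
move=> b /andP[b0 br]; apply: rQ => //.
by rewrite /ball /= sub0r normrN gtr0_norm//; lra.
Qed.

Lemma lebesgue_measurable_of_indic (A : set (R * R)) :
  lebesgue_measurable_fun (\1_A : R * R -> R) -> lebesgue_measurable A.
Proof.
move=> /(_ [set 1] (measurable_set1 _)); congr lebesgue_measurable.
apply/seteqP; split => x /=; rewrite indicE; last by move=> Ax; rewrite mem_set.
case: (boolP (x \in A)); first by rewrite inE.
by move=> _ /eqP; rewrite eq_sym oner_eq0.
Qed.

Lemma L1norm_dist (w w' : R * R -> R) :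
  L1norm (w \- w') = (\int[leb2]_x `|w x - w' x|%:E)%E.
Proof. by rewrite /L1norm Lnorm1. Qed.

Lemma Rintegral_dist_le (L K e : R) w w' (k : plane -> R) : 0 <= L -> 0 <= K ->
  density L w -> density L w' -> measurable_fun setT k ->
  (forall x, enorm x < L -> `|k x| <= K) ->
  (\int[leb2]_x `|w x - w' x|%:E <= e%:E)%E ->
  `|\int[leb2]_x (w x * k x) - \int[leb2]_x (w' x * k x)| <= K * e.
Proof.
move=> L0 K0 dw dw' mk kK we; have [_ _ w0] := dw; have [_ _ w0'] := dw'.
have i := integrable_density_mul L0 K0 dw mk kK.
have i' := integrable_density_mul L0 K0 dw' mk kK.
have iB : leb2.-integrable setT (EFin \o (fun x => w x * k x - w' x * k x)).
  by have := integrableB measurableT i i'; apply: eq_integrable.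
rewrite -RintegralB//; apply: le_trans (le_normr_Rintegral _ iB) _ => //.
rewrite -lee_fin /Rintegral fineK; last first.
  by have /integrable_abse h := iB; exact: (integrable_fin_num _ h).
have [mw _ _] := dw; have [mw' _ _] := dw'.
apply: (@le_trans _ _ (\int[leb2]_x (K%:E * `|w x - w' x|%:E))%E).
  apply: (@ge0_le_integral_off_null _ _ _ leb2 set0) => //.
    by move=> x; rewrite mule_ge0.
  move=> x _; rewrite -EFinM lee_fin -mulrBl normrM mulrC.
  have [xL|xL] := ltP (enorm x) L; first by rewrite ler_wpM2r// kK.
  by rewrite w0// w0'// subrr normr0 !mulr0.
rewrite ge0_integralZl//; last first.
  by apply/measurable_EFinP; apply: measurableT_comp;
    [exact: normr_measurable|exact: measurable_funB].
by rewrite EFinM lee_wpmul2l.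
Qed.

Lemma moment_rotated L m Om c w a s : 0 <= L -> density L w ->
  \int[leb2]_x (rotf a w x * wave L m Om c (s, x)) =
  cos (m%:R * (a - Om * s - c)) * \int[leb2]_x (w x * mode_cos L m x) -
  sin (m%:R * (a - Om * s - c)) * \int[leb2]_x (w x * mode_sin L m x).
Proof.
move=> L0 dw; rewrite (Rintegral_rotf a dw (measurable_wave L m Om c s)).
have [K K0 KB] := bounded_on_Ball L0 (cont_diff_continuous (cont_diff_mode_cos L m)).
have [K' K'0 KB'] := bounded_on_Ball L0 (cont_diff_continuous (cont_diff_mode_sin L m)).
have i := integrable_density_mul L0 K0 dw (measurable_mode_cos L m) KB.
have i' := integrable_density_mul L0 K'0 dw (measurable_mode_sin L m) KB'.
set t := a - Om * s - c.
have iZ : leb2.-integrable setT (EFin \o (fun x => cos (m%:R * t) * (w x * mode_cos L m x))).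
  by have := integrableZl measurableT (cos (m%:R * t)) i; apply: eq_integrable.
have iZ' : leb2.-integrable setT (EFin \o (fun x => sin (m%:R * t) * (w x * mode_sin L m x))).
  by have := integrableZl measurableT (sin (m%:R * t)) i'; apply: eq_integrable.
rewrite -!RintegralZl// -RintegralB//; apply: eq_Rintegral => x _.
rewrite /wave /= -rotD (_ : - (Om * s + c) + a = t); last by rewrite /t; ring.
by rewrite mode_cos_rot; ring.
Qed.

(** The moment of a solution against a rotating mode is almost conserved as long
as the solution stays close to rotated copies of the wave: its derivative is the
transport functional, which vanishes at every rotated copy and is Lipschitz for
the L1 distance.  The rotated wave is compared with the solution at the two end
times only, which accounts for the term 2 (K * eps). *)
Lemma moment_increment (L K eps Om c : R) m (wk wB : R * R -> R)
    (W : R -> R * R -> R) (V : R -> R * R -> R) (Theta : R -> R) (t t' : R) :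
  0 <= L -> 0 <= K -> density L wB -> eq_off_null wk wB ->
  yudovich_solution (fun t => rotf (Om * t) wk) ->
  (forall s x, enorm x < L ->
    [/\ `|'D_(1, (0, 0)) (wave L m Om c) (s, x)| <= K,
        `|'D_(0, (1, 0)) (wave L m Om c) (s, x)| <= K,
        `|'D_(0, (0, 1)) (wave L m Om c) (s, x)| <= K &
        `|wave L m Om c (s, x)| <= K]) ->
  yudovich_solution W -> 0 <= t -> t <= t' ->
  (forall s, 0 <= s <= t' -> density L (V s) /\ eq_off_null (W s) (V s) /\
    (\int[leb2]_x `|V s x - rotf (Theta s) wB x|%:E <= eps%:E)%E) ->
  `|\int[leb2]_x (rotf (Theta t') wB x * wave L m Om c (t', x)) -
    \int[leb2]_x (rotf (Theta t) wB x * wave L m Om c (t, x))| <=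
  K * (1 + 6 * majorant_mass L) * eps * (t' - t) + 2 * (K * eps).
Proof.
move=> L0 K0 dB wkB kel bnd sol t0 tt' VP.
have t'0 := le_trans t0 tt'.
set f := wave L m Om c.
have Gle s : 0 <= s <= t' -> `|Lam f (W s) s| <= K * (1 + 6 * majorant_mass L) * eps.
  move=> st; have [dV [WV dist]] := VP s st.
  rewrite (Lam_eq_off_null _ _ WV).
  rewrite -[X in `|X|]subr0 -(Lam_rotated_wave m c (Theta s) s L0 dB wkB kel).
  have [ma m1 m2] := measurable_derive_wave L m Om c s.
  apply: (transport_lipschitz L0 K0 ma m1 m2 _ dV (density_rotf _ dB) dist).
  by move=> x /(bnd s x)[h0 h1 h2 _]; split; [exact: h0|exact: h1|exact: h2].
have weak u : 0 <= u -> \int[leb2]_x (W u x * f (u, x)) -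
    \int[leb2]_x (W 0 x * f (0, x)) =
    \int[lebesgue_measure]_(s in `[0, u]) Lam f (W s) s.
  exact: (yudovich_weak sol (test_function_wave m Om c L0)).
have inc := Rintegral_itv_increment t0 tt' Gle.
rewrite -!weak// opprB addrA subrK in inc.
have close s : 0 <= s <= t' ->
    `|\int[leb2]_x (W s x * f (s, x)) -
      \int[leb2]_x (rotf (Theta s) wB x * f (s, x))| <= K * eps.
  move=> st; have [dV [WV dist]] := VP s st.
  rewrite (Rintegral_eq_off_null _ WV).
  apply: (Rintegral_dist_le L0 K0 dV (density_rotf _ dB) _ _ dist).
    exact: measurable_wave.
  by move=> x /(bnd s x)[_ _ _ h]; exact: h.
have ct : `|_| <= _ := close t ltac:(by rewrite t0).
have ct' : `|_| <= _ := close t' ltac:(by rewrite t'0 lexx).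
have triangle (p q r s d E : R) : `|p - q| <= E -> `|q - s| <= d -> `|p - r| <= d ->
    `|r - s| <= E + 2 * d.
  rewrite !ler_norml => /andP[? ?] /andP[? ?] /andP[? ?].
  by apply/andP; split; lra.
exact: triangle inc ct ct'.
Qed.

End Tracking.

(** * The phase estimate *)

Lemma kelvin_small (R : realType) (m : nat) (g : R -> R -> R) (Om : R -> R) (e : R) :
  (0 < m)%N -> kelvin_waves m g Om -> 0 < e ->
  exists2 d, 0 < d & forall b, 0 < b <= d ->
    [/\ forall a, `|g b a - b * cos (m%:R * a)| <= e * b,
        polar_patch (g b) `<=` Ball 2,
        yudovich_solution (fun t => rotf (Om b * t) \1_(polar_patch (g b))) &
        `|Om b| <= 1].
Proof.
move=> m0 kw e0.
have [d1 d10 H1] := at_right0_interval (kelvin_asymptotics kw e0).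
have [d2 d20 H2] := at_right0_interval (kelvin_C1 kw (e := 1 / 2) ltac:(by rewrite divr_gt0)).
have [d3 d30 H3] := at_right0_interval (kelvin_rotates kw).
have mp : 0 < m%:R :> R by rewrite ltr0n.
have lim1 : `|(m%:R - 1) / (2 * m%:R)| < 1 :> R.
  have m1 : 1 <= m%:R :> R by rewrite ler1n.
  rewrite ger0_norm ?divr_ge0 ?mulr_ge0 ?subr_ge0// ltr_pdivrMr ?mulr_gt0//; lra.
have [d4 d40 H4] : exists2 d, 0 < d & forall b, 0 < b <= d -> `|Om b| <= 1.
  have H : \forall b \near (0 : R)^'+, `|Om b| <= 1.
    exact: (cvgr_norm_le _ (kelvin_velocity kw) _ lim1).
  exact: at_right0_interval H.
exists (Num.min (Num.min d1 d2) (Num.min d3 d4)).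
  by rewrite !lt_min d10 d20 d30 d40.
move=> b /andP[b0]; rewrite !le_min => /andP[/andP[b1 b2] /andP[b3 b4]]; split.
- by apply: H1; rewrite b0.
- move=> x [r [a [r0 rg ->]]]; rewrite /Ball /= enorm_polar//.
  have /H2/(_ a)[ga _] : 0 < b <= d2 by rewrite b0.
  by move: ga; rewrite ler_norml => /andP[_ ga]; lra.
- by apply: H3; rewrite b0.
- by apply: H4; rewrite b0.
Qed.

(** The moments against two test functions a quarter period apart are the two
coordinates of one rotated vector, and [Tm_le] reads the angle off them.  Both
orders of the two times are stated because the two values of Tm differ by more
than a sign at the end of its range. *)
Lemma phase_increment (R : realType) (m : nat) (L : R) : (0 < m)%N -> 2 <= L ->
  exists e c C b1 : R, [/\ 0 < e, 0 < c, 0 <= C, 0 < b1 &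
  forall (b eps Om : R) (g : R -> R) (A : R -> set (R * R)) (Theta : R -> R) (t t' : R),
    0 < b <= b1 -> 0 <= eps -> `|Om| <= 1 ->
    (forall a, `|g a - b * cos (m%:R * a)| <= e * b) ->
    polar_patch g `<=` Ball 2 ->
    yudovich_solution (fun t => rotf (Om * t) \1_(polar_patch g)) ->
    yudovich_solution (fun t => \1_(A t)) ->
    0 <= t -> t <= t' -> t' - t <= 1 ->
    (forall s, 0 <= s <= t' -> A s `<=` Ball L) ->
    (forall s, 0 <= s <= t' ->
      (L1norm (\1_(A s) \- rotf (Theta s) \1_(polar_patch g))%R <= eps%:E)%E) ->
    `|Tm m ((Theta t' - Om * t') - (Theta t - Om * t))| <= 6 * (C * eps) / (c * b) /\
    `|Tm m ((Theta t - Om * t) - (Theta t' - Om * t'))| <= 6 * (C * eps) / (c * b)].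
Proof.
move=> m0 L2; have L0 : 0 <= L by lra.
have [e [c [b1 [e0 c0 b10 low]]]] := moment_lower_bound m0 L2.
have [K K0 KB] := wave_bounds m L0.
set C := K * (1 + 6 * majorant_mass L) + 2 * K.
have C0 : 0 <= C.
  by rewrite addr_ge0 ?mulr_ge0// addr_ge0// mulr_ge0// majorant_mass_ge0.
exists e, c, C, b1; split => //.
move=> b eps Om g A Theta t t' bb eps0 Om1 gE g2 kel sol t0 tt' t1 AL AE.
set w := \1_(polar_patch g) : R * R -> R.
have mP : lebesgue_measurable (polar_patch g).
  apply: lebesgue_measurable_of_indic.
  have := yudovich_meas kel (lexx 0); congr lebesgue_measurable_fun.
  by apply/funext => x; rewrite /rotf /= mulr0 oppr0 rot0.
have PL : polar_patch g `<=` Ball L.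
  by move=> x /g2; rewrite /Ball /= => h; exact: lt_le_trans h L2.
have [wB dB wwB] := borel_version_indic mP PL.
have VE s : exists V, 0 <= s <= t' -> density L V /\ eq_off_null \1_(A s) V /\
    (\int[leb2]_x `|V x - rotf (Theta s) wB x|%:E <= eps%:E)%E.
  have [st|/negP st] := boolP (0 <= s <= t'); last by exists w.
  have mA : lebesgue_measurable (A s).
    apply: lebesgue_measurable_of_indic; apply: (yudovich_meas sol).
    by have /andP[] := st.
  have [V dV AV] := borel_version_indic mA (AL s st).
  exists V => _; split=> //; split=> //.
  have := AE s st; rewrite L1norm_dist.
  by rewrite (integral_dist_eq_off_null AV (eq_off_null_rotf (Theta s) wwB)).
have [V VP] := choice VE.
set u := \int[leb2]_x (wB x * mode_cos L m x).
set v := \int[leb2]_x (wB x * mode_sin L m x).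
have ub : c * b <= u := low b g wB bb gE dB wwB.
have [b0 _] := andP bb.
have cb0 : 0 < c * b by exact: mulr_gt0.
have u0 : 0 < u by exact: lt_le_trans ub.
have inc d : `|(cos (m%:R * (Theta t' - Om * t' - d)) * u -
                sin (m%:R * (Theta t' - Om * t' - d)) * v) -
               (cos (m%:R * (Theta t - Om * t - d)) * u -
                sin (m%:R * (Theta t - Om * t - d)) * v)| <= C * eps.
  rewrite -!(moment_rotated m Om d _ _ L0 dB).
  apply: le_trans (moment_increment (K := K) L0 K0 dB wwB kel _ sol t0 tt' VP) _.
    by move=> s x xL; exact: (KB Om d s x Om1 xL).
  have -> : C * eps = K * (1 + 6 * majorant_mass L) * eps + 2 * (K * eps).
    by rewrite /C; ring.
  apply: lerD => //; rewrite ler_piMr// !mulr_ge0// addr_ge0// mulr_ge0//.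
  exact: majorant_mass_ge0.
have mpi : m%:R * (pi / 2 / m%:R) = pi / 2 :> R.
  by rewrite mulrC divfK// pnatr_eq0 -lt0n.
have uE : 6 * (C * eps) / u <= 6 * (C * eps) / (c * b).
  by rewrite ler_wpM2l ?mulr_ge0// lef_pV2 ?posrE.
have X := inc 0; rewrite !subr0 in X.
(* The phase shift by a quarter period of the mode gives the second coordinate
of the rotated moment. *)
have Y := inc (pi / 2 / m%:R).
rewrite ![m%:R * (_ - pi / 2 / m%:R)]mulrBr mpi !cosBpihalf !sinBpihalf !mulNr !opprK in Y.
have CE := mulr_ge0 C0 eps0.
split; apply: le_trans uE; first exact: (Tm_le m0 u0 CE X Y).
by rewrite distrC in X; rewrite distrC in Y; exact: (Tm_le m0 u0 CE X Y).
Qed.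

Theorem proposition1p4 (R : realType) (m : nat) (g : R -> R -> R) (Om : R -> R)
    (rbar bbar : R) :
  (2 <= m)%N -> kelvin_waves m g Om ->
  orbital_stability_constants m g rbar bbar ->
  exists C0 c0 b0 : R, [/\ 0 < C0, 0 < c0, 0 < b0 &
    forall b eps delta : R,
      0 < b <= Num.min b0 bbar -> 0 < eps <= c0 * b ^+ 2 ->
      0 < delta -> admissible m g rbar b eps delta ->
    forall (A0 : set (R * R)) (A : R -> set (R * R)) (T : \bar R)
        (Theta : R -> R),
      confined_patch m (g b) rbar delta A0 A T ->
      tracks (g b) A T eps Theta ->
    forall t t' : R,
      0 <= t -> (t%:E < T)%E -> 0 <= t' -> (t'%:E < T)%E ->
      `|t - t'| <= c0 * b ->
      `|Tm m (Theta t' - (Theta t + Om b * (t' - t)))| <= C0 * Num.sqrt eps].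
Proof.
move=> m2 kw _.
have m0 : (0 < m)%N by exact: leq_trans m2.
pose L := Num.max rbar 2.
have L2 : 2 <= L by rewrite le_max lexx orbT.
have [e [c [C [b1 [e0 c0 C0 b10 main]]]]] := phase_increment m0 L2.
have [d d0 small] := kelvin_small m0 kw e0.
pose b0 := Num.min 1 (Num.min b1 d).
exists (6 * C / c + 1), 1, b0; split => //.
- by rewrite ltr_wpDl// divr_ge0 ?mulr_ge0// ltW.
- by rewrite !lt_min ltr01 b10 d0.
move=> b eps delta /andP[bp]; rewrite !le_min => /andP[/andP[b_1 /andP[bb1 bd]] _].
move=> /andP[eps0 epsb] _ _ A0 A T Theta [_ [[sol _] _ AT]] tr t t' t0 tT t'0 t'T.
rewrite mul1r in epsb *; move=> tt'.
have [gE g2 kel Om1] : [/\ forall a, `|g b a - b * cos (m%:R * a)| <= e * b,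
    polar_patch (g b) `<=` Ball 2,
    yudovich_solution (fun t => rotf (Om b * t) \1_(polar_patch (g b))) &
    `|Om b| <= 1] by apply: small; rewrite bp.
have bb : 0 < b <= b1 by rewrite bp.
have AL s : 0 <= s -> (s%:E < T)%E -> A s `<=` Ball L.
  move=> s0 sT x Ax; have : Ball rbar x by apply: AT; exists s.
  by rewrite /Ball /= => h; apply: lt_le_trans h _; rewrite le_max lexx.
have AE s : 0 <= s -> (s%:E < T)%E ->
    (L1norm (\1_(A s) \- rotf (Theta s) \1_(polar_patch (g b)))%R <= eps%:E)%E.
  by move=> s0 sT; apply: le_trans tr; apply: ereal_sup_ubound; exists s.
have bound p q : 0 <= p -> p <= q -> (q%:E < T)%E -> q - p <= b ->
    `|Tm m ((Theta q - Om b * q) - (Theta p - Om b * p))| <= 6 * (C * eps) / (c * b) /\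
    `|Tm m ((Theta p - Om b * p) - (Theta q - Om b * q))| <= 6 * (C * eps) / (c * b).
  move=> p0 pq qT qpb.
  have inT s : s <= q -> (s%:E < T)%E by move=> sq; apply: le_lt_trans qT; rewrite lee_fin.
  apply: (main b eps (Om b) (g b) A Theta p q bb (ltW eps0) Om1 gE g2 kel sol p0 pq).
  - exact: le_trans qpb b_1.
  - by move=> s /andP[s0 /inT sT]; exact: AL.
  - by move=> s /andP[s0 /inT sT]; exact: AE.
have fin : 6 * (C * eps) / (c * b) <= (6 * C / c + 1) * Num.sqrt eps.
  have s0 : 0 <= Num.sqrt eps by exact: sqrtr_ge0.
  have sb : Num.sqrt eps <= b.
    by rewrite -[leRHS](gtr0_norm bp) -sqrtr_sqr ler_wsqrtr.
  have sE : eps = Num.sqrt eps * Num.sqrt eps by rewrite -expr2 sqr_sqrtr// ltW.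
  apply: (@le_trans _ _ (6 * C / c * Num.sqrt eps)); last by rewrite [leRHS]mulrDl mul1r lerDl.
  have -> : 6 * (C * eps) / (c * b) = 6 * C / c * (Num.sqrt eps * (Num.sqrt eps / b)).
    by rewrite {1}sE; field; rewrite !gt_eqF.
  apply: ler_wpM2l; first by rewrite divr_ge0 ?mulr_ge0// ltW.
  by rewrite ler_piMr// ler_pdivrMr// mul1r.
apply: le_trans fin.
have -> : Theta t' - (Theta t + Om b * (t' - t)) =
    (Theta t' - Om b * t') - (Theta t - Om b * t) by ring.
move: tt'; rewrite ler_norml => /andP[tt1 tt2].
have [le_tt'|/ltW le_t't] := leP t t'.
  by have [] := bound t t' t0 le_tt' t'T ltac:(lra).
by have [] := bound t' t t'0 le_t't tT ltac:(lra).
Qed.
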